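(* Let $k$ be an algebraically closed field and let $A=kQ$ where $Q$ is a finite connected quiver without oriented cycle. Let $T$ be a basic tilting $A$-module and let $B=\mathrm{End}_A(T)$ (hence $B$ is tilted of type $Q$). If $B$ is simply connected, then $Q$ is a tree and $HH^1(B)=0$.
   Context: $HH^1(B)$ is the first Hochschild cohomology group of $B$ with coefficients in the bimodule $B$. ''$Q$ is a tree'' means its underlying graph is a tree. A tilting $A$-module is a finite dimensional left $A$-module $T$ such that $T$ has finite projective dimension, $\mathrm{Ext}^i_A(T,T)=0$ for all $i>0$, and there is an exact sequence $0\to A\to T_1\to\cdots\to T_r\to 0$ with all $T_j$ direct sums of direct summands of $T$. It is basic if it is a direct sum of pairwise non-isomorphic indecomposable modules. $k$-categories. A $k$-category is a small category $\mathcal C$ whose morphism sets ${}_y\mathcal C_x$ (from $x$ to $y$) are $k$-vector spaces with bilinear composition; functors are $k$-linear. It is connected if there is no non trivial partition $\mathrm{Ob}(\mathcal C)=E\sqcup F$ with ${}_y\mathcal C_x={}_x\mathcal C_y=0$ for all $x\in E,y\in F$. It is locally bounded if distinct objects are non-isomorphic, $\bigoplus_y{}_y\mathcal C_x$ and $\bigoplus_y{}_x\mathcal C_y$ are finite dimensional for all $x$, and every ${}_x\mathcal C_x$ is local. If $T=T_1\oplus\cdots\oplus T_n$ with $T_i$ indecomposable, $B=\mathrm{End}_A(T)$ is viewed as the locally bounded $k$-category with objects $T_1,\dots,T_n$ and morphisms from $T_i$ to $T_j$ equal to $\mathrm{Hom}_A(T_i,T_j)$. Simple connectedness. A Galois covering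 of $\mathcal B$ with group $G$ is a functor $F:\mathcal E\to\mathcal B$ with a group morphism $G\to\mathrm{Aut}(F)=\{g\in\mathrm{Aut}(\mathcal E)\mid F\circ g=F\}$ such that the induced action of $G$ on $\mathrm{Ob}(\mathcal E)$ is free and the functor $\mathcal E/G\to\mathcal B$ induced by $F$ is an isomorphism. It is called connected if $\mathcal E$ is connected and locally bounded, and proper if $G$ is non trivial. A locally bounded $k$-category $\mathcal B$ is simply connected if it has no proper connected Galois covering. *)

(* Defs.v *)
From HB Require Import structures.
From mathcomp Require Import all_boot all_order all_algebra finmap generic_quotient.
From mathcomp Require Import mathcomp_extra boolp classical_sets functions cardinality fsbigop.
From mathcomp.multinomials Require Import monalg.

Set Implicit Arguments.
Unset Strict Implicit.
Unset Printing Implicit Defensive.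

Import GRing.Theory.
Local Open Scope ring_scope.

(* Finite quivers are taken to be non-empty, so that the path algebra is a
   non-zero ring, as [algType] requires. *)
Record quiver := Quiver {
  vert : finType;
  arr : finType;
  src : arr -> vert;
  tgt : arr -> vert;
  vert_gt0 : (0 < #|vert|)%N
}.

Section Quiver.
Variable Q : quiver.

Fixpoint walk (x : vert Q) (s : seq (arr Q)) : bool :=
  if s is a :: s' then (src a == x) && walk (tgt a) s' else true.

Definition walk_end (x : vert Q) (s : seq (arr Q)) : vert Q :=
  last x [seq tgt a | a <- s].

Definition no_oriented_cycle : Prop :=
  forall (x : vert Q) (s : seq (arr Q)),
    s != [::] -> walk x s -> walk_end x s != x.

(* A path is its source vertex together with its sequence of arrows, in the order
   in which they are traversed; the sequence is empty for a trivial path. *)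
Record qpath := QPath {
  qpath_val : vert Q * seq (arr Q);
  qpath_walk : walk qpath_val.1 qpath_val.2
}.
HB.instance Definition _ := [isSub for qpath_val].
HB.instance Definition _ := [Choice of qpath by <:].

Definition psrc (p : qpath) : vert Q := (qpath_val p).1.
Definition parr (p : qpath) : seq (arr Q) := (qpath_val p).2.
Definition ptgt (p : qpath) : vert Q := walk_end (psrc p) (parr p).
Definition pid (x : vert Q) : qpath := @QPath (x, [::]) isT.
(* [pcomp p q] is the path q followed by p (arrows compose like functions). *)
Definition pcomp (p q : qpath) : option qpath :=
  if ptgt q == psrc p then insub (psrc q, parr q ++ parr p) else None.

Lemma walk_cat x s t : walk x (s ++ t) = walk x s && walk (walk_end x s) t.
Proof. by elim: s x => //= a s IH x; rewrite IH andbA. Qed.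

Lemma walk_end_cat x s t : walk_end x (s ++ t) = walk_end (walk_end x s) t.
Proof. by rewrite /walk_end map_cat last_cat. Qed.

Lemma pcompP p q : ptgt q = psrc p ->
  exists2 r, pcomp p q = Some r & val r = (psrc q, parr q ++ parr p).
Proof.
move=> e; rewrite /pcomp e eqxx.
have w : walk (psrc q, parr q ++ parr p).1 (psrc q, parr q ++ parr p).2.
  by rewrite /= walk_cat (valP q) -/(ptgt q) e (valP p).
by rewrite insubT; exists (QPath w).
Qed.

Lemma pcomp_bindA p q r :
  obind (pcomp p) (pcomp q r) = obind (fun s => pcomp s r) (pcomp p q).
Proof.
have [erq|nrq] := eqVneq (ptgt r) (psrc q); last first.
  rewrite /pcomp (negPf nrq) /=.
  case: eqP => // e; case: insubP => //= s _ es.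
  by rewrite [psrc s]/psrc es /= (negPf nrq).
have [s es vs] := pcompP erq.
have ts : ptgt s = ptgt q.
  by rewrite /ptgt /psrc /parr vs /= walk_end_cat -/(ptgt r) erq.
have [eqp|nqp] := eqVneq (ptgt q) (psrc p); last first.
  by rewrite es /= /pcomp ts (negPf nqp).
have [t et vt] := pcompP eqp; rewrite es et /=.
have [u -> vu] : exists2 r, pcomp p s = Some r & val r = (psrc s, parr s ++ parr p).
  by apply: pcompP; rewrite ts.
have [v -> vv] : exists2 v, pcomp t r = Some v & val v = (psrc r, parr r ++ parr t).
  by apply: pcompP; rewrite /psrc vt.
congr Some; apply: val_inj; rewrite vu vv /psrc /parr vs vt /=.
by rewrite catA.
Qed.

Lemma pcomp_idl x p : pcomp (pid x) p = if x == ptgt p then Some p else None.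
Proof.
rewrite /pcomp eq_sym; case: eqP => //= _; rewrite [parr (pid x)]/parr /= cats0.
by rewrite [(_, _)](_ : _ = val p) ?valK // [RHS]surjective_pairing.
Qed.

Lemma pcomp_idr x p : pcomp p (pid x) = if x == psrc p then Some p else None.
Proof.
rewrite /pcomp /= /ptgt /walk_end /=; case: eqP => //= ->.
by rewrite [(_, _)](_ : _ = val p) ?valK // [RHS]surjective_pairing.
Qed.

End Quiver.

Lemma bilinear_assoc (k : fieldType) (V : lmodType k) (I : Type) (u : I -> V)
    (mul : V -> V -> V) :
  (forall P : V -> Prop, P 0 -> (forall f g, P f -> P g -> P (f + g)) ->
     (forall c i, P (c *: u i)) -> forall f, P f) ->
  left_distributive mul +%R -> right_distributive mul +%R ->
  (forall c f g, c *: mul f g = mul (c *: f) g) ->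
  (forall c f g, c *: mul f g = mul f (c *: g)) ->
  (forall i j l, mul (u i) (mul (u j) (u l)) = mul (mul (u i) (u j)) (u l)) ->
  associative mul.
Proof.
move=> ind mDl mDr mZl mZr mA.
have m0l f : mul 0 f = 0 by rewrite -[X in mul X _](scale0r 0) -mZl scale0r.
have m0r f : mul f 0 = 0 by rewrite -[X in mul _ X](scale0r 0) -mZr scale0r.
move=> f g h; elim/ind: f => [|f1 f2 E1 E2|a p].
- by rewrite !m0l.
- by rewrite !mDl E1 E2.
elim/ind: g => [|g1 g2 E1 E2|b q].
- by rewrite !(m0r, m0l).
- by rewrite !(mDl, mDr) E1 E2.
elim/ind: h => [|h1 h2 E1 E2|c r].
- by rewrite !m0r.
- by rewrite !mDr E1 E2.
rewrite -(mZl b) -(mZr c (u q)) -(mZl a) -(mZr b) -(mZr c _ (mul _ _)) mA.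
by rewrite -(mZl a) -(mZr b (u p)) -(mZl a) -(mZl b) -(mZr c).
Qed.

Section PathAlgebra.
Variables (k : fieldType) (Q : quiver).

(* kQ: finitely supported functions from paths to k, with the bilinear product
   extending [pcomp], non-composable paths having product 0. *)
Definition path_algebra : Type := {malg k[qpath Q]}.
HB.instance Definition _ := GRing.Lmodule.copy path_algebra {malg k[qpath Q]}.

Definition path_elt (p : qpath Q) : path_algebra := << p >>.

Definition opath_elt (o : option (qpath Q)) : path_algebra :=
  if o is Some r then path_elt r else 0.

Definition pamul (f g : path_algebra) : path_algebra :=
  \sum_(p <- msupp f) \sum_(q <- msupp g) (f@_p * g@_q) *: opath_elt (pcomp p q).
Definition pa1 : path_algebra := \sum_(x : vert Q) path_elt (pid x).

Lemma pamulw (d1 d2 : {fset qpath Q}) (f g : path_algebra) :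
  (msupp f `<=` d1)%fset -> (msupp g `<=` d2)%fset ->
  pamul f g = \sum_(p <- d1) \sum_(q <- d2) (f@_p * g@_q) *: opath_elt (pcomp p q).
Proof.
move=> le1 le2; rewrite /pamul (big_fset_incl _ le1) /=.
  apply/eq_bigr => p _; apply/big_fset_incl => // q _ /mcoeff_outdom ->.
  by rewrite mulr0 scale0r.
move=> p _ /mcoeff_outdom fp.
by rewrite big1 // => q _; rewrite fp mul0r scale0r.
Qed.

Lemma pamulDl : left_distributive pamul +%R.
Proof.
move=> f g h.
rewrite (pamulw (msuppD_le f g) (fsubset_refl _)).
rewrite (pamulw (fsubsetUl (msupp f) (msupp g)) (fsubset_refl _)).
rewrite (pamulw (fsubsetUr (msupp f) (msupp g)) (fsubset_refl _)).
rewrite -big_split /=; apply/eq_bigr => p _.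
rewrite -big_split /=; apply/eq_bigr => q _.
by rewrite mcoeffD mulrDl scalerDl.
Qed.

Lemma pamulDr : right_distributive pamul +%R.
Proof.
move=> h f g.
rewrite (pamulw (fsubset_refl _) (msuppD_le f g)).
rewrite (pamulw (fsubset_refl _) (fsubsetUl (msupp f) (msupp g))).
rewrite (pamulw (fsubset_refl _) (fsubsetUr (msupp f) (msupp g))).
rewrite -big_split /=; apply/eq_bigr => p _.
rewrite -big_split /=; apply/eq_bigr => q _.
by rewrite mcoeffD mulrDr scalerDl.
Qed.

Lemma pamulZl c f g : c *: pamul f g = pamul (c *: f) g.
Proof.
rewrite (pamulw (msuppZ_le c f) (fsubset_refl _)) scaler_sumr.
apply/eq_bigr => p _; rewrite scaler_sumr; apply/eq_bigr => q _.
by rewrite mcoeffZ scalerA mulrA.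
Qed.

Lemma pamulZr c f g : c *: pamul f g = pamul f (c *: g).
Proof.
rewrite (pamulw (fsubset_refl _) (msuppZ_le c g)) scaler_sumr.
apply/eq_bigr => p _; rewrite scaler_sumr; apply/eq_bigr => q _.
by rewrite mcoeffZ scalerA mulrCA.
Qed.

Lemma pamul0l f : pamul 0 f = 0.
Proof. by rewrite -[X in pamul X _](scale0r 0) -pamulZl scale0r. Qed.
Lemma pamul0r f : pamul f 0 = 0.
Proof. by rewrite -[X in pamul _ X](scale0r 0) -pamulZr scale0r. Qed.

Lemma pamulUU p q : pamul (path_elt p) (path_elt q) = opath_elt (pcomp p q).
Proof.
rewrite (@pamulw [fset p]%fset [fset q]%fset) ?msuppU_le // !big_seq_fset1.
by rewrite /path_elt !mcoeffUU mulr1 scale1r.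
Qed.

Lemma pamulUo p o :
  pamul (path_elt p) (opath_elt o) = opath_elt (obind (pcomp p) o).
Proof. by case: o => [q|] /=; [exact: pamulUU | exact: pamul0r]. Qed.

Lemma pamuloU p o :
  pamul (opath_elt o) (path_elt p) = opath_elt (obind (fun q => pcomp q p) o).
Proof. by case: o => [q|] /=; [exact: pamulUU | exact: pamul0l]. Qed.

Lemma pa_ind (P : path_algebra -> Prop) :
    P 0 -> (forall f g, P f -> P g -> P (f + g)) ->
    (forall c p, P (c *: path_elt p)) -> forall f, P f.
Proof.
move=> P0 PD PU f; rewrite [f]monalgE; elim/big_ind: _ => // p _.
suff -> : << f@_p *g p >> = f@_p *: path_elt p :> path_algebra by exact: PU.
move: (f@_p) => c; apply/malgP => q; rewrite mcoeffZ.
apply: etrans (mcoeffU p c q) _.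
have -> : (path_elt p)@_q = 1 *+ (p == q) := mcoeffU p 1 q.
by case: (p == q); rewrite ?mulr1n ?mulr0n ?mulr1 ?mulr0.
Qed.

Lemma pamulA : associative pamul.
Proof.
apply: (bilinear_assoc pa_ind pamulDl pamulDr pamulZl pamulZr) => p q r.
rewrite (congr1 (pamul (path_elt p)) (pamulUU q r)) pamulUo pcomp_bindA.
by rewrite (congr1 (pamul^~ (path_elt r)) (pamulUU p q)) pamuloU.
Qed.

Lemma pamul1l : left_id pa1 pamul.
Proof.
elim/pa_ind => [|f1 f2 E1 E2|c p]; first exact: pamul0r.
  by rewrite pamulDr E1 E2.
rewrite -pamulZr; congr (_ *: _); rewrite /pa1.
rewrite (big_morph (pamul^~ _) (fun x y => pamulDl x y _) (pamul0l _)).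
rewrite (bigD1 (ptgt p)) //= pamulUU pcomp_idl eqxx.
by rewrite big1 ?addr0 // => x /negPf nx; rewrite pamulUU pcomp_idl nx.
Qed.

Lemma pamul1r : right_id pa1 pamul.
Proof.
elim/pa_ind => [|f1 f2 E1 E2|c p]; first exact: pamul0l.
  by rewrite pamulDl E1 E2.
rewrite -pamulZl; congr (_ *: _); rewrite /pa1.
rewrite (big_morph (pamul _) (fun x y => pamulDr _ x y) (pamul0r _)).
rewrite (bigD1 (psrc p)) //= pamulUU pcomp_idr eqxx.
by rewrite big1 ?addr0 // => x /negPf nx; rewrite pamulUU pcomp_idr nx.
Qed.

Lemma pa1_neq0 : pa1 != 0.
Proof.
case/card_gt0P: (vert_gt0 Q) => x _.
apply/eqP => /malgP /(_ (pid x)); rewrite mcoeff0 raddf_sum /= (bigD1 x) //=.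
rewrite (mcoeffUU (pid x) 1) big1 => [/eqP|y nyx]; first by rewrite addr0 oner_eq0.
rewrite (mcoeffU (pid y) 1 (pid x)).
by case: eqP => // /(congr1 (@psrc Q)) eyx; move: nyx; rewrite [y]eyx eqxx.
Qed.

HB.instance Definition _ := GRing.Zmodule_isNzRing.Build path_algebra
  pamulA pamul1l pamul1r pamulDl pamulDr pa1_neq0.
HB.instance Definition _ := GRing.Lmodule_isLalgebra.Build k path_algebra pamulZl.
HB.instance Definition _ := GRing.Lalgebra_isAlgebra.Build k path_algebra pamulZr.

End PathAlgebra.

Section Graph.
Variable Q : quiver.

(* Arrows of the double quiver: (a, false) is a, (a, true) is a reversed; its paths
   are the walks in the underlying graph of Q. *)
Definition double_quiver : quiver :=
  @Quiver (vert Q) (arr Q * bool)%type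
    (fun a => if a.2 then tgt a.1 else src a.1)
    (fun a => if a.2 then src a.1 else tgt a.1) (vert_gt0 Q).

Definition quiver_connected : Prop :=
  forall x y : vert double_quiver, exists2 s : seq (arr double_quiver), walk x s & walk_end x s = y.

(* The underlying graph is a multigraph: a loop is a cycle, and so is a pair of
   distinct parallel (or opposite) arrows; going along an arrow and back is not. *)
Definition graph_cycle (x : vert double_quiver) (s : seq (arr double_quiver)) : Prop :=
  [/\ s != [::], walk x s, walk_end x s = x,
      uniq [seq tgt a | a <- s] & uniq [seq a.1 | a <- s]].

Definition is_tree : Prop :=
  quiver_connected /\ forall x s, ~ graph_cycle x s.
End Graph.

Definition trivial_module (R : pzRingType) (M : lmodType R) : Prop := forall x : M, x = 0.

Definition fin_dim (k : fieldType) (V : lmodType k) : Prop :=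
  exists n (b : 'I_n -> V), forall v, exists c : 'I_n -> k, v = \sum_i c i *: b i.

Section Modules.
Variables (k : fieldType) (A : algType k).
Implicit Types M N : lmodType A.

Definition restr_scalars M : Type := M.

Section RestrScalars.
Variable M : lmodType A.
HB.instance Definition _ := GRing.Zmodule.on (restr_scalars M).
Definition restr_scale (c : k) (x : restr_scalars M) : restr_scalars M :=
  c%:A *: (x : M).
Fact restr_scaleA a b x : restr_scale a (restr_scale b x) = restr_scale (a * b) x.
Proof. by rewrite /restr_scale scalerA -scalerAl mul1r scalerA. Qed.
Fact restr_scale1 : left_id 1 restr_scale.
Proof. by move=> x; rewrite /restr_scale !scale1r. Qed.
Fact restr_scaleDr : right_distributive restr_scale +%R.
Proof. by move=> a x y; rewrite /restr_scale scalerDr. Qed.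
Fact restr_scaleDl x : {morph restr_scale^~ x : a b / a + b}.
Proof. by move=> a b; rewrite /restr_scale !scalerDl. Qed.
HB.instance Definition _ := GRing.Zmodule_isLmodule.Build k (restr_scalars M)
  restr_scaleA restr_scale1 restr_scaleDr restr_scaleDl.
End RestrScalars.

(* [modhom M N] is a copy of {linear M -> N} carrying the k-vector space structure
   (c f)(x) = c f(x). *)
Definition modhom M N : Type := {linear M -> N}.
Definition hom_map M N (f : modhom M N) : {linear M -> N} := f.
Coercion hom_map : modhom >-> GRing.Linear.type.

Section HomSpace.
Variables M N : lmodType A.
Implicit Types f g : modhom M N.

Lemma hom_ext f g : (forall x, f x = g x) -> f = g.
Proof.
move=> /funext; rewrite /hom_map; case: f g => [f [[f1] [f2]]] [g [[g1] [g2]]] /= e.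
case: _ / e in g1 g2 *.
by rewrite (Prop_irrelevance f1 g1) (Prop_irrelevance f2 g2).
Qed.

HB.instance Definition _ := gen_eqMixin (modhom M N).
HB.instance Definition _ := gen_choiceMixin (modhom M N).

Definition mk_hom (f : M -> N) (lf : linear f) : modhom M N :=
  HB.pack f (GRing.isLinear.Build A M N *:%R f lf).

Fact hom0_linear : linear (fun _ : M => 0 : N).
Proof. by move=> a x y; rewrite scaler0 addr0. Qed.
Fact homD_linear f g : linear (fun x => f x + g x).
Proof. by move=> a x y; rewrite !linearP scalerDr addrACA. Qed.
Fact homN_linear f : linear (fun x => - f x).
Proof. by move=> a x y; rewrite linearP opprD scalerN. Qed.
Fact homZ_linear (c : k) f : linear (fun x => c%:A *: f x).
Proof.
move=> a x y; rewrite linearP scalerDr !scalerA; congr (_ *: _ + _).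
by rewrite -scalerAl mul1r -scalerAr mulr1.
Qed.

Definition hom0 : modhom M N := mk_hom hom0_linear.
Definition homD f g : modhom M N := mk_hom (homD_linear f g).
Definition homN f : modhom M N := mk_hom (homN_linear f).
Definition homZ (c : k) f : modhom M N := mk_hom (homZ_linear c f).

Fact homDA : associative homD.
Proof. by move=> f g h; apply: hom_ext => x /=; rewrite addrA. Qed.
Fact homDC : commutative homD.
Proof. by move=> f g; apply: hom_ext => x /=; rewrite addrC. Qed.
Fact hom0D : left_id hom0 homD.
Proof. by move=> f; apply: hom_ext => x /=; rewrite add0r. Qed.
Fact homND : left_inverse hom0 homN homD.
Proof. by move=> f; apply: hom_ext => x /=; rewrite addNr. Qed.
HB.instance Definition _ := GRing.isZmodule.Build (modhom M N) homDA homDC hom0D homND.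

Fact homZA a b f : homZ a (homZ b f) = homZ (a * b) f.
Proof. by apply: hom_ext => x /=; rewrite scalerA -scalerAl mul1r scalerA. Qed.
Fact homZ1 : left_id 1 homZ.
Proof. by move=> f; apply: hom_ext => x /=; rewrite !scale1r. Qed.
Fact homZDr : right_distributive homZ +%R.
Proof. by move=> a f g; apply: hom_ext => x /=; rewrite scalerDr. Qed.
Fact homZDl f : {morph homZ^~ f : a b / a + b}.
Proof. by move=> a b; apply: hom_ext => x /=; rewrite !scalerDl. Qed.
HB.instance Definition _ := GRing.Zmodule_isLmodule.Build k (modhom M N)
  homZA homZ1 homZDr homZDl.
End HomSpace.

Definition hom_id M : modhom M M := (idfun : {linear M -> M}).
Definition hom_comp L M N (g : modhom M N) (f : modhom L M) : modhom L N :=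
  (g \o f : {linear L -> N}).

Definition module_iso M N : Prop := exists f : modhom M N, bijective f.

Definition direct_sum n (X : 'I_n -> lmodType A) M : Prop :=
  exists inj : forall i, modhom (X i) M,
    bijective (fun x : (forall i, X i) => \sum_i inj i (x i)).

(* The products below are MathComp's direct product of modules. *)
Definition is_summand N M : Prop :=
  exists N' : lmodType A, module_iso (N * N')%type M.

Definition indecomposable M : Prop :=
  ~ trivial_module M /\
  forall N N' : lmodType A,
    module_iso (N * N')%type M -> trivial_module N \/ trivial_module N'.

Definition basic_decomposition n (X : 'I_n -> lmodType A) M : Prop :=
  [/\ direct_sum X M, forall i, indecomposable (X i) &
      forall i j, i != j -> ~ module_iso (X i) (X j)].

Definition in_add T M : Prop :=
  exists n (X : 'I_n -> lmodType A),
    (forall i, is_summand (X i) T) /\ direct_sum X M.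

Definition exact_at L M N (f : modhom L M) (g : modhom M N) : Prop :=
  forall y, g y = 0 <-> exists x, f x = y.

Definition projective P : Prop :=
  forall M N (p : modhom M N) (f : modhom P N), (forall y, exists x, p x = y) ->
    exists g : modhom P M, forall x, p (g x) = f x.

(* ... -> P_2 -> P_1 -> P_0 -> M -> 0 *)
Record proj_resolution M := ProjResolution {
  pres : nat -> lmodType A;
  pdiff : forall i, modhom (pres i.+1) (pres i);
  paug : modhom (pres 0) M;
  pres_proj : forall i, projective (pres i);
  paug_surj : forall x, exists y, paug y = x;
  paug_exact : exact_at (pdiff 0) paug;
  pdiff_exact : forall i, exact_at (pdiff i.+1) (pdiff i)
}.

Definition finite_proj_dim M : Prop :=
  exists (P : proj_resolution M) (n : nat),
    forall i, (n < i)%N -> trivial_module (pres P i).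

(* Ext^i(M, N) is the i-th cohomology of Hom(P, N) for a projective resolution P of
   M; it does not depend on P. *)
Definition Ext_vanishes M N (i : nat) : Prop :=
  forall P : proj_resolution M,
    if i is j.+1 then
      forall f : modhom (pres P j.+1) N, hom_comp f (pdiff P j.+1) = 0 ->
        exists g : modhom (pres P j) N, f = hom_comp g (pdiff P j)
    else
      forall f : modhom (pres P 0) N, hom_comp f (pdiff P 0) = 0 -> f = 0.

(* 0 -> A -> X_0 -> ... -> X_{r-1} -> 0, extended by zeros; every X_i is a finite
   direct sum of direct summands of T. *)
Definition add_coresolution T : Prop :=
  exists (r : nat) (X : nat -> lmodType A) (e : modhom A^o (X 0%N))
         (d : forall i, modhom (X i) (X i.+1)),
    [/\ injective e, exact_at e (d 0%N), forall i, exact_at (d i) (d i.+1),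
        forall i, in_add T (X i) & forall i, (r <= i)%N -> trivial_module (X i)].

Definition tilting T : Prop :=
  [/\ fin_dim (restr_scalars T), finite_proj_dim T,
      forall i, (0 < i)%N -> Ext_vanishes T T i & add_coresolution T].

End Modules.

(* Low degrees of the Hochschild complex of an algebra B with coefficients in B:
   B -> Hom_k(B, B) -> Hom_k(B (x) B, B). The product is an argument, rather than
   part of an [algType], because End_A(T) is the zero ring when T = 0. *)
Section Hochschild.
Variables (k : fieldType) (B : lmodType k) (mul : B -> B -> B).

Definition hochschild_d0 (b x : B) : B := mul x b - mul b x.
Definition hochschild_d1 (f : B -> B) (x y : B) : B :=
  mul x (f y) - f (mul x y) + mul (f x) y.
Definition HH1_vanishes : Prop :=
  forall f : {linear B -> B}, (forall x y, hochschild_d1 f x y = 0) ->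
    exists b, forall x, f x = hochschild_d0 b x.
End Hochschild.

(* [mor x y] is the space of morphisms from x to y. The choice structure on objects
   is no restriction: classically every type has one. *)
Record kcat (k : fieldType) := KCat {
  ob :> choiceType;
  mor : ob -> ob -> lmodType k;
  idm : forall x, mor x x;
  kcomp : forall x y z, mor y z -> mor x y -> mor x z;
  comp_linearl : forall x y z (f : mor x y), linear (fun g : mor y z => kcomp g f);
  comp_linearr : forall x y z (g : mor y z), linear (fun f : mor x y => kcomp g f);
  compA : forall w x y z (h : mor y z) (g : mor x y) (f : mor w x),
    kcomp h (kcomp g f) = kcomp (kcomp h g) f;
  comp_idl : forall x y (f : mor x y), kcomp (idm y) f = f;
  comp_idr : forall x y (f : mor x y), kcomp f (idm x) = f
}.
Arguments mor {k} k0 x y : rename.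
Arguments idm {k k0} x : rename.

Section KCat.
Variable k : fieldType.
Implicit Types C D E : kcat k.

(* Partitions of the objects are pairs (P, complement of P). *)
Definition cat_connected C : Prop :=
  ~ exists P : C -> Prop,
      [/\ exists x, P x, exists y, ~ P y &
          forall x y, P x -> ~ P y ->
            trivial_module (mor C x y) /\ trivial_module (mor C y x)].

Definition invertible C (x y : C) (f : mor C x y) : Prop :=
  exists g : mor C y x, kcomp g f = idm x /\ kcomp f g = idm y.

(* The endomorphism algebra of x is local: its non-invertible elements form a proper
   two-sided ideal. *)
Definition local_endo C (x : C) : Prop :=
  [/\ (idm x : mor C x x) <> 0,
      forall f g : mor C x x, ~ invertible f -> ~ invertible g -> ~ invertible (f + g),
      forall f g : mor C x x, ~ invertible f -> ~ invertible (kcomp g f) &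
      forall f g : mor C x x, ~ invertible f -> ~ invertible (kcomp f g)].

(* The direct sum of the V y over all objects y is finite dimensional. *)
Definition fin_dim_sum C (V : C -> lmodType k) : Prop :=
  finite_set (fun y => ~ trivial_module (V y)) /\ forall y, fin_dim (V y).

Definition locally_bounded C : Prop :=
  [/\ forall x y : C, x <> y -> ~ exists f : mor C x y, invertible f,
      forall x : C, fin_dim_sum (fun y => mor C x y),
      forall x : C, fin_dim_sum (fun y => mor C y x) &
      forall x : C, local_endo x].

(* Morphisms bundled with source and target: equality of functors on the nose is
   equality of the bundled images of all morphisms (identities give the objects). *)
Definition arrow C : Type := {xy : C * C & mor C xy.1 xy.2}.
Definition to_arrow C (x y : C) (f : mor C x y) : arrow C :=
  existT (fun xy : C * C => mor C xy.1 xy.2 : Type) (x, y) f.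

Record kfunctor C D := KFunctor {
  fob :> C -> D;
  fmor : forall x y, {linear mor C x y -> mor D (fob x) (fob y)};
  fmor_id : forall x, fmor x x (idm x) = idm (fob x);
  fmor_comp : forall x y z (g : mor C y z) (f : mor C x y),
    fmor x z (kcomp g f) = kcomp (fmor y z g) (fmor x y f)
}.
Arguments fmor {C D} k0 {x y} : rename.

Definition kfunctor_eq C D (F F' : kfunctor C D) : Prop :=
  forall (x y : C) (f : mor C x y), to_arrow (fmor F f) = to_arrow (fmor F' f).

Definition kfunctor_id C : kfunctor C C :=
  @KFunctor C C id (fun x y => idfun : {linear mor C x y -> mor C x y})
    (fun _ => erefl) (fun _ _ _ _ _ => erefl).

Section Composition.
Variables (C D E : kcat k) (F' : kfunctor D E) (F : kfunctor C D).
Definition kfcomp_mor (x y : C) : {linear mor C x y -> mor E (F' (F x)) (F' (F y))} :=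
  @fmor D E F' (F x) (F y) \o @fmor C D F x y.
Fact kfcomp_id (x : C) : kfcomp_mor x x (idm x) = idm (F' (F x)).
Proof. by rewrite /kfcomp_mor /= !fmor_id. Qed.
Fact kfcomp_comp (x y z : C) (g : mor C y z) (f : mor C x y) :
  kfcomp_mor x z (kcomp g f) = kcomp (kfcomp_mor y z g) (kfcomp_mor x y f).
Proof. by rewrite /kfcomp_mor /= !fmor_comp. Qed.
Definition kfunctor_comp : kfunctor C E :=
  @KFunctor C E (fun x => F' (F x)) kfcomp_mor kfcomp_id kfcomp_comp.
End Composition.

Definition kfunctor_iso C D (F : kfunctor C D) : Prop :=
  exists F' : kfunctor D C,
    kfunctor_eq (kfunctor_comp F' F) (kfunctor_id C) /\
    kfunctor_eq (kfunctor_comp F F') (kfunctor_id D).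

End KCat.
Arguments fmor {k C D} k0 {x y} : rename.

(* A group morphism from G to the automorphisms of E; each [act g] is an
   automorphism, with inverse [act g^-1]. *)
Record kaction (k : fieldType) (G : groupType) (E : kcat k) := KAction {
  act :> G -> kfunctor E E;
  act1 : kfunctor_eq (act 1%g) (kfunctor_id E);
  actM : forall g h, kfunctor_eq (act (g * h)%g) (kfunctor_comp (act g) (act h))
}.

Definition free_action k G E (a : @kaction k G E) : Prop :=
  forall (g : G) (x : E), a g x = x -> g = 1%g.

Lemma fsumE (V : nmodType) (I : choiceType) (D : set I) (F : I -> V) :
  finite_set D -> (forall i, F i <> 0 -> D i) ->
  (\sum_(i \in setT) F i = \sum_(i <- fset_set D) F i)%R.
Proof.
move=> fD FD; rewrite -(fsbig_widen D setT) ?fsbig_finite //.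
by move=> i [_ nDi] /=; apply: contrapT => /FD.
Qed.

Section Quotient.
Variables (k : fieldType) (G : groupType) (E : kcat k) (a : kaction G E).

(* The morphism m if it goes from x to y, and 0 otherwise. *)
Definition at_hom (x y : E) (m : arrow E) : mor E x y :=
  @untag (E * E)%type (fun xy => mor E xy.1 xy.2) (mor E x y) 0 (x, y) id m.

Lemma at_homE x y (f : mor E x y) : at_hom x y (to_arrow f) = f.
Proof. by rewrite /at_hom (untagE _ _ (erefl : tag (to_arrow f) = (x, y))). Qed.

Lemma at_hom0 x y x' y' (f : mor E x y) :
  (x, y) <> (x', y') -> at_hom x' y' (to_arrow f) = 0.
Proof. by move=> /eqP ne; rewrite /at_hom untag_dflt. Qed.

Lemma to_arrow_ob (x y x' y' : E) (f : mor E x y) (f' : mor E x' y') :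
  to_arrow f = to_arrow f' -> x = x' /\ y = y'.
Proof. by move=> /(congr1 tag) /= [-> ->]. Qed.

Lemma act_ob1 x : a 1%g x = x.
Proof. by have [] := to_arrow_ob (act1 a (idm x)). Qed.
Lemma act_obM g h x : a (g * h)%g x = a g (a h x).
Proof. by have [] := to_arrow_ob (actM a g h (idm x)). Qed.
Lemma act_obK g : cancel (a g) (a g^-1%g).
Proof. by move=> x; rewrite -act_obM mulVg act_ob1. Qed.
Lemma act_obVK g : cancel (a g^-1%g) (a g).
Proof. by move=> x; rewrite -act_obM mulgV act_ob1. Qed.
Lemma act_ob_bij g : bijective (a g).
Proof. exact: Bijective (act_obK g) (act_obVK g). Qed.

Lemma fmor_at_hom g x y (u v : E) (f : mor E u v) :
  at_hom (a g x) (a g y) (to_arrow (fmor (a g) f))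
  = fmor (a g) (at_hom x y (to_arrow f)).
Proof.
have [[eu ev]|ne] := pselect ((u, v) = (x, y)).
  by case: x / eu; case: y / ev; rewrite !at_homE.
rewrite (at_hom0 _ ne) linear0 at_hom0 // => -[/(bij_inj (act_ob_bij g)) eu].
by move=> /(bij_inj (act_ob_bij g)) ev; apply: ne; rewrite eu ev.
Qed.

Definition orbit_rel : rel E := fun x y => `[< exists g, a g x = y >].

Fact orbit_rel_equiv : equiv_class_of orbit_rel.
Proof.
split=> [x|x y|y x z].
- by apply/asboolP; exists 1%g; exact: act_ob1.
- by apply/asboolP/asboolP => -[g <-]; exists g^-1%g; rewrite act_obK.
move=> /asboolP[g <-] /asboolP[h <-]; apply/asboolP.
by exists (h * g)%g; rewrite act_obM.
Qed.
Canonical orbit_equiv := EquivRelPack orbit_rel_equiv.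

Definition orbits : choiceType := {eq_quot orbit_equiv}%qT.
Definition orbit_of (x : E) : orbits := (\pi_({eq_quot orbit_equiv}) x)%qT.

Lemma orbit_ofP x y : (orbit_of x = orbit_of y) <-> exists g, a g x = y.
Proof.
split=> [/eqP|e]; last by apply/eqP; rewrite eqmodE; apply/asboolP.
by rewrite eqmodE => /asboolP.
Qed.

Lemma orbit_of_act g x : orbit_of (a g x) = orbit_of x.
Proof. by apply/esym/orbit_ofP; exists g. Qed.

(* The quotient category E/G: its objects are the G-orbits of objects of E, and a
   morphism from A to B is a G-equivariant family of morphisms x -> y indexed by
   x in A and y in B, only finitely many of which are non-zero for each x (automatic
   if E is locally bounded). Families are extended by 0 to all pairs of objects. *)
Record quot_mor (A B : orbits) := QuotMor {
  qfam :> forall x y : E, mor E x y;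
  qfam_supp : forall x y, qfam x y <> 0 -> orbit_of x = A /\ orbit_of y = B;
  qfam_act : forall g x y, qfam (a g x) (a g y) = fmor (a g) (qfam x y);
  qfam_fin : forall x, finite_set (fun y => qfam x y <> 0)
}.

Section QuotMor.
Variables A B : orbits.
Implicit Types f g : quot_mor A B.

Lemma quot_mor_ext A' B' (f g : quot_mor A' B') : (forall x y, f x y = g x y) -> f = g.
Proof.
case: f g => [f f1 f2 f3] [g g1 g2 g3] /= e.
have {}e : f = g by apply: functional_extensionality_dep => x; exact: functional_extensionality_dep.
case: _ / e in g1 g2 g3 *.
by rewrite (Prop_irrelevance f1 g1) (Prop_irrelevance f2 g2) (Prop_irrelevance f3 g3).
Qed.

HB.instance Definition _ := gen_eqMixin (quot_mor A B).
HB.instance Definition _ := gen_choiceMixin (quot_mor A B).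

Program Definition quot0 : quot_mor A B := @QuotMor A B (fun _ _ => 0) _ _ _.
Next Obligation. by rewrite linear0. Qed.
Next Obligation. by apply: (sub_finite_set _ (finite_set0 E)). Qed.

Program Definition quotD f g : quot_mor A B :=
  @QuotMor A B (fun x y => f x y + g x y) _ _ _.
Next Obligation.
have [f0|/qfam_supp //] := pselect (f x y = 0).
by move: H; rewrite f0 add0r => /qfam_supp.
Qed.
Next Obligation. by rewrite !qfam_act linearD. Qed.
Next Obligation.
apply: (@sub_finite_set _ _ ((fun y => f x y <> 0) `|` (fun y => g x y <> 0))%classic).
  move=> y /= fg; have [f0|?] := pselect (f x y = 0); [right|by left].
  by rewrite f0 add0r in fg.
by rewrite finite_setU; split; exact: qfam_fin.
Qed.

Program Definition quotZ (c : k) f : quot_mor A B :=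
  @QuotMor A B (fun x y => c *: f x y) _ _ _.
Next Obligation. by apply: (@qfam_supp _ _ f) => f0; rewrite f0 scaler0 in H. Qed.
Next Obligation. by rewrite qfam_act linearZ. Qed.
Next Obligation.
apply: sub_finite_set (qfam_fin f x) => y cf f0; apply: cf; by rewrite f0 scaler0.
Qed.

Definition quotN f := quotZ (-1) f.

Fact quotDA : associative quotD.
Proof. by move=> f g h; apply: quot_mor_ext => x y /=; rewrite addrA. Qed.
Fact quotDC : commutative quotD.
Proof. by move=> f g; apply: quot_mor_ext => x y /=; rewrite addrC. Qed.
Fact quot0D : left_id quot0 quotD.
Proof. by move=> f; apply: quot_mor_ext => x y /=; rewrite add0r. Qed.
Fact quotND : left_inverse quot0 quotN quotD.
Proof. by move=> f; apply: quot_mor_ext => x y /=; rewrite scaleN1r addNr. Qed.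
HB.instance Definition _ :=
  GRing.isZmodule.Build (quot_mor A B) quotDA quotDC quot0D quotND.

Fact quotZA b c f : quotZ b (quotZ c f) = quotZ (b * c) f.
Proof. by apply: quot_mor_ext => x y /=; rewrite scalerA. Qed.
Fact quotZ1 : left_id 1 quotZ.
Proof. by move=> f; apply: quot_mor_ext => x y /=; rewrite scale1r. Qed.
Fact quotZDr : right_distributive quotZ +%R.
Proof. by move=> c f g; apply: quot_mor_ext => x y /=; rewrite scalerDr. Qed.
Fact quotZDl f : {morph quotZ^~ f : b c / b + c}.
Proof. by move=> b c; apply: quot_mor_ext => x y /=; rewrite scalerDl. Qed.
HB.instance Definition _ := GRing.Zmodule_isLmodule.Build k (quot_mor A B)
  quotZA quotZ1 quotZDr quotZDl.
End QuotMor.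

Lemma comp0l (x y : E) z (f : mor E x y) : kcomp (0 : mor E y z) f = 0.
Proof. by have := comp_linearl (z := z) f (-1) 0 0; rewrite !scaleN1r oppr0 addr0 addNr. Qed.
Lemma comp0r x (y z : E) (g : mor E y z) : kcomp g (0 : mor E x y) = 0.
Proof. by have := comp_linearr (x := x) g (-1) 0 0; rewrite !scaleN1r oppr0 addr0 addNr. Qed.
Arguments comp0l [x y] z f.
Arguments comp0r x [y z] g.

Lemma compDl (x y z : E) (f : mor E x y) (g h : mor E y z) :
  kcomp (g + h) f = kcomp g f + kcomp h f.
Proof. by have := comp_linearl f 1 g h; rewrite !scale1r. Qed.
Lemma compDr (x y z : E) (g : mor E y z) (f h : mor E x y) :
  kcomp g (f + h) = kcomp g f + kcomp g h.
Proof. by have := comp_linearr g 1 f h; rewrite !scale1r. Qed.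
Lemma comp_suml (x y z : E) (f : mor E x y) I (s : seq I) (F : I -> mor E y z) :
  kcomp (\sum_(i <- s) F i) f = \sum_(i <- s) kcomp (F i) f.
Proof. exact: (big_morph (fun g : mor E y z => kcomp g f) (fun g h => compDl f g h) (comp0l z f)). Qed.
Lemma comp_sumr (x y z : E) (g : mor E y z) I (s : seq I) (F : I -> mor E x y) :
  kcomp g (\sum_(i <- s) F i) = \sum_(i <- s) kcomp g (F i).
Proof. exact: (big_morph (fun f : mor E x y => kcomp g f) (fun f h => compDr g f h) (comp0r x g)). Qed.

Section QuotComp.
Variables A B C : orbits.

Definition quot_comp_fam (g : quot_mor B C) (f : quot_mor A B) (x z : E) : mor E x z :=
  \sum_(y \in setT) kcomp (g y z) (f x y).

Lemma quot_comp_famE (g : quot_mor B C) (f : quot_mor A B) (x z : E) (D : set E) : finite_set D ->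
  (forall y, f x y <> 0 -> D y) ->
  quot_comp_fam g f x z = \sum_(y <- fset_set D) kcomp (g y z) (f x y).
Proof.
move=> fD fxD; apply: fsumE => // y gf; apply: fxD => f0; apply: gf.
by rewrite f0 comp0r.
Qed.

Lemma quot_comp_fam_neq0 (g : quot_mor B C) (f : quot_mor A B) (x z : E) : quot_comp_fam g f x z <> 0 ->
  exists2 y, g y z <> 0 & f x y <> 0.
Proof.
move=> gf; apply: contrapT => ne; apply: gf; apply: fsbig1 => y _.
have [f0|nf] := pselect (f x y = 0); first by rewrite f0 comp0r.
have [g0|ng] := pselect (g y z = 0); first by rewrite g0 comp0l.
by case: ne; exists y.
Qed.

Program Definition quot_comp (g : quot_mor B C) (f : quot_mor A B) : quot_mor A C :=
  @QuotMor A C (quot_comp_fam g f) _ _ _.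
Next Obligation.
by have [z /qfam_supp[_ ->] /qfam_supp[-> _]] := quot_comp_fam_neq0 H.
Qed.
Next Obligation.
rename g0 into h.
rewrite [LHS](reindex_fsbigT (a h)) /=; last exact: act_ob_bij.
rewrite (@fsumE _ _ (fun z => f x z <> 0)); last 2 first.
- exact: qfam_fin.
- by move=> z + f0; rewrite !qfam_act f0 linear0 comp0r; apply.
rewrite (quot_comp_famE _ _ (qfam_fin f x)) // linear_sum.
by apply: eq_bigr => z _; rewrite !qfam_act fmor_comp.
Qed.
Next Obligation.
apply: (@sub_finite_set _ _
  (\bigcup_(y in (fun y => f x y <> 0)) (fun z => g y z <> 0))%classic).
  by move=> z /quot_comp_fam_neq0[y gy fy]; exists y.
by apply: bigcup_finite => [|y _]; exact: qfam_fin.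
Qed.
End QuotComp.

Program Definition quot_id (A : orbits) : quot_mor A A :=
  @QuotMor A A (fun x y => if orbit_of x == A then at_hom x y (to_arrow (idm x)) else 0)
    _ _ _.
Next Obligation.
move: H; case: eqP => // <-; have [-> //|ne] := pselect (x = y).
by rewrite at_hom0 // => -[].
Qed.
Next Obligation.
rewrite orbit_of_act; case: eqP => _; last by rewrite linear0.
by rewrite -fmor_at_hom fmor_id.
Qed.
Next Obligation.
apply: sub_finite_set (finite_set1 x) => y /=; case: eqP => // _ ne.
by apply: contrapT => nyx; apply: ne; rewrite at_hom0 // => -[/esym].
Qed.

Lemma quot_idE (A : orbits) (x : E) : orbit_of x = A -> quot_id A x x = idm x.
Proof. by move=> /= ->; rewrite eqxx at_homE. Qed.
Lemma quot_id0 (A : orbits) (x y : E) : x <> y -> quot_id A x y = 0.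
Proof. by move=> nxy /=; case: ifP => // _; rewrite at_hom0 // => -[]. Qed.

Fact quot_comp_linearl A B C (f : quot_mor A B) :
  linear (fun g : quot_mor B C => quot_comp g f).
Proof.
move=> c g h; apply: quot_mor_ext => x z /=.
rewrite !(quot_comp_famE _ _ (qfam_fin f x)) // scaler_sumr -big_split /=.
by apply: eq_bigr => y _; rewrite comp_linearl.
Qed.

Fact quot_comp_linearr A B C (g : quot_mor B C) :
  linear (fun f : quot_mor A B => quot_comp g f).
Proof.
move=> c f h; apply: quot_mor_ext => x z /=.
pose D := ((fun y => f x y <> 0) `|` (fun y => h x y <> 0))%classic.
have fD : finite_set D by rewrite finite_setU; split; exact: qfam_fin.
rewrite !(@quot_comp_famE _ _ _ _ _ _ _ D) //; last 3 first.
- by right.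
- by left.
- move=> y /= ne; have [f0|?] := pselect (f x y = 0); [right|by left].
  by move=> h0; apply: ne; rewrite f0 h0 scaler0 addr0.
by rewrite scaler_sumr -big_split /=; apply: eq_bigr => y _; rewrite comp_linearr.
Qed.

Fact quot_compA A B C D (h : quot_mor C D) (g : quot_mor B C) (f : quot_mor A B) :
  quot_comp h (quot_comp g f) = quot_comp (quot_comp h g) f.
Proof.
apply: quot_mor_ext => x z /=.
pose W := (fun w => f x w <> 0) : set E.
have fW : finite_set W := qfam_fin f x.
pose Y := (\bigcup_(w in W) (fun y => g w y <> 0))%classic.
have fY : finite_set Y by apply: bigcup_finite => // w _; exact: qfam_fin.
rewrite (@quot_comp_famE _ _ _ _ _ _ _ Y) //; last first.
  by move=> y /quot_comp_fam_neq0[w gw fw]; exists w.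
rewrite (@quot_comp_famE _ _ _ _ _ _ _ W) //.
under eq_bigr => y _.
  rewrite /= (@quot_comp_famE _ _ _ _ _ _ _ W) // comp_sumr.
  over.
rewrite exchange_big /= [LHS]big_seq [RHS]big_seq; apply: eq_bigr => w.
rewrite in_fset_set // inE => Ww.
rewrite (@quot_comp_famE _ _ _ _ _ _ _ Y) // => [|y gy]; last by exists w.
by rewrite comp_suml; apply: eq_bigr => y _; rewrite compA.
Qed.

Fact quot_comp_idl A B (f : quot_mor A B) : quot_comp (quot_id B) f = f.
Proof.
apply: quot_mor_ext => x y; rewrite -[LHS]/(quot_comp_fam _ _ x y).
pose D := ((fun z => f x z <> 0) `|` [set y])%classic.
have fD : finite_set D by rewrite finite_setU; split; [exact: qfam_fin | exact: finite_set1].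
rewrite (@quot_comp_famE _ _ _ _ _ _ _ D) //; last by left.
rewrite (big_fsetD1 y); last by rewrite in_fset_set // inE /D; right.
rewrite big1_fset => [|z]; last first.
  by rewrite in_fsetD1 => /andP[/eqP nzy _] _; rewrite quot_id0 // comp0l.
apply: etrans (addr0 _) _; have [f0|/qfam_supp[_ eB]] := pselect (f x y = 0); first by rewrite f0 comp0r.
by rewrite quot_idE // comp_idl.
Qed.

Fact quot_comp_idr A B (f : quot_mor A B) : quot_comp f (quot_id A) = f.
Proof.
apply: quot_mor_ext => x y; rewrite -[LHS]/(quot_comp_fam _ _ x y).
rewrite (@quot_comp_famE _ _ _ _ _ _ _ [set x]%classic) //; last first.
  by move=> z /= ne; apply: contrapT => nzx; apply: ne; apply: quot_id0 => /esym.
rewrite fset_set1 big_seq_fset1.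
have [f0|/qfam_supp[eA _]] := pselect (f x y = 0); first by rewrite f0 comp0l.
by rewrite quot_idE // comp_idr.
Qed.

Definition quot_cat : kcat k :=
  @KCat k orbits quot_mor quot_id quot_comp
    quot_comp_linearl quot_comp_linearr quot_compA quot_comp_idl quot_comp_idr.

Hypothesis a_free : free_action a.

Lemma free_inj g h x : a g x = a h x -> g = h.
Proof.
move=> e; apply: (mulgI h^-1%g); rewrite mulVg; apply: (a_free (x := x)).
by rewrite act_obM e act_obK.
Qed.

(* The image in E/G of f : x -> y is the family with value g f at (g x, g y). *)
Definition quot_proj_fam (x y : E) (f : mor E x y) (x' y' : E) : mor E x' y' :=
  \sum_(g \in setT) at_hom x' y' (to_arrow (fmor (a g) f)).

Lemma quot_proj_fam_neq0 (x y : E) (f : mor E x y) (x' y' : E) :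
  quot_proj_fam f x' y' <> 0 -> exists2 g, x' = a g x & y' = a g y.
Proof.
move=> nf; apply: contrapT => ne; apply: nf; apply: fsbig1 => g _.
by apply: at_hom0 => -[ex ey]; apply: ne; exists g.
Qed.

Lemma quot_proj_famE (x y : E) (f : mor E x y) g y' :
  quot_proj_fam f (a g x) y' = at_hom (a g x) y' (to_arrow (fmor (a g) f)).
Proof.
rewrite /quot_proj_fam (@fsumE _ _ [set g]%classic) ?fset_set1 ?big_seq_fset1 //.
move=> h /= nf; apply: contrapT => nhg; apply: nf; apply: at_hom0 => -[].
by move=> /free_inj.
Qed.

Lemma quot_proj_famEE (x y : E) (f : mor E x y) g :
  quot_proj_fam f (a g x) (a g y) = fmor (a g) f.
Proof. by rewrite quot_proj_famE at_homE. Qed.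

Program Definition quot_proj_mor (x y : E) (f : mor E x y) :
    quot_mor (orbit_of x) (orbit_of y) :=
  @QuotMor (orbit_of x) (orbit_of y) (quot_proj_fam f) _ _ _.
Next Obligation.
by have [g -> ->] := quot_proj_fam_neq0 H; rewrite !orbit_of_act.
Qed.
Next Obligation.
rename x0 into u, y0 into v.
rewrite [LHS](reindex_fsbigT (fun h : G => (g * h)%g)) /=; last first.
  by exists (fun h : G => (g^-1 * h)%g); [exact: mulKg | exact: mulVKg].
have E1 h : at_hom (a g u) (a g v) (to_arrow (fmor (a (g * h)%g) f))
          = fmor (a g) (at_hom u v (to_arrow (fmor (a h) f))).
  by rewrite (actM a g h f) fmor_at_hom.
under eq_fsbigr => h _ do rewrite E1.
have [[h0 eh0]|nu] := pselect (exists h, a h x = u); last first.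
  have N h : at_hom u v (to_arrow (fmor (a h) f)) = 0.
    by apply: at_hom0 => -[eu _]; apply: nu; exists h.
  rewrite [X in fmor _ X]fsbig1 ?linear0 => [|h _]; last exact: N.
  by apply: fsbig1 => h _; rewrite N linear0.
have N h : at_hom u v (to_arrow (fmor (a h) f)) <> 0 -> h = h0.
  move=> nz; apply: contrapT => ne; apply: nz; apply: at_hom0 => -[eu _].
  by apply: ne; apply: (@free_inj _ _ x); rewrite eu eh0.
rewrite /quot_proj_fam !(@fsumE _ _ [set h0]%classic) ?fset_set1 ?big_seq_fset1 //.
by move=> h nz; apply: N => z; apply: nz; rewrite z linear0.
Qed.
Next Obligation.
rename x0 into u.
have [[h eh]|nu] := pselect (exists h, a h x = u).
  apply: sub_finite_set (finite_set1 (a h y)) => v /quot_proj_fam_neq0[g eg ->].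
  by rewrite -(@free_inj h g x) // eh.
apply: sub_finite_set (finite_set0 E) => v /quot_proj_fam_neq0[g eg _].
by apply: nu; exists g.
Qed.

Lemma quot_proj_mor_ext (x : E) (B : orbits) (f f' : quot_mor (orbit_of x) B) :
  (forall g y', f (a g x) y' = f' (a g x) y') -> f = f'.
Proof.
move=> e; apply: quot_mor_ext => u v.
have [[h <-]|nu] := pselect (exists h, a h x = u); first exact: e.
have Z (p : quot_mor (orbit_of x) B) : p u v = 0.
  apply: contrapT => /qfam_supp[/esym/orbit_ofP [g eg] _].
  by apply: nu; exists g.
by rewrite !Z.
Qed.

Fact quot_proj_linear (x y : E) : linear (@quot_proj_mor x y).
Proof.
move=> c f f'.
apply: quot_proj_mor_ext => g z /=.
rewrite !quot_proj_famE.
have [->|nz] := pselect (z = a g y); first by rewrite !at_homE linearP.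
have N (p : mor E (a g x) (a g y)) : at_hom (a g x) z (to_arrow p) = 0.
  by apply: at_hom0 => -[/esym].
by rewrite !N scaler0 addr0.
Qed.

Definition quot_proj_lin (x y : E) :
    {linear mor E x y -> quot_mor (orbit_of x) (orbit_of y)} :=
  HB.pack (@quot_proj_mor x y)
    (GRing.isLinear.Build k _ _ *:%R _ (@quot_proj_linear x y)).

Fact quot_proj_id (x : E) : quot_proj_lin x x (idm x) = quot_id (orbit_of x).
Proof.
apply: quot_proj_mor_ext => g z /=.
by rewrite quot_proj_famE orbit_of_act eqxx fmor_id.
Qed.

Fact quot_proj_comp (x y z : E) (g : mor E y z) (f : mor E x y) :
  quot_proj_lin x z (kcomp g f) = quot_comp (quot_proj_lin y z g) (quot_proj_lin x y f).
Proof.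
apply: quot_proj_mor_ext => h w.
rewrite -[RHS]/(quot_comp_fam _ _ (a h x) w).
rewrite (@quot_comp_famE _ _ _ _ _ _ _ [set (a h y)]%classic) //; last first.
  by move=> u /quot_proj_fam_neq0 [h' /free_inj -> ->].
rewrite fset_set1 big_seq_fset1 /= quot_proj_famEE !quot_proj_famE.
have [->|nw] := pselect (w = a h z); first by rewrite !at_homE fmor_comp.
by rewrite !at_hom0 ?comp0l // => -[/esym].
Qed.

Definition quot_proj : kfunctor E quot_cat :=
  @KFunctor k E quot_cat orbit_of quot_proj_lin quot_proj_id quot_proj_comp.

End Quotient.

Section GaloisCovering.
Variable k : fieldType.

(* The functor E/G -> B induced by F is the one whose composition with the projection
   E -> E/G is F. *)
Definition galois_covering (G : groupType) (E B : kcat k) (F : kfunctor E B)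
    (a : kaction G E) : Prop :=
  (forall g : G, kfunctor_eq (kfunctor_comp F (a g)) F) /\
  exists (a_free : free_action a) (H : kfunctor (quot_cat a) B),
    kfunctor_iso H /\ kfunctor_eq (kfunctor_comp H (quot_proj a_free)) F.

(* For locally bounded B. *)
Definition simply_connected (B : kcat k) : Prop :=
  ~ exists (G : groupType) (E : kcat k) (F : kfunctor E B) (a : kaction G E),
      [/\ galois_covering F a, cat_connected E, locally_bounded E &
          exists g : G, g <> 1%g].
End GaloisCovering.

Section EndCat.
Variables (k : fieldType) (A : algType k) (n : nat) (X : 'I_n -> lmodType A).

Fact hom_comp_linearl (L M N : lmodType A) (f : modhom L M) :
  linear (fun g : modhom M N => hom_comp g f).
Proof. by move=> c g h; apply: hom_ext. Qed.
Fact hom_comp_linearr (L M N : lmodType A) (g : modhom M N) :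
  linear (fun f : modhom L M => hom_comp g f).
Proof. by move=> c f h; apply: hom_ext => x /=; rewrite linearP. Qed.

Fact hom_compA (K L M N : lmodType A) (h : modhom M N) (g : modhom L M) (f : modhom K L) :
  hom_comp h (hom_comp g f) = hom_comp (hom_comp h g) f.
Proof. exact: hom_ext. Qed.
Fact hom_comp_idl (M N : lmodType A) (f : modhom M N) : hom_comp (hom_id N) f = f.
Proof. exact: hom_ext. Qed.
Fact hom_comp_idr (M N : lmodType A) (f : modhom M N) : hom_comp f (hom_id M) = f.
Proof. exact: hom_ext. Qed.

(* B = End_A(T), for T the direct sum of the X i, as a k-category. *)
Definition end_cat : kcat k :=
  @KCat k 'I_n (fun i j => modhom (X i) (X j)) (fun i => hom_id (X i))
    (fun _ _ _ g f => hom_comp g f)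
    (fun _ _ _ => @hom_comp_linearl _ _ _) (fun _ _ _ => @hom_comp_linearr _ _ _)
    (fun _ _ _ _ => @hom_compA _ _ _ _)
    (fun _ _ => @hom_comp_idl _ _) (fun _ _ => @hom_comp_idr _ _).
End EndCat.

(* Main.v *)
Require Import Defs.
From mathcomp Require Import all_boot all_algebra.
From HB Require Import structures.
From mathcomp Require Import finmap ring.
From mathcomp Require Import boolp classical_sets cardinality fsbigop.
From mathcomp.multinomials Require Import monalg.

(* The path algebra is hereditary, so Ext^1(M, N) is the cokernel of [(phi_x) |-> (phi_(tgt a)
   a - a phi_(src a))]: on a rigid module every derivation of kQ can be lifted to a linear map.

   A weight [lam] on the arrows is a derivation of kQ, which lifts to linear maps [phi_i] of
   the indecomposable summands X_i of T. Then [f |-> phi_j f - f phi_i] is a derivation of the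
   category B, and its generalized eigenspaces grade B by the additive group of k. After
   shifting each [phi_i] by a scalar the degrees lie in a subgroup H such that the smash
   product of B with H is a connected Galois covering of B with group H; it is locally bounded
   because a rigid indecomposable module over a hereditary algebra has only scalar
   endomorphisms. If B is simply connected then H = 0, so B preserves the generalized
   eigenspaces of [phi] on T, and the spectral projections lie in End_B(T) = kQ. It follows
   that [lam] is a coboundary. Since this holds for every [lam], Q is a tree, and an arrow is
   the only path parallel to it.

   The coresolution of kQ by add T presents T over B, and shows both the double centralizer
   property and that a derivation D of B lifts to a linear map [nabla] of T. The commutator of
   [nabla] with kQ is a derivation of kQ, which is inner because weights are coboundaries.
   Hence [nabla] can be corrected by an element of kQ to lie in B, and D is inner. *)

Set Implicit Arguments.
Unset Strict Implicit.
Unset Printing Implicit Defensive.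

Import GRing.Theory.
Local Open Scope ring_scope.

(** * Linear algebra *)

(** The lift of a derivation to a module is unique only up to an endomorphism and need not be
    diagonalizable, hence generalized eigenspaces; they still form a grading, since the product of
    two generalized eigenvectors of a derivation is again one, for the sum of the eigenvalues.
    Graded by all of k, the smash product falls in general into several components, which are
    permuted by translation. H is the stabilizer of one of them, and the scalar shifts are a change
    of coordinates that turns this component into the set of all pairs (i, h) with h in H. It meets
    every fibre because B is connected, which in turn rests on the centre of kQ being k. From H = 0
    to a coboundary: as e_x kQ e_x = k e_x, a spectral projection acts on e_x T by a scalar, so that
    e_x T has a single eigenvalue mu_x; an arrow a raises eigenvalues by lam_a. The weights applied
    to Q itself are indicators of single arrows. A closed walk in the graph that uses the arrow
    exactly once has total weight 1 or -1, which is non-zero in every field, whereas a coboundary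
    sums to 0 along closed walks. *)

Definition mklin (R : pzRingType) (U V : lmodType R) (f : U -> V) (lf : linear f) :
  {linear U -> V} := HB.pack f (GRing.isLinear.Build R U V *:%R f lf).

Section FixedPoints.
Variables (R : pzRingType) (V : lmodType R) (p : {linear V -> V}).

(** For an idempotent [p] this is its image. In this form both the direct summands cut out by an
    idempotent endomorphism and the homogeneous components of morphism spaces become modules. *)
Definition fixpt : {pred V} := [pred v | p v == v].

Fact fixpt_submod_closed : GRing.submod_closed fixpt.
Proof.
split=> [|c u v]; rewrite !inE ?linear0 // => /eqP pu /eqP pv.
by rewrite linearP pu pv.
Qed.
HB.instance Definition _ := GRing.isSubmodClosed.Build R V fixpt fixpt_submod_closed.

Definition fixsp : Type := {v : V | v \in fixpt}.
HB.instance Definition _ := SubChoice.on fixsp.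
HB.instance Definition _ := [SubChoice_isSubLmodule of fixsp by <:].

Lemma fixsp_val_linear : linear (val : fixsp -> V).
Proof. by []. Qed.

Lemma fixsp_val_sum I (r : seq I) (F : I -> fixsp) :
  val (\sum_(i <- r) F i) = \sum_(i <- r) val (F i).
Proof. exact: (linear_sum (mklin fixsp_val_linear)). Qed.

Lemma fixspE (v : fixsp) : p (val v) = val v.
Proof. by case: v => v /= /eqP. Qed.

Definition mk_fixsp (v : V) (pv : p v = v) : fixsp := exist _ v (introT eqP pv).

End FixedPoints.

Section FiniteDimension.
Variable k : fieldType.
Implicit Types V W : lmodType k.

Lemma fin_dim_surj V W (f : V -> W) : linear f -> (forall w, exists v, f v = w) ->
  fin_dim V -> fin_dim W.
Proof.
move=> lf sf [n [b bP]]; pose F := mklin lf.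
exists n, (fun i => f (b i)) => w; have [v <-] := sf w; have [c ->] := bP v.
exists c; rewrite -[f _]/(F _) linear_sum; apply: eq_bigr => i _.
by rewrite linearZ.
Qed.

(** [fin_dim] only provides a spanning family; one of minimal length is a basis, because a
    non-trivial relation would allow one of its vectors to be dropped. *)
Lemma fin_dim_coord V : fin_dim V ->
  exists n (u : {linear V -> 'rV[k]_n}) (v : {linear 'rV[k]_n -> V}), cancel u v /\ cancel v u.
Proof.
move=> fV.
have exP : exists n, `[< exists b : 'I_n -> V, forall v, exists c : 'I_n -> k, v =
  \sum_i c i *: b i >].
  by case: fV => n bP; exists n; apply/asboolP.
case: (ex_minnP exP) => n /asboolP[b bP] nmin.
have bfree (c : 'I_n -> k) : \sum_i c i *: b i = 0 -> forall i, c i = 0.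
  case: n b bP nmin c => [|n] b bP nmin c c0 i; first by case: i.
  apply/eqP/negP => /negP nci; suff : (n.+1 <= n)%N by rewrite ltnn.
  apply: nmin; apply/asboolP; exists (fun j => b (lift i j)) => w.
  have [d ->] := bP w; exists (fun j => d (lift i j) - d i / c i * c (lift i j)).
  have -> : \sum_i d i *: b i = \sum_i d i *: b i - (d i / c i) *: (\sum_i c i *: b i).
    by rewrite c0 scaler0 subr0.
  rewrite scaler_sumr -sumrB.
  rewrite (bigD1_ord i) //= scalerA -scalerBl divfK // subrr scale0r add0r.
  by apply: eq_bigr => j _; rewrite scalerA -scalerBl.
pose v (c : 'rV[k]_n) : V := \sum_i c 0 i *: b i.
have v_lin : linear v.
  move=> a x y; rewrite /v scaler_sumr -big_split /=; apply: eq_bigr => i _.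
  by rewrite !mxE scalerDl scalerA.
pose vl := mklin v_lin.
have v_surj w : exists c, v c = w.
  have [c ->] := bP w; exists (\row_i c i); apply: eq_bigr => i _.
  by rewrite mxE.
have v_ker c : v c = 0 -> c = 0.
  by move=> vc; apply/rowP => i; rewrite mxE; exact: (bfree (c 0)).
have v_inj : injective v.
  move=> x y e; apply/eqP; rewrite -subr_eq0; apply/eqP/v_ker.
  by rewrite -[v _]/(vl _) linearB /= e subrr.
have [u uP] : exists u : V -> 'rV[k]_n, forall w, v (u w) = w.
  by exists (fun w => sval (cid (v_surj w))) => w; case: cid.
have u_lin : linear u.
  by move=> a x y; apply: v_inj; rewrite -[RHS]/(vl _) linearP /= !uP.
exists n, (mklin u_lin), vl; split => // x.
by apply: v_inj; exact: uP.
Qed.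

Lemma row_free_col_mx m n (v : 'rV[k]_n) (M : 'M_(m, n)) :
  row_free M -> ~~ (v <= M)%MS -> row_free (col_mx v M).
Proof.
move=> freeM nvM; rewrite -kermx_eq0; apply/eqP/row_matrixP => i; rewrite row0.
have := row_sub i (kermx (col_mx v M)); move: (row i _) => w.
rewrite sub_kermx -[w]hsubmxK mul_row_col (mx11_scalar (lsubmx w)) mul_scalar_mx => /eqP e.
have c0 : lsubmx w 0 0 = 0.
  apply: contraNeq nvM => nc; rewrite -(eqmx_scale v nc).
  by move/eqP: e; rewrite addr_eq0 => /eqP ->; rewrite -mulNmx submxMl.
move: e; rewrite c0 scale0r add0r -(mul0mx _ M) => /(row_free_inj freeM) ->.
by rewrite raddf0 row_mx0.
Qed.

(** Families with linearly independent image under [j] have length at most [n]; one of maximal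
    length spans [V]. *)
Lemma fin_dim_inj V n (j : {linear V -> 'rV[k]_n}) : injective j -> fin_dim V.
Proof.
move=> ij.
pose P r := `[< exists b : 'I_r -> V, row_free (\matrix_i j (b i)) >].
have exP : exists r, P r.
  exists 0%N; apply/asboolP; exists (fun _ => 0).
  by rewrite /row_free -leqn0 rank_leq_row.
have ubP r : P r -> (r <= n)%N.
  by move=> /asboolP[b /eqP {1}<-]; exact: rank_leq_col.
case: (ex_maxnP exP ubP) => r /asboolP[b bfree] rmax.
exists r, b => v.
have : (j v <= \matrix_i j (b i))%MS.
  apply/negP => /negP njv.
  suff : (r.+1 <= r)%N by rewrite ltnn.
  apply: rmax; apply/asboolP.
  exists (fun i : 'I_(1 + r) => if fintype.split i is inr l then b l else v).
  have -> : \matrix_i j (if fintype.split i is inr l then b l else v) =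
    col_mx (j v) (\matrix_i j (b i)) :> 'M_(1 + r, n).
    apply/matrixP => i l; rewrite !mxE; case: fintype.split => [z|z]; rewrite ?mxE //.
    by rewrite (ord1 z).
  exact: row_free_col_mx.
case/submxP => D e; exists (fun i => D 0 i); apply: ij; rewrite e linear_sum /=.
rewrite mulmx_sum_row; apply: eq_bigr => i _; rewrite linearZ /= rowK //.
Qed.

(** With such an [s], the map [v |-> v - s (d v)] is a projection onto the kernel of [d]. This
    splits exact sequences of modules over [k]. *)
Lemma pseudo_inverse V W (d : {linear V -> W}) : fin_dim V -> fin_dim W ->
  exists s : {linear W -> V}, forall v, d (s (d v)) = d v.
Proof.
move=> /fin_dim_coord[n [u [v [uK vK]]]] /fin_dim_coord[m [u' [v' [uK' vK']]]].
pose D := lin1_mx (u' \o d \o v).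
have DE x : x *m D = u' (d (v x)) by rewrite mul_rV_lin1.
exists (v \o mulmxr (pinvmx D) \o u') => x /=.
apply: (can_inj uK'); rewrite -DE -{1}[x]uK -DE.
by rewrite mulmxKpV ?submxMl // DE uK.
Qed.

Lemma inj_surj V (f : {linear V -> V}) : fin_dim V -> injective f -> forall w, exists v, f v = w.
Proof.
move=> /fin_dim_coord[n [u [v [uK vK]]]] injf w.
pose D := lin1_mx (u \o f \o v).
have DE x : x *m D = u (f (v x)) by rewrite mul_rV_lin1.
have : D \in unitmx.
  rewrite -row_free_unit -kermx_eq0; apply/eqP/row_matrixP => i; rewrite row0.
  have := row_sub i (kermx D); rewrite sub_kermx DE => /eqP e.
  apply: (can_inj vK); apply: injf; apply: (can_inj uK).
  by rewrite e !linear0.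
move=> Du; exists (v (u w *m invmx D)); apply: (can_inj uK).
by rewrite -DE mulmxKV.
Qed.

End FiniteDimension.

Section GeneralizedEigenspaces.
Variable k : fieldType.
Implicit Types U V W : lmodType k.

Fact shift_subproof V (phi : {linear V -> V}) (c : k) : linear (fun v => phi v - c *: v).
Proof.
move=> a x y; rewrite linearP scalerBr !scalerDr !scalerA (mulrC c).
by rewrite opprD addrACA.
Qed.
Definition shift V (phi : {linear V -> V}) c : {linear V -> V} := mklin (shift_subproof phi c).

Definition geig V (phi : {linear V -> V}) (c : k) (v : V) : Prop :=
  exists N, iter N (shift phi c) v = 0.

Section OneOperator.
Variables (V : lmodType k) (phi : {linear V -> V}).
Implicit Types (c d : k) (v w : V).

Lemma iter_linearP (f : {linear V -> V}) N a v w : iter N f (a *: v + w) =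
  a *: iter N f v + iter N f w.
Proof. by elim: N => //= N ->; rewrite linearP. Qed.

Lemma iter_linear0 (f : {linear V -> V}) N : iter N f 0 = 0.
Proof. by elim: N => //= N ->; rewrite linear0. Qed.

Lemma iter_linear_ge (f : {linear V -> V}) N M v : (N <= M)%N -> iter N f v = 0 -> iter M f v = 0.
Proof. by move=> /subnK <- e; rewrite iterD e iter_linear0. Qed.

Lemma geig0 c : geig phi c 0.
Proof. by exists 0%N. Qed.

Lemma geig_eigen c v : phi v = c *: v -> geig phi c v.
Proof. by move=> e; exists 1%N; rewrite /= e subrr. Qed.

Lemma geigP c a v w : geig phi c v -> geig phi c w -> geig phi c (a *: v + w).
Proof.
move=> [N vN] [M wM]; exists (maxn N M); rewrite iter_linearP.
by rewrite (iter_linear_ge (leq_maxl N M) vN) (iter_linear_ge (leq_maxr N M) wM) scaler0 addr0.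
Qed.

Lemma geigZ c a v : geig phi c v -> geig phi c (a *: v).
Proof. by move=> /(geigP a)/(_ (geig0 c)); rewrite addr0. Qed.

Lemma geigD c v w : geig phi c v -> geig phi c w -> geig phi c (v + w).
Proof. by move=> vc wc; have := geigP 1 vc wc; rewrite scale1r. Qed.

Lemma geig_sum c I (r : seq I) (P : pred I) (F : I -> V) :
  (forall i, P i -> geig phi c (F i)) -> geig phi c (\sum_(i <- r | P i) F i).
Proof. by move=> Fc; elim/big_ind: _ => //; [exact: geig0 | exact: geigD]. Qed.

Lemma iter_comm (T : Type) (f g : T -> T) N (v : T) : (forall x, f (g x) = g (f x)) ->
  f (iter N g v) = iter N g (f v).
Proof. by move=> fg; elim: N => //= N <-; rewrite fg. Qed.

Lemma shiftC c d v : shift phi c (shift phi d v) = shift phi d (shift phi c v).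
Proof.
rewrite /= ![phi (_ - _)]linearB ![phi (_ *: _)]linearZ /= !scalerBr !scalerA (mulrC c) !opprB.
by rewrite -!addrA; congr (_ + _); rewrite addrCA [RHS]addrCA; congr (_ + _); exact: addrC.
Qed.

Lemma geig_shift c d v : geig phi c v -> geig phi c (shift phi d v).
Proof.
by move=> [N vN]; exists N; rewrite -iter_comm ?vN ?linear0 // => x; exact: shiftC.
Qed.

Lemma geig_iter_shift c d N v : geig phi c v -> geig phi c (iter N (shift phi d) v).
Proof. by move=> vc; elim: N => //= N; exact: geig_shift. Qed.

(** By induction [v] is an eigenvector for [c], and on such a vector the iterates of [shift phi d]
    act by powers of [c - d]. *)
Lemma geig_disjoint c d v : c != d -> geig phi c v -> geig phi d v -> v = 0.
Proof.
move=> ncd [N]; elim: N v => // N IH v vN vd.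
have : shift phi c v = 0 by apply: IH; [rewrite -iterSr | exact: geig_shift].
move/eqP; rewrite subr_eq0 => /eqP e; case: vd => M.
have -> : iter M (shift phi d) v = (c - d) ^+ M *: v.
  elim: M => [|M IHM]; first by rewrite scale1r.
  by rewrite iterS IHM linearZ /= e -scalerBl scalerA exprSr.
by move/eqP; rewrite scaler_eq0 expf_eq0 subr_eq0 (negPf ncd) andbF => /eqP.
Qed.

Lemma geig_free (s : seq k) (w : k -> V) : uniq s -> (forall c, geig phi c (w c)) ->
  \sum_(c <- s) w c = 0 -> forall c, c \in s -> w c = 0.
Proof.
elim: s w => //= c s IH w /andP[cs us] wE; rewrite big_cons => e.
have wd d : d \in s -> w d = 0.
  move=> ds; have [N wN] := wE c.
  have ncd : c != d by apply: contraNneq cs => ->.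
  apply: (geig_disjoint ncd _ (wE d)); exists N.
  (* Applying [iter N (shift phi c)] removes the term [w c] from the relation and leaves a relation
     over [s]. *)
  apply: (IH (fun d => iter N (shift phi c) (w d))) => // [d'|]; first exact: geig_iter_shift.
  transitivity (iter N (shift phi c) (w c + \sum_(j <- s) w j)); last by rewrite e iter_linear0.
  rewrite -[w c]scale1r iter_linearP wN scaler0 add0r.
  apply: esym; apply: (big_morph (iter N (shift phi c))) => [x y|].
    by rewrite -[x in LHS]scale1r iter_linearP scale1r.
  exact: iter_linear0.
move=> d; rewrite inE => /predU1P[->|]; last exact: wd.
by move: e; rewrite big_seq big1 ?addr0.
Qed.

Lemma geig_solve c d w : c != d -> geig phi d w -> exists2 u, geig phi d u & shift phi c u = w.
Proof.
move=> ncd [N]; elim: N w => [w w0|N IH w].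
  by exists 0; [exact: geig0 | rewrite linear0 -w0].
move=> wN; have [|u ud e] := IH (shift phi d w); first by rewrite -iterSr.
(* By the choice of [u], the map [shift phi c] sends [w - u] to [shift phi c w - shift phi d w],
   which is [(d - c) w]. *)
exists ((d - c)^-1 *: (w - u)).
  by apply: geigZ; apply: geigD; [exists N.+1 | rewrite -scaleN1r; exact: geigZ].
rewrite linearZ linearB /= -[phi u - _ *: u]/(shift phi c u) e /=.
rewrite opprB [X in _ *: X]addrC addrA subrK -scalerBl.
by rewrite scalerA mulVf ?scale1r // subr_eq0 eq_sym.
Qed.

(** Primary decomposition of a vector killed by a product of factors [phi - c]. The components of
    [shift phi c v] of degree other than [c] are lifted along [shift phi c] by [geig_solve]; what
    the lifts leave of [v] has degree [c]. *)
Lemma geig_decomp (s : seq k) v : foldr (fun c => shift phi c) v s = 0 ->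
  exists w : k -> V, (forall c, geig phi c (w c)) /\ v = \sum_(c <- undup s) w c.
Proof.
elim/last_ind: s v => [v /= ->|s c IH v].
  by exists (fun _ => 0); split=> [c|]; [exact: geig0 | rewrite big_nil].
rewrite foldr_rcons => /IH[w [wE e]].
have uP d : exists u, geig phi d u /\ (d != c -> shift phi c u = w d).
  have [->|ndc] := eqVneq d c; first by exists 0; split=> //; exact: geig0.
  have ncd : c != d by rewrite eq_sym.
  by have [u ud ue] := geig_solve ncd (wE d); exists u.
pose u d := sval (cid (uP d)).
have u_spec d : geig phi d (u d) /\ (d != c -> shift phi c (u d) = w d) := svalP (cid (uP d)).
have uE d := proj1 (u_spec d).
have ue d (ndc : d != c) : shift phi c (u d) = w d by apply: (proj2 (u_spec d)).
pose r := v - \sum_(d <- undup s | d != c) u d.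
have rE : geig phi c r.
  have : geig phi c (shift phi c r).
    rewrite linearB linear_sum e (bigID (pred1 c)) /=.
    rewrite [X in _ + X - _](eq_bigr (fun d => shift phi c (u d))); last by move=> d /ue ->.
    by rewrite addrK; apply: geig_sum => d /eqP ->.
  by move=> [N rN]; exists N.+1; rewrite iterSr.
exists (fun d => if d == c then r else u d); split=> [d|]; first by case: eqP => [->|].
have us : uniq (undup (rcons s c)) by exact: undup_uniq.
rewrite (bigD1_seq c) ?mem_undup ?mem_rcons ?inE ?eqxx //= /r.
rewrite -[LHS](subrK (\sum_(d <- undup s | d != c) u d)); congr (_ + _).
transitivity (\sum_(d <- [seq d <- undup (rcons s c) | d != c]) u d).
  rewrite -[LHS]big_filter; apply: perm_big; apply: uniq_perm;
    rewrite ?filter_uniq ?undup_uniq // => d.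
  rewrite !mem_filter !mem_undup mem_rcons inE; by case: (d == c).
by rewrite big_filter; apply: eq_bigr => d /negPf ->.
Qed.

End OneOperator.

Lemma geig_map V W (phi : {linear V -> V}) (psi : {linear W -> W}) (f : {linear V -> W}) l c v :
  (forall v, psi (f v) = f (phi v) + l *: f v) -> geig phi c v -> geig psi (c + l) (f v).
Proof.
move=> h [N vN]; exists N.
suff -> : iter N (shift psi (c + l)) (f v) = f (iter N (shift phi c) v) by rewrite vN linear0.
elim: N {vN} => //= N ->; rewrite h [in RHS]linearB [in RHS]linearZ /=.
by rewrite scalerDl opprD addrACA subrr addr0.
Qed.

(** By the Leibniz rule [shift psi (c + d)] sends [beta x y] to two terms, in each of which one
    argument has come one step closer to 0. Induction on the sum of the two exponents thus replaces
    a binomial expansion. *)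
Lemma geig_bilinear U V W (beta : U -> V -> W) (phi : {linear U -> U}) (phi' : {linear V -> V})
    (psi : {linear W -> W}) c d u v :
  (forall u, linear (beta u)) -> (forall v, linear (beta^~ v)) ->
  (forall u v, psi (beta u v) = beta (phi u) v + beta u (phi' v)) ->
  geig phi c u -> geig phi' d v -> geig psi (c + d) (beta u v).
Proof.
move=> lr ll leib [N uN] [M vM].
have b0l x : beta 0 x = 0 by rewrite -[beta 0 x]/(mklin (ll x) 0) linear0.
have b0r x : beta x 0 = 0 by rewrite -[beta x 0]/(mklin (lr x) 0) linear0.
have step x y : shift psi (c + d) (beta x y) = beta (shift phi c x) y + beta x (shift phi' d y).
  rewrite -[beta (shift _ _ _) _]/(mklin (ll y) _) -[beta x (shift _ _ _)]/(mklin (lr x) _) /=.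
  rewrite -[beta (_ - _) _]/(mklin (ll y) _) -[beta x (_ - _)]/(mklin (lr x) _).
  rewrite ![in RHS]linearB ![in RHS]linearZ /= leib scalerDl opprD addrACA !scalerN //.
suff H n : forall x y N M, (N + M <= n)%N -> iter N (shift phi c) x = 0 ->
    iter M (shift phi' d) y = 0 -> geig psi (c + d) (beta x y).
  exact: (H (N + M)%N u v N M (leqnn _) uN vM).
elim: n => [|n IH] x y {uN vM}{}N {}M.
  by rewrite leqn0 addn_eq0 => /andP[/eqP -> _] /= -> _; rewrite b0l; exact: geig0.
case: N => [|N]; first by move=> _ /= -> _; rewrite b0l; exact: geig0.
case: M => [|M]; first by move=> _ _ /= ->; rewrite b0r; exact: geig0.
move=> le xN yM.
have [K e] : geig psi (c + d) (shift psi (c + d) (beta x y)).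
  rewrite step; apply: geigD.
    by apply: (IH _ _ N M.+1) => //; rewrite -iterSr.
  by apply: (IH _ _ N.+1 M) => //; [rewrite addSnnS | rewrite -iterSr].
by exists K.+1; rewrite iterSr.
Qed.

End GeneralizedEigenspaces.

Section SpectralProjections.
Variable k : closedFieldType.
Implicit Types V W : lmodType k.

(** The last clause says that the [pr c] are the projections onto the generalized eigenspaces; [s]
    has to contain all eigenvalues, but may contain other scalars. *)
Definition spectral V (phi : {linear V -> V}) (s : seq k) (pr : k -> {linear V -> V}) : Prop :=
  [/\ uniq s, forall v, v = \sum_(c <- s) pr c v, forall c v, geig phi c (pr c v) &
      forall c d v, geig phi c v -> pr d v = if d == c then v else 0].

(** This is the Cayley-Hamilton theorem, the characteristic polynomial being a product of linear
    factors. Dimension 0 is treated apart because [horner_mx] takes matrices of positive size. *)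
Lemma killed_by_shifts V (phi : {linear V -> V}) : fin_dim V ->
  exists s : seq k, forall v, foldr (fun c => shift phi c) v s = 0.
Proof.
move=> /fin_dim_coord[[|n] [u [v [uK vK]]]].
  exists [::] => x /=; apply: (can_inj uK); by rewrite [LHS]thinmx0 [RHS]thinmx0.
pose D := lin1_mx (u \o phi \o v).
have DE x : x *m D = u (phi (v x)) by rewrite mul_rV_lin1.
have [s Ds] := closed_field_poly_normal (char_poly D).
exists s => x; apply: (can_inj uK); rewrite linear0.
suff -> y : u (foldr (fun c => shift phi c) y s) =
  u y *m horner_mx D (\prod_(z <- s) ('X - z%:P)).
  have := Cayley_Hamilton D.
  by rewrite Ds (monicP (char_poly_monic D)) scale1r => ->; rewrite mulmx0.
elim: s {Ds} => [|c s IH]; first by rewrite big_nil rmorph1 mulmx1.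
rewrite big_cons mulrC rmorphM /= mulmxA -IH rmorphB /= horner_mx_X horner_mx_C.
by rewrite mulmxBr DE uK mul_mx_scalar linearB linearZ.
Qed.

Lemma spectral_exists V (phi : {linear V -> V}) : fin_dim V ->
  exists s pr, spectral phi s pr.
Proof.
move=> /(killed_by_shifts phi)[t tP].
pose s := undup t; have us : uniq s by exact: undup_uniq.
have decomp v : exists w : k -> V, [/\ forall c, geig phi c (w c),
    forall c, c \notin s -> w c = 0 & v = \sum_(c <- s) w c].
  have [w [wE e]] := geig_decomp (tP v).
  exists (fun c => if c \in s then w c else 0); split=> [c|c /negPf ->|] //.
    by case: ifP => // _; exact: geig0.
  by rewrite e big_seq [RHS]big_seq; apply: eq_bigr => c ->.
have decomp_uniq (w w' : k -> V) : (forall c, geig phi c (w c)) -> (forall c, c \notin s ->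
  w c = 0) ->
    (forall c, geig phi c (w' c)) -> (forall c, c \notin s -> w' c = 0) ->
    \sum_(c <- s) w c = \sum_(c <- s) w' c -> forall c, w c = w' c.
  move=> wE w0 wE' w0' e c; have [cs|cs] := boolP (c \in s); last by rewrite w0 ?w0'.
  apply/eqP; rewrite -subr_eq0; apply/eqP.
  apply: (@geig_free _ _ phi s (fun c => w c - w' c)) => // [d|].
    by rewrite -scaleN1r addrC; exact: geigP.
  by rewrite sumrB e subrr.
pose pr0 c v := sval (cid (decomp v)) c.
have prP v : [/\ forall c, geig phi c (pr0 c v),
    forall c, c \notin s -> pr0 c v = 0 & v = \sum_(c <- s) pr0 c v] := svalP (cid (decomp v)).
have pr_lin c : linear (pr0 c).
  move=> a x y; have [xE x0 xs] := prP x; have [yE y0 ys] := prP y; have [zE z0 zs] :=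
    prP (a *: x + y).
  apply: (decomp_uniq (pr0^~ (a *: x + y)) (fun c => a *: pr0 c x + pr0 c y)) => // [d|d ds|].
  - exact: geigP.
  - by rewrite x0 // y0 // scaler0 addr0.
  - by rewrite -zs big_split /= -scaler_sumr -xs -ys.
exists s, (fun c => mklin (pr_lin c)); split=> //= [v|c v|c d v vc]; try by case: (prP v).
have [vE v0 vs] := prP v.
have [->|nv] := eqVneq v 0.
  by rewrite -[pr0 d 0]/(mklin (pr_lin d) 0) linear0 if_same.
have cs : c \in s.
  apply: contraNT nv => cs.
  (* If [c] were not in [s], then [- v] in degree [c] and the components of [v] in the degrees of
     [s] would sum to 0, which forces [v = 0]. *)
  have := @geig_free _ _ phi (c :: s) (fun d => if d == c then - v else pr0 d v).
  rewrite /= cs us => /(_ isT) H; have : - v = 0; last by move/eqP; rewrite oppr_eq0.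
  have /= := H _ _ c; rewrite eqxx; apply; rewrite ?mem_head //.
    by move=> d'; case: eqP => [->|//]; rewrite -scaleN1r; exact: geigZ.
  rewrite big_cons eqxx big_seq (eq_bigr (pr0^~ v)) -?big_seq -?vs ?addNr // => d' d's.
  by case: eqP d's => [->|//]; rewrite (negPf cs).
apply: (decomp_uniq (pr0^~ v) (fun d => if d == c then v else 0)) => // [d'|d' d's|].
- by case: eqP => [->|_] //; exact: geig0.
- by case: eqP d's => [->|//]; rewrite cs.
- by rewrite -vs (bigD1_seq c) //= eqxx big1 ?addr0 // => i /negPf ->.
Qed.

Section SpectralTheory.
Variables (V : lmodType k) (phi : {linear V -> V}) (s : seq k) (pr : k -> {linear V -> V}).
Hypothesis sp : spectral phi s pr.

Lemma spectral_uniq : uniq s. Proof. by case: sp. Qed.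
Lemma spectral_sum v : v = \sum_(c <- s) pr c v. Proof. by case: sp. Qed.
Lemma spectral_geig c v : geig phi c (pr c v). Proof. by case: sp. Qed.
Lemma spectralE c d v : geig phi c v -> pr d v = if d == c then v else 0.
Proof. by case: sp => _ _ _; apply. Qed.

Lemma spectral_pr c d v : pr d (pr c v) = if d == c then pr c v else 0.
Proof. by apply: spectralE; exact: spectral_geig. Qed.

Lemma spectral_out c v : c \notin s -> pr c v = 0.
Proof.
move=> cs; rewrite [in LHS](spectral_sum v) linear_sum big_seq big1 // => d ds.
by rewrite spectral_pr; case: eqP cs => // ->; rewrite ds.
Qed.
End SpectralTheory.

Lemma spectral_intertwine V W (phi : {linear V -> V}) s pr (psi : {linear W -> W}) s' pr'
    (f : {linear V -> W}) l :
  spectral phi s pr -> spectral psi s' pr' ->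
  (forall c v, geig phi c v -> geig psi (c + l) (f v)) ->
  forall c v, pr' (c + l) (f v) = f (pr c v).
Proof.
move=> sp sp' fg c v; rewrite [in LHS](spectral_sum sp v) !linear_sum /=.
have E d : pr' (c + l) (f (pr d v)) = if d == c then f (pr c v) else 0.
  rewrite (spectralE sp' (c + l) (fg d _ (spectral_geig sp d v))).
  by rewrite (inj_eq (addIr l)) eq_sym; case: eqP => [->|].
rewrite (eq_bigr _ (fun d _ => E d)); have [cs|cs] := boolP (c \in s).
  rewrite (bigD1_seq c) ?(spectral_uniq sp) //= eqxx big1 ?addr0 // => d /negPf -> //.
rewrite (spectral_out sp _ cs) linear0 big1 // => d _; exact: if_same.
Qed.

End SpectralProjections.

(** * Modules over the path algebra *)

Section ScalarRestriction.
Variables (k : fieldType) (A : algType k).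
Implicit Types L M N : lmodType A.

Definition klin M N := {linear restr_scalars M -> restr_scalars N}.

Fact kl_subproof M N (f : modhom M N) :
  linear (f : restr_scalars M -> restr_scalars N).
Proof. by move=> c u v; exact: (linearP f). Qed.
Definition kl M N (f : modhom M N) : klin M N := mklin (kl_subproof f).

Lemma scale_algC (f : A) M (c : k) (m : M) : f *: (c%:A *: m) = c%:A *: (f *: m).
Proof. by rewrite !scalerA -scalerAl mul1r -scalerAr mulr1. Qed.

Lemma scalerZ (f : A) M (c : k) (m : M) : (c *: f) *: m = c%:A *: (f *: m).
Proof. by rewrite scalerA -scalerAl mul1r. Qed.

Fact act_subproof M (f : A) : linear (fun m : restr_scalars M => f *: (m : M) : restr_scalars M).
Proof. by move=> c u v; rewrite [LHS]scalerDr; congr (_ + _); exact: scale_algC. Qed.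
Definition act M (f : A) : klin M M := mklin (@act_subproof M f).

Lemma klZ M N (phi : klin M N) (c : k) (m : M) : phi (c%:A *: m) = c%:A *: (phi m : N).
Proof. exact: (linearZ_LR phi c m). Qed.

Lemma klin_scale_commutes M N (phi : klin M N) c (f : A) (m : M) :
  phi (f *: m) = f *: (phi m : N) -> phi ((c *: f) *: m) = (c *: f) *: (phi m : N).
Proof. by move=> h; rewrite (scalerZ f c m) klZ h -scalerZ. Qed.

Lemma klin_scale_inj M (c d : k) (m : M) : m <> 0 -> c%:A *: m = d%:A *: m -> c = d.
Proof.
move=> nm e; apply/eqP; rewrite -subr_eq0; apply: contra_notT nm => ncd.
have : (c - d) *: (m : restr_scalars M) = 0.
  by rewrite scalerBl; apply/eqP; rewrite subr_eq0; apply/eqP.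
by move/eqP; rewrite scaler_eq0 (negPf ncd) => /eqP.
Qed.

Fact klin_modhom_subproof M N (phi : klin M N) :
  (forall (f : A) (m : M), phi (f *: m) = f *: (phi m : N)) -> linear (phi : M -> N).
Proof. by move=> h c u v; rewrite -h; exact: linearD. Qed.
Definition klin_modhom M N (phi : klin M N) h : modhom M N :=
  mk_hom (@klin_modhom_subproof M N phi h).

End ScalarRestriction.

Section PathAlgebraModules.
Variables (k : fieldType) (Q : quiver).
Local Notation A := (path_algebra k Q).
Implicit Types (x y : vert Q) (a : arr Q) (p q : qpath Q).

Definition qarr a : qpath Q := @QPath Q (src a, [:: a]) (introT andP (conj (eqxx _) isT)).
Definition pe x : A := path_elt k (pid x).
Definition pa a : A := path_elt k (qarr a).

Lemma path_eltM p q : path_elt k p * path_elt k q = opath_elt k (Defs.pcomp p q).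
Proof. exact: pamulUU. Qed.

Lemma sum_pe : \sum_x pe x = 1 :> A.
Proof. by []. Qed.

Lemma pe_path x p : pe x * path_elt k p = if x == ptgt p then path_elt k p else 0.
Proof. by rewrite /pe path_eltM pcomp_idl; case: ifP. Qed.

Lemma path_pe x p : path_elt k p * pe x = if x == psrc p then path_elt k p else 0.
Proof. by rewrite /pe path_eltM pcomp_idr; case: ifP. Qed.

Lemma pe_pe x y : pe x * pe y = if x == y then pe y else 0.
Proof. exact: pe_path. Qed.

Lemma pe_pa x a : pe x * pa a = if x == tgt a then pa a else 0.
Proof. exact: pe_path. Qed.

Lemma pa_pe x a : pa a * pe x = if x == src a then pa a else 0.
Proof. exact: path_pe. Qed.

Lemma path_elt_ind (P : A -> Prop) : (forall x, P (pe x)) ->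
  (forall f a, P f -> P (f * pa a)) -> forall p, P (path_elt k p).
Proof.
move=> Pe Pa [[x s]]; elim: s x => [|a s IH] x w.
  by rewrite (_ : QPath w = pid x); [exact: Pe | exact: val_inj].
have /andP[/= /eqP ax w'] := w.
suff -> : path_elt k (QPath w) = path_elt k (@QPath Q (tgt a, s) w') * pa a by apply: Pa;
  exact: IH.
rewrite path_eltM; have [//|r -> vr] := @pcompP Q (@QPath Q (tgt a, s) w') (qarr a).
by congr path_elt; apply: val_inj; rewrite vr /psrc /parr /= ax.
Qed.

Lemma klin_commutes (M N : lmodType A) (phi : klin M N) :
  (forall x (m : M), phi (pe x *: m) = pe x *: (phi m : N)) ->
  (forall a (m : M), phi (pa a *: m) = pa a *: (phi m : N)) ->
  forall (f : A) (m : M), phi (f *: m) = f *: (phi m : N).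
Proof.
move=> phie phia.
have H p (m : M) : phi (path_elt k p *: m) = path_elt k p *: (phi m : N).
  move: p m; apply: (@path_elt_ind (fun f => forall m : M, phi (f *: m) = f *: (phi m : N))).
    exact: phie.
  move=> f a IH m.
  by rewrite -!scalerA IH phia.
elim/pa_ind => [m|f g Pf Pg m|c p m].
- by rewrite !scale0r linear0.
- by rewrite !scalerDl -Pf -Pg; exact: linearD.
- exact: klin_scale_commutes (H p m).
Qed.

End PathAlgebraModules.

(** A representation of the quiver with its vertex spaces gathered in one space, as the images of
    the orthogonal idempotents [rep_e x]. It is the least data from which a module over the path
    algebra can be built. *)
Record quiver_rep (k : fieldType) (Q : quiver) (V : lmodType k) := QuiverRep {
  rep_e : vert Q -> {linear V -> V};
  rep_a : arr Q -> {linear V -> V};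
  rep_ee : forall x y v, rep_e x (rep_e y v) = if x == y then rep_e y v else 0;
  rep_e1 : forall v, \sum_x rep_e x v = v;
  rep_ea : forall x a v, rep_e x (rep_a a v) = if x == tgt a then rep_a a v else 0;
  rep_ae : forall x a v, rep_a a (rep_e x v) = if x == src a then rep_a a v else 0
}.

Section ModuleOfRep.
Variables (k : fieldType) (Q : quiver) (V : lmodType k) (r : quiver_rep Q V).
Local Notation A := (path_algebra k Q).
Implicit Types (x y : vert Q) (a : arr Q) (p q : qpath Q) (v : V).

Fixpoint rep_walk (s : seq (arr Q)) v : V :=
  if s is a :: s' then rep_walk s' (rep_a r a v) else v.
Definition rep_path p v : V := rep_walk (parr p) (rep_e r (psrc p) v).

Lemma rep_walk_linear s : linear (rep_walk s).
Proof. by elim: s => //= a s IH c u v; rewrite linearP IH. Qed.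

Lemma rep_walk_cat s t v : rep_walk (s ++ t) v = rep_walk t (rep_walk s v).
Proof. by elim: s v => //= a s IH v. Qed.

Lemma rep_walk0 s : rep_walk s 0 = 0.
Proof. exact: (linear0 (mklin (rep_walk_linear s))). Qed.

Lemma rep_path_linear p : linear (rep_path p).
Proof. by move=> c u v; rewrite /rep_path linearP rep_walk_linear. Qed.

Lemma rep_walk_end x s v : walk x s -> rep_e r x v = v ->
  forall y, rep_e r y (rep_walk s v) = if y == walk_end x s then rep_walk s v else 0.
Proof.
elim: s x v => [|a s IH] x v /=; first by move=> _ e y; rewrite -e rep_ee.
by move=> /andP[/eqP ax w] e y; apply: IH; rewrite // rep_ea eqxx.
Qed.

Lemma rep_path_comp p q v :
  rep_path p (rep_path q v) = if Defs.pcomp p q is Some s then rep_path s v else 0.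
Proof.
have E : rep_e r (psrc p) (rep_path q v) = if psrc p == ptgt q then rep_path q v else 0.
  by apply: rep_walk_end; [exact: (valP q) | rewrite rep_ee eqxx].
rewrite {1}/rep_path E; have [e|ne] := eqVneq (psrc p) (ptgt q).
  have [s -> vs] := pcompP (esym e).
  by rewrite /rep_path /psrc /parr vs /= rep_walk_cat.
by rewrite /Defs.pcomp eq_sym (negPf ne) rep_walk0.
Qed.

Lemma path_elt_spanning (F G : A -> V) :
  {morph F : f g / f + g} -> (forall c f, F (c *: f) = c *: F f) ->
  {morph G : f g / f + g} -> (forall c f, G (c *: f) = c *: G f) ->
  (forall p, F (path_elt k p) = G (path_elt k p)) -> F =1 G.
Proof.
move=> FD FZ GD GZ FG; elim/pa_ind => [|f g Ef Eg|c p].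
- by rewrite -(scale0r 0) FZ GZ !scale0r.
- by rewrite FD GD Ef Eg.
- by rewrite FZ GZ FG.
Qed.

Definition rep_act (f : A) v : V := \sum_(p <- msupp f) f@_p *: rep_path p v.

Lemma rep_actw (d : {fset qpath Q}) (f : A) v : (msupp f `<=` d)%fset ->
  rep_act f v = \sum_(p <- d) f@_p *: rep_path p v.
Proof.
move=> le; apply: big_fset_incl => // p _ /mcoeff_outdom ->.
by rewrite scale0r.
Qed.

Lemma rep_actDl v : {morph rep_act^~ v : f g / f + g}.
Proof.
move=> f g; rewrite (rep_actw _ (msuppD_le f g)).
rewrite (rep_actw _ (fsubsetUl (msupp f) (msupp g))) (rep_actw _ (fsubsetUr (msupp f) (msupp g))).
by rewrite -big_split /=; apply: eq_bigr => p _; rewrite mcoeffD scalerDl.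
Qed.

Lemma rep_actZl c f v : rep_act (c *: f) v = c *: rep_act f v.
Proof.
rewrite (rep_actw _ (msuppZ_le c f)) scaler_sumr.
by apply: eq_bigr => p _; rewrite mcoeffZ scalerA.
Qed.

Lemma rep_act_linear f : linear (rep_act f).
Proof.
move=> c u v; rewrite /rep_act scaler_sumr -big_split /=; apply: eq_bigr => p _.
by rewrite rep_path_linear scalerDr !scalerA mulrC.
Qed.

Lemma rep_act_path p v : rep_act (path_elt k p) v = rep_path p v.
Proof.
rewrite (@rep_actw [fset p]%fset) ?msuppU_le // big_seq_fset1.
by rewrite /path_elt mcoeffUU scale1r.
Qed.

Lemma rep_act0l v : rep_act 0 v = 0.
Proof. by rewrite -[0](scale0r 0) rep_actZl scale0r. Qed.

Lemma rep_actDr f u v : rep_act f (u + v) = rep_act f u + rep_act f v.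
Proof. exact: (linearD (mklin (rep_act_linear f))). Qed.

Lemma rep_actZr f c v : rep_act f (c *: v) = c *: rep_act f v.
Proof. exact: (linearZ_LR (mklin (rep_act_linear f))). Qed.

Lemma rep_actM f g v : rep_act f (rep_act g v) = rep_act (pamul f g) v.
Proof.
have H p q : rep_act (path_elt k p) (rep_act (path_elt k q) v) =
  rep_act (pamul (path_elt k p) (path_elt k q)) v.
  rewrite pamulUU !rep_act_path rep_path_comp.
  by case: Defs.pcomp => [s|] /=; rewrite ?rep_act_path ?rep_act0l.
move: f; apply: path_elt_spanning => [f1 f2|c f1|f1 f2|c f1|p].
- exact: rep_actDl.
- exact: rep_actZl.
- by rewrite pamulDl; exact: rep_actDl.
- by rewrite -pamulZl; exact: rep_actZl.
move: g; apply: path_elt_spanning => [g1 g2|c g1|g1 g2|c g1|q].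
- exact: etrans (congr1 _ (rep_actDl v g1 g2)) (rep_actDr _ _ _).
- exact: etrans (congr1 _ (rep_actZl c g1 v)) (rep_actZr _ _ _).
- by rewrite pamulDr; exact: rep_actDl.
- by rewrite -pamulZr; exact: rep_actZl.
- exact: H.
Qed.

Lemma rep_act1 v : rep_act 1 v = v.
Proof.
rewrite -[RHS](rep_e1 r) -(sum_pe k Q).
rewrite (big_morph (rep_act^~ v) (rep_actDl v) (rep_act0l v)).
by apply: eq_bigr => x _; exact: rep_act_path.
Qed.

Definition rep_module of quiver_rep Q V : Type := V.
HB.instance Definition _ := GRing.Zmodule.on (rep_module r).

Fact rep_scaleA (f g : A) (v : (rep_module r)) : rep_act f (rep_act g v) = rep_act (f * g) v.
Proof. exact: rep_actM. Qed.
Fact rep_scale1 : left_id 1 (rep_act : A -> (rep_module r) -> (rep_module r)).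
Proof. exact: rep_act1. Qed.
Fact rep_scaleDr : right_distributive (rep_act : A -> (rep_module r) -> (rep_module r)) +%R.
Proof. by move=> f u v; have := rep_act_linear f 1 u v; rewrite !scale1r. Qed.
Fact rep_scaleDl (v : (rep_module r)) : {morph (rep_act : A -> (rep_module r) ->
  (rep_module r))^~ v : f g / f + g}.
Proof. exact: rep_actDl. Qed.
HB.instance Definition _ := GRing.Zmodule_isLmodule.Build A (rep_module r)
  rep_scaleA rep_scale1 rep_scaleDr rep_scaleDl.

Lemma rep_modE (f : A) (v : (rep_module r)) : f *: v = rep_act f v.
Proof. by []. Qed.

Lemma rep_mod_pe x (v : (rep_module r)) : pe k x *: v = rep_e r x v.
Proof. exact: rep_act_path. Qed.

Lemma rep_mod_pa a (v : (rep_module r)) : pa k a *: v = rep_a r a v.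
Proof.
rewrite rep_modE /pa rep_act_path /rep_path /=.
by rewrite rep_ae eqxx.
Qed.

Lemma rep_mod_algC (c : k) (v : (rep_module r)) : c%:A *: v = (c *: (v : V) : V).
Proof. by rewrite rep_modE rep_actZl rep_act1. Qed.
End ModuleOfRep.

(* [qgen] expresses that the [qe x] and the [qa a] generate the algebra [A]. *)
Record quiver_algebra (k : fieldType) (Q : quiver) (A : algType k) := QuiverAlgebra {
  qe : vert Q -> A;
  qa : arr Q -> A;
  sum_qe : \sum_x qe x = 1;
  qe_qe : forall x y, qe x * qe y = if x == y then qe y else 0;
  qe_qa : forall x a, qe x * qa a = if x == tgt a then qa a else 0;
  qa_qe : forall x a, qa a * qe x = if x == src a then qa a else 0;
  qgen : forall (M N : lmodType A) (phi : klin M N),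
    (forall x (m : M), phi (qe x *: m) = qe x *: (phi m : N)) ->
    (forall a (m : M), phi (qa a *: m) = qa a *: (phi m : N)) ->
    forall (f : A) (m : M), phi (f *: m) = f *: (phi m : N)
}.

Section QuiverAlgebraAction.
Variables (k : fieldType) (Q : quiver) (A : algType k) (S : quiver_algebra Q A).
Lemma qe_corner (al : A) x : al * qe S x = qe S x * al ->
  qe S x * (al * qe S x) = al * qe S x /\ al * qe S x * qe S x = al * qe S x.
Proof. by move=> e; split; [rewrite e mulrA qe_qe eqxx | rewrite -mulrA qe_qe eqxx]. Qed.

Variables (M : lmodType A) (m : M).

Lemma sum_qe_act : \sum_x qe S x *: m = m.
Proof. by rewrite -scaler_suml sum_qe scale1r. Qed.

Lemma qe_qe_act x y : qe S x *: (qe S y *: m) = if x == y then qe S y *: m else 0.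
Proof. by rewrite scalerA qe_qe; case: eqP => // _; rewrite scale0r. Qed.

Lemma qe_qa_act x a : qe S x *: (qa S a *: m) = if x == tgt a then qa S a *: m else 0.
Proof. by rewrite scalerA qe_qa; case: eqP => // _; rewrite scale0r. Qed.

Lemma qa_qe_act x a : qa S a *: (qe S x *: m) = if x == src a then qa S a *: m else 0.
Proof. by rewrite scalerA qa_qe; case: eqP => // _; rewrite scale0r. Qed.

Lemma qe_qaD_act x a m' : qe S x *: (qa S a *: m + qe S (tgt a) *: m')
  = if x == tgt a then qa S a *: m + qe S (tgt a) *: m' else 0.
Proof.
rewrite scalerDr qe_qa_act !scalerA qe_qe; case: eqP => // _.
by rewrite scale0r addr0.
Qed.
End QuiverAlgebraAction.

(* For the path algebra, which is hereditary, the cokernel of [(phi_x) |-> (phi_(tgt a) a - a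
   phi_(src a))] is Ext^1(M, N). *)
Definition Ext1_zero (k : fieldType) (Q : quiver) (A : algType k) (S : quiver_algebra Q A)
    (M N : lmodType A) : Prop :=
  forall psi : arr Q -> klin M N, exists phi : klin M N,
    (forall x (m : M), phi (qe S x *: m) = qe S x *: (phi m : N)) /\
    (forall a (m : M), phi (qa S a *: m) - qa S a *: (phi m : N) =
       qe S (tgt a) *: (psi a (qe S (src a) *: m) : N) :> N).

Definition path_quiver_algebra (k : fieldType) (Q : quiver) :
    quiver_algebra Q (path_algebra k Q) :=
  @QuiverAlgebra k Q (path_algebra k Q) (@pe k Q) (@pa k Q) (@sum_pe k Q)
    (@pe_pe k Q) (@pe_pa k Q) (@pa_pe k Q) (@klin_commutes k Q).

Section ExtensionModule.
Variables (k : fieldType) (Q : quiver).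
Local Notation A := (path_algebra k Q).
Local Notation S := (path_quiver_algebra k Q).
Variables (M N : lmodType A) (psi : arr Q -> klin M N).

(** The extension of [M] by [N] with class [psi]: an arrow [a] acts on the sum of [N] and [M] by a
    triangular matrix with off-diagonal entry [psi a]. As arrows satisfy no relations, every family
    [psi] gives a module. *)
Definition ext_space : lmodType k := (restr_scalars N * restr_scalars M)%type.
Definition ext_e (x : vert Q) (v : ext_space) : ext_space := (qe S x *: (v.1 : N),
  qe S x *: (v.2 : M)).
Definition ext_a (a : arr Q) (v : ext_space) : ext_space :=
  (qa S a *: (v.1 : N) + qe S (tgt a) *: (psi a (qe S (src a) *: (v.2 : M)) : N),
    qa S a *: (v.2 : M)).

Fact ext_e_linear x : linear (ext_e x).
Proof.
move=> c u v; apply: (congr2 pair).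
  exact: (linearP (act N (qe S x))).
exact: (linearP (act M (qe S x))).
Qed.

Fact ext_a_linear a : linear (ext_a a).
Proof.
move=> c u v; apply: (congr2 pair); last exact: (linearP (act M (qa S a))).
pose F : klin M N := act N (qe S (tgt a)) \o psi a \o act M (qe S (src a)).
have E1 := linearP (act N (qa S a)) c u.1 v.1.
have E2 := linearP F c u.2 v.2.
apply: etrans (congr2 +%R E1 E2) _.
by rewrite /= scalerDr addrACA.
Qed.

Fact ext_ee x y v : mklin (ext_e_linear x) (mklin (ext_e_linear y) v)
  = if x == y then mklin (ext_e_linear y) v else 0.
Proof.
apply: etrans (congr2 pair (qe_qe_act _ _ _ _) (qe_qe_act _ _ _ _)) _.
by case: ifP.
Qed.

Fact ext_e1 v : \sum_x mklin (ext_e_linear x) v = v.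
Proof.
case: v => n m; apply: etrans (congr2 pair (sum_qe_act S n) (sum_qe_act S m)).
elim: (index_enum (vert Q)) => [|x s IH]; first by rewrite !big_nil.
rewrite big_cons IH; apply: esym.
by apply: (congr2 pair); apply: big_cons.
Qed.

Fact ext_ea x a v : mklin (ext_e_linear x) (mklin (ext_a_linear a) v)
  = if x == tgt a then mklin (ext_a_linear a) v else 0.
Proof.
by apply: etrans (congr2 pair (qe_qaD_act _ _ _ _ _) (qe_qa_act _ _ _ _)) _; case: ifP.
Qed.

Fact ext_ae x a v : mklin (ext_a_linear a) (mklin (ext_e_linear x) v)
  = if x == src a then mklin (ext_a_linear a) v else 0.
Proof.
have h : (ext_a a (ext_e x v)).1 = if x == src a then (ext_a a v).1 else 0 :> N.
  rewrite /ext_a /ext_e [X in X + _]qa_qe_act [X in psi a X]qe_qe_act eq_sym.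
  case: eqP => [<-|_] //.
  by rewrite (linear0 (psi a)) [X in _ + X]scaler0 addr0.
by apply: etrans (congr2 pair h (qa_qe_act _ _ _ _)) _; case: ifP.
Qed.

Definition ext_rep : quiver_rep Q ext_space := QuiverRep ext_ee ext_e1 ext_ea ext_ae.
Definition ext_module : lmodType A := rep_module ext_rep.

Fact ext_fst_subproof : linear (fst : restr_scalars ext_module -> restr_scalars N).
Proof. by move=> c u v; exact: (congr1 (fun w : ext_space => (w + v :
  ext_space).1) (rep_mod_algC c (u : ext_module))). Qed.
Definition ext_fst : klin ext_module N := mklin ext_fst_subproof.

Fact ext_snd_subproof : linear (snd : restr_scalars ext_module -> restr_scalars M).
Proof. by move=> c u v; exact: (congr1 (fun w : ext_space => (w + v :
  ext_space).2) (rep_mod_algC c (u : ext_module))). Qed.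
Definition ext_snd_klin : klin ext_module M := mklin ext_snd_subproof.

Fact ext_snd_commutes (f : A) (v : ext_module) : ext_snd_klin (f *: v) = f *: (ext_snd_klin v :
  M).
Proof.
apply: klin_commutes => [x w|a w].
  exact: (congr1 snd (rep_mod_pe x (w : ext_module))).
exact: (congr1 snd (rep_mod_pa a (w : ext_module))).
Qed.
Definition ext_snd : modhom ext_module M := klin_modhom ext_snd_commutes.

Lemma ext_fst_pe x (v : ext_module) : ext_fst (qe S x *: v) = qe S x *: (ext_fst v : N).
Proof. exact: (congr1 fst (rep_mod_pe x v)). Qed.

Lemma ext_fst_pa a (v : ext_module) : ext_fst (qa S a *: v)
  = qa S a *: (ext_fst v : N) + qe S (tgt a) *: (psi a (qe S (src a) *: ext_snd v) : N).
Proof. exact: (congr1 fst (rep_mod_pa a v)). Qed.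

Lemma ext_snd_surj m : exists v, ext_snd v = m.
Proof. by exists (0, m). Qed.

End ExtensionModule.

(** The augmentation of [P_0] lifts to a map [g] into the extension module, and [g] sends the first
    syzygy into [N]. Since Ext^1 vanishes, this restriction extends to some [h] from [P_0] to [N].
    Then [ext_fst g - h] descends to the map [phi] on [M], and [m |-> (phi m, m)] splits the
    extension. *)
Lemma Ext_vanishes_Ext1_zero (k : fieldType) (Q : quiver) (M N : lmodType (path_algebra k Q)) :
  finite_proj_dim M -> Ext_vanishes M N 1 -> Ext1_zero (path_quiver_algebra k Q) M N.
Proof.
(* [Ext_vanishes] speaks of all projective resolutions, so one has to be provided; it comes from the
   finite projective dimension. *)
move=> [P _] /(_ P) ext psi.
have [g gE] := @pres_proj _ _ _ P 0%N _ _ (ext_snd psi) (paug P) (ext_snd_surj psi).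
pose S := path_quiver_algebra k Q.
have d2 z : ext_snd psi (g (pdiff P 0 z)) = 0.
  by rewrite gE; apply: (paug_exact _).2; exists z.
pose f0 : klin (pres P 1) N := ext_fst psi \o kl g \o kl (pdiff P 0).
have f0E (f : path_algebra k Q) z : f0 (f *: z) = f *: (f0 z : N).
  apply: klin_commutes => [x m|a m]; rewrite /f0 /= !linearZ /=.
    exact: ext_fst_pe.
  rewrite ext_fst_pa d2.
  by rewrite [X in psi a X]scaler0 (linear0 (psi a)) [X in _ + X]scaler0 addr0.
have [|h hE] := ext (klin_modhom f0E).
  apply: hom_ext => z /=; have -> : pdiff P 0 (pdiff P 1 z) = 0.
    by apply: (@pdiff_exact _ _ _ P 0 _).2; exists z.
  by rewrite linear0.
have {}hE z : ext_fst psi (g (pdiff P 0 z)) = h (pdiff P 0 z).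
  by rewrite -[RHS]/(hom_comp h (pdiff P 0) z) -hE.
pose F : klin (pres P 0) N := ext_fst psi \o kl g \- kl h.
have F0 y : paug P y = 0 -> F y = 0.
  by move=> /(paug_exact _).1[z <-]; rewrite /F /= hE subrr.
have yP t : exists y, paug P y = t := paug_surj P t.
pose y t := sval (cid (yP t)).
have yE t : paug P (y t) = t := svalP (cid (yP t)).
have FE z : F (y (paug P z)) = F z.
  apply/eqP; rewrite -subr_eq0 -linearB; apply/eqP/F0.
  by rewrite linearB yE /= subrr.
have philin : linear (fun t : restr_scalars M => F (y t) : restr_scalars N).
  move=> c u v; transitivity (F (c *: (y u : restr_scalars (pres P 0)) + y v));
    last exact: (linearP F).
  rewrite -[RHS]FE; apply: (congr1 (fun t => F (y t))).
  have -> : paug P (c *: (y u : restr_scalars (pres P 0)) + y v) =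
    c%:A *: paug P (y u) + paug P (y v) by exact: (linearP (paug P)).
  by rewrite !yE.
have FA (f : path_algebra k Q) z : F (f *: z) = ext_fst psi (f *: g z) - f *: h z.
  by rewrite /F /= !linearZ.
have phiA (f : path_algebra k Q) m : mklin philin (f *: m) = F (f *: y m).
  by rewrite /= -[RHS]FE linearZ /= yE.
exists (mklin philin); split=> [x m|a m].
  rewrite phiA FA ext_fst_pe; apply: esym.
  exact: (@scalerBr _ N (qe S x) (ext_fst psi (g (y m))) (h (y m))).
have ab (X Y Z W : N) : W = X - Z -> X + Y - Z - W = Y by move=> ->; apply/eqP;
  rewrite subr_eq addrA (addrC Y).
rewrite phiA FA ext_fst_pa gE yE; apply: ab.
exact: (@scalerBr _ N (qa S a) (ext_fst psi (g (y m))) (h (y m))).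
Qed.

(** * Tilting modules *)

Section Summands.
Variables (k : fieldType) (A : algType k).
Implicit Types L M N T : lmodType A.

Lemma direct_sum_proj n (X : 'I_n -> lmodType A) M : direct_sum X M ->
  exists (inj : forall i, modhom (X i) M) (prj : forall i, modhom M (X i)),
    [/\ forall m, \sum_i inj i (prj i m) = m, forall i x, prj i (inj i x) = x &
        forall i j x, i != j -> prj j (inj i x) = 0].
Proof.
move=> [inj [g gK gK']].
have gD i : linear (fun m => g m i).
  move=> c u v; suff -> : g (c *: u + v) = (fun i => c *: g u i + g v i) by [].
  apply: (can_inj gK); rewrite gK'.
  rewrite -{1}[u]gK' -{1}[v]gK' scaler_sumr -big_split /=.
  by apply: eq_bigr => j _; rewrite linearP.
have gi i x : g (inj i x) = eqtype.dfwith (fun j => 0 : X j) x.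
  apply: (can_inj gK); rewrite gK' (bigD1 i) //= dfwith_in big1 ?addr0 // => j ji.
  by rewrite dfwith_out ?linear0 // eq_sym.
exists inj, (fun i => mk_hom (gD i)); split=> //= [i x|i j x ij].
  by rewrite gi dfwith_in.
by rewrite gi dfwith_out.
Qed.

(* Membership in add T, expressed by a dual basis: the identity of [M] factors through some
   [T^n]. *)
Definition factors_through T M : Prop :=
  exists n (p : 'I_n -> modhom M T) (q : 'I_n -> modhom T M), forall m, \sum_i q i (p i m) = m.

Lemma in_add_factors T M : in_add T M -> factors_through T M.
Proof.
move=> [n [X [sX /direct_sum_proj[inj [prj [e _ _]]]]]].
have H i : exists (u : modhom (X i) T) (v : modhom T (X i)), forall x, v (u x) = x.
  have [N' [f [g fK gK]]] := sX i.
  have glin : linear g.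
    by move=> c u v; apply: (can_inj fK); rewrite gK linearP !gK.
  have ul : linear (fun x : X i => f (x, 0)).
    move=> c x y; rewrite -linearP; congr (f _).
    by apply: (congr2 pair); [| exact: esym (etrans (addr0 _) (scaler0 _ _))].
  have vl : linear (fun t => (g t).1) by move=> c x y; rewrite glin.
  by exists (mk_hom ul), (mk_hom vl) => x /=; rewrite fK.
pose u i := sval (cid (H i)); pose v i := sval (cid (svalP (cid (H i)))).
have uv i x : v i (u i x) = x := svalP (cid (svalP (cid (H i)))) x.
exists n, (fun i => hom_comp (u i) (prj i)), (fun i => hom_comp (inj i) (v i)) => m.
by rewrite -[RHS]e; apply: eq_bigr => i _ /=; rewrite uv.
Qed.

Lemma factors_fin_dim T M : factors_through T M ->
  fin_dim (restr_scalars T) -> fin_dim (restr_scalars M).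
Proof.
move=> [n [p [q e]]] [m [b bP]].
have h t : exists c : 'I_m -> k, t = \sum_i (c i *: b i : restr_scalars T) by exact: bP.
pose c t := sval (cid (h t)).
have cE (t : T) : t = \sum_j (c t j *: b j : restr_scalars T) := svalP (cid (h t)).
pose B (ij : 'I_n * 'I_m) : restr_scalars M := q ij.1 (b ij.2).
exists #|{: 'I_n * 'I_m}|, (fun l => B (enum_val l)) => w.
exists (fun l => let ij : 'I_n * 'I_m := enum_val l in c (p ij.1 w) ij.2).
rewrite -{1}[w]e (eq_bigr (fun i => \sum_j c (p i w) j *: B (i, j))).
  by rewrite pair_bigA /= (reindex _ (onW_bij _ (enum_val_bij _))); apply: eq_bigr => l _;
    case: (enum_val l).
move=> i _; rewrite {1}[p i w]cE; rewrite (linear_sum (kl (q i))) /=.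
by apply: eq_bigr => j _; exact: (linearZ_LR (kl (q i))).
Qed.

End Summands.

Section ExtensionOfMaps.
Variables (k : fieldType) (Q : quiver) (A : algType k) (S : quiver_algebra Q A).
Implicit Types L M N T : lmodType A.

Lemma klin_sum_linear M N I (r : seq I) (F : I -> klin M N) :
  linear ((fun m => \sum_(i <- r) F i m) : restr_scalars M -> restr_scalars N).
Proof.
move=> c u v; rewrite scaler_sumr -big_split /=.
by apply: eq_bigr => i _; rewrite linearP.
Qed.

Lemma Ext1_zero_factors T M N : factors_through T M -> Ext1_zero S T N -> Ext1_zero S M N.
Proof.
move=> [n [p [q e]]] ET psi.
have H i : exists phi : klin T N,
    (forall x (m : T), phi (qe S x *: m) = qe S x *: (phi m : N)) /\
    (forall a (m : T), phi (qa S a *: m) - qa S a *: (phi m : N) =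
       qe S (tgt a) *: (psi a (q i (qe S (src a) *: m)) : N) :> N).
  exact: (ET (fun a => psi a \o kl (q i))).
pose phi i := sval (cid (H i)).
have phiP i := svalP (cid (H i)).
exists (mklin (klin_sum_linear (index_enum 'I_n) (fun i => phi i \o kl (p i)))).
split=> [x m|a m]; rewrite /= scaler_sumr.
  by apply: eq_bigr => i _; rewrite linearZ /= (phiP i).1.
rewrite -sumrB -[in RHS](e m) scaler_sumr (linear_sum (psi a)) scaler_sumr.
by apply: eq_bigr => i _; rewrite linearZ /= (phiP i).2 linearZ.
Qed.

Lemma Ext1_zero_retract M N T (u : modhom N T) (v : modhom T N) :
  (forall x, v (u x) = x) -> Ext1_zero S M T -> Ext1_zero S M N.
Proof.
move=> vu ET psi; have [phi [phie phia]] := ET (fun a => kl u \o psi a).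
exists (kl v \o phi); split=> [x m|a m] /=; first by rewrite phie linearZ.
have := congr1 v (phia a m); rewrite linearB !linearZ /= => ->.
by rewrite vu.
Qed.

(** Here [f] is any linear extension to [M] of a homomorphism defined on the kernel of [d]. Over the
    path algebra the obstruction to a homomorphic extension lies in Ext^1 of the image of [d], which
    is a quotient of Ext^1(M', T) by heredity. *)
Lemma hom_extension M M' T (d : modhom M M') (f : klin M T) :
  fin_dim (restr_scalars M) -> fin_dim (restr_scalars M') -> Ext1_zero S M' T ->
  (forall (a : A) (m : M), d m = 0 -> f (a *: m) = a *: (f m : T)) ->
  exists F : modhom M T, forall m, d m = 0 -> F m = f m.
Proof.
move=> fM fM' ET fker.
have [s sP] := pseudo_inverse (kl d) fM fM'.
pose pi : klin M M := idfun \- (s \o kl d).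
have dpi m : d (pi m) = 0 by rewrite /pi linearB [X in _ - X]sP subrr.
have pi_ker m : d m = 0 -> pi m = m by rewrite /pi /= => ->; rewrite linear0 subr0.
have sd m : s (d m) = m - pi m by rewrite /pi /= opprB addrC subrK.
clearbody pi.
pose F0 : klin M T := mklin (klin_sum_linear (index_enum (vert Q))
  (fun x => act T (qe S x) \o f \o pi \o act M (qe S x))).
have F0E m : F0 m = \sum_x qe S x *: (f (pi (qe S x *: m)) : T) by [].
have F0_ker m : d m = 0 -> F0 m = f m.
  move=> dm; rewrite F0E -[RHS](sum_qe_act S (f m : T)); apply: eq_bigr => x _.
  have dx : d (qe S x *: m) = 0 by rewrite linearZ /= dm scaler0.
  by rewrite pi_ker // fker // qe_qe_act eqxx.
have F0e y (m : M) : F0 (qe S y *: m) = qe S y *: (F0 m : T).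
  rewrite !F0E scaler_sumr; apply: eq_bigr => x _.
  by rewrite !qe_qe_act eq_sym; case: eqP => [->|_] //; rewrite !linear0 scaler0.
clearbody F0.
(* The failure of [F0] to commute with [a] vanishes on the kernel of [d], so it factors through [d];
   [psi a] is that factor, extended to [M'] by means of [s]. *)
pose psi a : klin M' T := (F0 \o act M (qa S a) \o s) \- (act T (qa S a) \o F0 \o s).
have psid a m : psi a (d m) = F0 (qa S a *: m) - qa S a *: (F0 m : T).
  rewrite /psi /= sd scalerBr.
  have -> : F0 (qa S a *: m - qa S a *: pi m) = F0 (qa S a *: m) - F0 (qa S a *: pi m)
    by exact: (linearB F0).
  have -> : F0 (m - pi m) = F0 m - F0 (pi m) by exact: (linearB F0).
  rewrite scalerBr.
  have dpa : d (qa S a *: pi m) = 0 by rewrite linearZ /= dpi scaler0.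
  rewrite (F0_ker (qa S a *: pi m)) // (F0_ker (pi m)) // fker //.
  by rewrite opprB addrA subrK.
have [G [Ge Ga]] := ET psi.
pose F : klin M T := F0 \- (G \o kl d).
have FA : forall (a : A) (m : M), F (a *: m) = a *: (F m : T).
  apply: (@qgen _ _ _ S M T F) => [x m|a m]; rewrite /F /=.
    by rewrite F0e linearZ /= Ge scalerBr.
  have Ga' : qe S (tgt a) *: (psi a (qe S (src a) *: d m) : T) =
    F0 (qa S a *: m) - qa S a *: (F0 m : T).
    have -> : qe S (src a) *: d m = d (qe S (src a) *: m) by rewrite linearZ.
    rewrite psid F0e !qa_qe_act !eqxx scalerBr -F0e.
    by rewrite !qe_qa_act !eqxx.
  have e := Ga a (d m); rewrite Ga' in e.
  have -> : d (qa S a *: m) = qa S a *: d m by rewrite linearZ.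
  rewrite scalerBr; move/eqP: e; rewrite subr_eq => /eqP ->.
  by rewrite opprD opprB addrA addrCA subrr addr0.
exists (klin_modhom FA) => m dm.
by rewrite /= /F /= dm linear0 subr0 F0_ker.
Qed.

End ExtensionOfMaps.

Lemma hom_sumE (k : fieldType) (A : algType k) (M N : lmodType A) I (r : seq I)
    (F : I -> modhom M N) m : (\sum_(i <- r) F i) m = \sum_(i <- r) F i m.
Proof. by elim/big_rec2: _ => // i x y _ <-. Qed.

Section Coresolution.
Variables (k : fieldType) (Q : quiver) (A : algType k) (S : quiver_algebra Q A).
Variables (T M0 M1 M2 : lmodType A).
Variables (e : modhom A^o M0) (d0 : modhom M0 M1) (d1 : modhom M1 M2).
Hypotheses (T_fin : fin_dim (restr_scalars T)) (T_rigid : Ext1_zero S T T).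
Hypotheses (addM0 : factors_through T M0) (addM1 : factors_through T M1)
  (addM2 : factors_through T M2).
Hypotheses (e_inj : injective e) (ex0 : exact_at e d0) (ex1 : exact_at d0 d1).

Let w : M0 := e 1.

Let M0_fin : fin_dim (restr_scalars M0). Proof. exact: factors_fin_dim addM0 T_fin. Qed.
Let M1_fin : fin_dim (restr_scalars M1). Proof. exact: factors_fin_dim addM1 T_fin. Qed.
Let M2_fin : fin_dim (restr_scalars M2). Proof. exact: factors_fin_dim addM2 T_fin. Qed.

Let eE (a : A) : e a = a *: w.
Proof. by rewrite /w -linearZ /=; congr (e _); rewrite [RHS]mulr1. Qed.

Let d0e a : d0 (e a) = 0.
Proof. by apply: (ex0 (e a)).2; exists a. Qed.

Let d1d0 m : d1 (d0 m) = 0.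
Proof. by apply: (ex1 (d0 m)).2; exists m. Qed.

(** Together with [cores_relations] this makes Hom(M1, T) -> Hom(M0, T) -> T -> 0 exact, the second
    map being evaluation at [w]: a presentation of [T] over its endomorphism ring. *)
Lemma cores_generates (t : T) : exists F : modhom M0 T, F w = t.
Proof.
have [s sP] := pseudo_inverse (kl d0) M0_fin M1_fin.
have exa (m : M0) : exists a : A, e a = m - s (d0 m).
  by apply: (ex0 _).1; rewrite linearB [X in _ - X]sP subrr.
(* [g] is a linear retraction of [e], so [m |-> g m *: t] is a linear extension to [M0] of the
   homomorphism [a |-> a *: t]. *)
pose g m := sval (cid (exa m)); have gE m : e (g m) = m - s (d0 m) := svalP (cid (exa m)).
have g_lin : linear ((fun m => g m *: t) : restr_scalars M0 -> restr_scalars T).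
  move=> c u v; have -> : g (c%:A *: (u : M0) + v) = c%:A * g u + g v.
    apply: e_inj; rewrite [RHS](linearP e) !gE.
    have -> : s (d0 (c%:A *: (u : M0) + v)) = c%:A *: (s (d0 u) : M0) + s (d0 v).
      by rewrite [d0 _](linearP d0); exact: (linearP s).
    by rewrite scalerBr opprD addrACA.
  by rewrite scalerDl -scalerA.
have g_ker m : d0 m = 0 -> e (g m) = m by move=> dm; rewrite gE dm linear0 subr0.
have [|F FE] := @hom_extension _ _ _ S M0 M1 T d0 (mklin g_lin) M0_fin M1_fin (Ext1_zero_factors
  addM1 T_rigid).
  move=> a m dm /=; rewrite scalerA; congr (_ *: t); apply: e_inj.
  rewrite g_ker; last by rewrite linearZ /= dm scaler0.
  by rewrite -[a * g m]/(a *: (g m : A^o)) linearZ /= g_ker.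
exists F; rewrite FE ?d0e //=.
suff -> : g w = 1 by rewrite scale1r.
by apply: e_inj; rewrite g_ker ?d0e.
Qed.

(** [F] vanishes on the image of [e], so it induces a homomorphism on the image of [d0], which is
    the kernel of [d1] and from which homomorphisms to [T] extend to [M1]. *)
Lemma cores_relations (F : modhom M0 T) : F w = 0 -> exists H : modhom M1 T, forall m, F m =
  H (d0 m).
Proof.
move=> Fw; have [s sP] := pseudo_inverse (kl d0) M0_fin M1_fin.
have Fe m : d0 m = 0 -> F m = 0 by move=> /(ex0 m).1[a <-]; rewrite eE linearZ /= Fw scaler0.
have Fs m : F (s (d0 m)) = F m.
  by apply/eqP; rewrite -subr_eq0 -linearB Fe // linearB [X in X - _]sP subrr.
have [|H HE] := @hom_extension _ _ _ S M1 M2 T d1 (kl F \o s) M1_fin M2_fin (Ext1_zero_factors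
  addM2 T_rigid).
  move=> a m /(ex1 m).1[z <-] /=.
  have -> : a *: d0 z = d0 (a *: z) by rewrite linearZ.
  by rewrite !Fs linearZ.
by exists H => m; rewrite HE ?d1d0 //= Fs.
Qed.

Lemma cores_faithful (a : A) : (forall t : T, a *: t = 0) -> a = 0.
Proof.
move=> aT; apply: e_inj; rewrite linear0 eE.
have [n [p [q pq]]] := addM0.
rewrite -[w]pq scaler_sumr big1 // => i _.
by rewrite -linearZ /= -linearZ /= linearZ /= aT linear0.
Qed.

(** A map commuting with all endomorphisms of [T] extends naturally to add T. Its value [u] at [w]
    is killed by [d0] by naturality, hence [u = e a]; any homomorphism from [M0] to [T] that sends
    [w] to [t] then sends [u] both to [phi t] and to [a *: t]. *)
Lemma cores_double_centralizer (phi : klin T T) :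
  (forall (b : modhom T T) t, phi (b t) = b (phi t)) -> exists a : A, forall t : T, phi t =
    a *: t.
Proof.
move=> phib; have [n [p [q pq]]] := addM0; have [n' [p' [q' pq']]] := addM1.
pose u := \sum_i q i (phi (p i w)).
have du : d0 u = 0.
  rewrite -[LHS]pq' (eq_bigr (fun j => q' j (phi (p' j (d0 w))))); last first.
    move=> j _; congr (q' j _); rewrite /u !linear_sum.
    rewrite -{2}[w]pq !linear_sum; apply: eq_bigr => i _.
    exact: (esym (phib (hom_comp (p' j) (hom_comp d0 (q i))) _)).
  by rewrite big1 // => j _; rewrite d0e !linear0.
have [a ea] := (ex0 u).1 du; exists a => t.
have [F <-] := cores_generates t.
rewrite -linearZ /= -eE ea /u linear_sum -{1}[w]pq !linear_sum; apply: eq_bigr => i _.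
exact: (phib (hom_comp F (q i))).
Qed.

Section LiftDerivation.
Variable D : {linear modhom T T -> modhom T T}.
Hypothesis D_leibniz : forall b c, D (hom_comp b c) = hom_comp b (D c) + hom_comp (D b) c.

(** Through the dual bases, [D] extends to maps [DF] and [DH] on Hom(M0, T) and Hom(M1, T), and [W]
    plays the role of the derivative of [d0]. The rule sending [F w] to [DF F w] is not well
    defined: on a relation [F = H d0] it gives [H (W w)]. The term [F s] in [G] cancels this
    defect. *)
Lemma cores_lift_derivation : exists nabla : klin T T,
  forall (b : modhom T T) t, nabla (b t) = D b t + b (nabla t).
Proof.
have [n [p [q pq]]] := addM0; have [n' [p' [q' pq']]] := addM1.
have [n2 [p2 [q2 pq2]]] := addM2.
have leib b c t : D (hom_comp b c) t = b (D c t) + D b (c t) by rewrite D_leibniz.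
pose DF (F : modhom M0 T) m : T := \sum_i D (hom_comp F (q i)) (p i m).
pose DH (H : modhom M1 T) m : T := \sum_j D (hom_comp H (q' j)) (p' j m).
pose c j i := hom_comp (p' j) (hom_comp d0 (q i)).
pose W m : M1 := \sum_i \sum_j q' j (D (c j i) (p i m)).
have DFb (b : modhom T T) F m : DF (hom_comp b F) m = D b (F m) + b (DF F m).
  rewrite /DF -{2}[m]pq !linear_sum -big_split; apply: eq_bigr => i _ /=.
  by rewrite addrC -leib; congr (D _ _); exact: hom_ext.
have DHc (H : modhom M1 T) i t :
    D (hom_comp (hom_comp H d0) (q i)) t = \sum_j (H (q' j (D (c j i) t)) + D (hom_comp H (q' j))
      (c j i t)).
  have -> : hom_comp (hom_comp H d0) (q i) = \sum_j hom_comp (hom_comp H (q' j)) (c j i).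
    by apply: hom_ext => x; rewrite hom_sumE -[LHS]/(H (d0 (q i x))) -[d0 _]pq' linear_sum.
  by rewrite linear_sum hom_sumE; apply: eq_bigr => j _; rewrite leib.
have DFd (H : modhom M1 T) m : DF (hom_comp H d0) m = H (W m) + DH H (d0 m).
  rewrite /DF (eq_bigr _ (fun i _ => DHc H i (p i m))) /W linear_sum /DH.
  under eq_bigr => i _ do rewrite big_split /=.
  rewrite big_split /=; congr (_ + _); first by apply: eq_bigr => i _; rewrite linear_sum.
  rewrite exchange_big /=; apply: eq_bigr => j _.
  by rewrite -[X in d0 X]pq !linear_sum.
have d0w : d0 w = 0 by exact: d0e.
have DH0 H : DH H 0 = 0 by rewrite /DH big1 // => j _; rewrite !linear0.
(* Differentiating [d1 d0 = 0] at [w], which [d0] kills, shows that [d1] kills [W w]; exactness at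
   [M1] then provides [s]. *)
have [s ds] : exists s, d0 s = - W w.
  apply: (ex1 _).1; rewrite linearN; apply/eqP; rewrite oppr_eq0 -[_ == 0]/(d1 (W w) == 0);
    apply/eqP.
  rewrite -[LHS]pq2 big1 // => h _.
  have := DFd (hom_comp (p2 h) d1) w; rewrite d0w DH0 addr0 /= => <-.
  rewrite /DF big1 ?linear0 // => i _.
  have -> : hom_comp (hom_comp (hom_comp (p2 h) d1) d0) (q i) = 0 by apply: hom_ext => x /=;
    rewrite d1d0 linear0.
  by rewrite linear0.
pose G (F : modhom M0 T) : T := DF F w + F s.
have G0 (F : modhom M0 T) : F w = 0 -> G F = 0.
  move=> /cores_relations[H FH]; rewrite /G FH ds linearN /=.
  have -> : F = hom_comp H d0 by apply: hom_ext => m; rewrite FH.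
  by rewrite DFd d0w DH0 addr0 subrr.
have GP (a : k) (F F' : modhom M0 T) : G (a *: F + F') = a%:A *: G F + G F'.
  rewrite /G /= scalerDr addrACA; congr (_ + _).
  rewrite /DF scaler_sumr -big_split; apply: eq_bigr => i _ /=.
  have -> : hom_comp (a *: F + F') (q i) = a *: hom_comp F (q i) + hom_comp F' (q i)
    by exact: hom_ext.
  by rewrite linearP.
pose Ft t := sval (cid (cores_generates t)); have FtE t : Ft t w = t :=
  svalP (cid (cores_generates t)).
have GE (F : modhom M0 T) : G (Ft (F w)) = G F.
  have z : (F - Ft (F w)) w = 0 by rewrite -[LHS]/(F w - Ft (F w) w) FtE subrr.
  by have := GP 1 (F - Ft (F w)) (Ft (F w)); rewrite !scale1r subrK (G0 _ z) add0r.
have nabla_lin : linear ((fun t => G (Ft t)) : restr_scalars T -> restr_scalars T).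
  move=> a u v; have := GP a (Ft u) (Ft v); rewrite -GE => <-; congr (G (Ft _)).
  by rewrite /= !FtE.
exists (mklin nabla_lin) => b t /=.
rewrite -{1}[t]FtE -[b (Ft t w)]/(hom_comp b (Ft t) w) GE /G DFb FtE /= linearD addrA //.
Qed.
End LiftDerivation.

End Coresolution.

Lemma tilting_properties (k : fieldType) (Q : quiver) (T : lmodType (path_algebra k Q)) :
  tilting T ->
  [/\ Ext1_zero (path_quiver_algebra k Q) T T,
      forall a : path_algebra k Q, (forall t : T, a *: t = 0) -> a = 0,
      forall phi : klin T T, (forall (b : modhom T T) t, phi (b t) = b (phi t)) ->
        exists a : path_algebra k Q, forall t : T, phi t = a *: t &
      forall D : {linear modhom T T -> modhom T T},
        (forall b c, D (hom_comp b c) = hom_comp b (D c) + hom_comp (D b) c) ->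
        exists nabla : klin T T, forall (b : modhom T T) t, nabla (b t) = D b t + b (nabla t)].
Proof.
move=> [T_fin T_pd T_ext [r [X [e [d [e_inj ex0 ex addX _]]]]]].
have E : Ext1_zero (path_quiver_algebra k Q) T T.
  exact: Ext_vanishes_Ext1_zero T_pd (T_ext 1%N isT).
have fX i : factors_through T (X i) by exact: in_add_factors.
split=> //.
- exact: cores_faithful (fX 0%N) e_inj.
- by apply: (cores_double_centralizer T_fin E (fX 0%N) (fX 1%N) e_inj ex0).
- by apply: (cores_lift_derivation T_fin E (fX 0%N) (fX 1%N) (fX 2%N) e_inj ex0 (ex 0%N)).
Qed.

(** * Rigid indecomposable modules *)

Section RigidIndecomposable.
Variables (k : closedFieldType) (Q : quiver) (A : algType k) (S : quiver_algebra Q A).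
Variable X : lmodType A.
Hypotheses (X_fin : fin_dim (restr_scalars X)) (X_indec : indecomposable X).

Lemma indecomposable_idempotent (p : modhom X X) : (forall x, p (p x) = p x) ->
  (forall x, p x = 0) \/ (forall x, p x = x).
Proof.
move=> pp; pose q : modhom X X := hom_id X - p.
have qE x : q x = x - p x by [].
have qq x : q (q x) = q x by rewrite !qE linearB pp subrr subr0.
pose N : lmodType A := fixsp p; pose N' : lmodType A := fixsp q.
have f_lin : linear (fun u : N * N' => val u.1 + val u.2 : X).
  by move=> c u v; rewrite /= scalerDr addrACA.
have [] := X_indec.2 N N'.
- exists (mk_hom f_lin), (fun x => (mk_fixsp (pp x), mk_fixsp (qq x))) => [[u u']|x] /=;
  last by rewrite addrC subrK.
  have pu := fixspE u; have qu := fixspE u'.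
  have pu' : p (val u') = 0 by apply/eqP; rewrite -(inj_eq (addrI (val u'))) addr0 -{1}qu qE
    subrK.
  have e : p (val u + val u') = val u by rewrite linearD /= pu pu' addr0.
  by congr pair; apply: val_inj; rewrite /= ?e // addrC addKr.
- by move=> N0; left=> x; exact: (congr1 val (N0 (mk_fixsp (pp x)))).
- move=> N0; right=> x; apply/eqP; rewrite eq_sym -subr_eq0 -qE; apply/eqP.
  exact: (congr1 val (N0 (mk_fixsp (qq x)))).
Qed.

(** A form of Fitting's lemma: the spectral projections of an endomorphism are themselves idempotent
    endomorphisms, so a non-zero one is the identity. *)
Lemma indecomposable_endo (f : modhom X X) : exists c, forall x, geig (kl f) c x.
Proof.
have [s [pr sp]] := spectral_exists (kl f) X_fin.
have prA c (a : A) (x : X) : pr c (a *: x) = a *: (pr c x : X).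
  have := @spectral_intertwine k (restr_scalars X) (restr_scalars X) (kl f) s pr (kl f) s pr (act
    X a) 0 sp sp.
  move=> /(_ _ c x); rewrite addr0; apply => d y yd; apply: geig_map yd => z.
  by rewrite scale0r addr0 /= linearZ.
have prI c := @indecomposable_idempotent (klin_modhom (prA c)).
have [x nx] : exists x : X, x <> 0.
  by apply: contrapT => nx; apply: X_indec.1 => x; apply: contrapT => x0; apply: nx; exists x.
have [c nc] : exists c, pr c x <> 0.
  apply: contrapT => nc; apply: nx; rewrite (spectral_sum sp x) big1 // => c _.
  by apply: contrapT => pc; apply: nc; exists c.
exists c => y; have [|/= p0|/= p1] := prI c.
- by move=> z /=; rewrite (spectral_pr sp) eqxx.
- by case: nc; rewrite p0.
- by have := spectral_geig sp c y; rewrite p1.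
Qed.

Lemma equivariant_pseudo_inverse (M N : lmodType A) (d : modhom M N) :
  fin_dim (restr_scalars M) -> fin_dim (restr_scalars N) ->
  exists s : klin N M, (forall m, d (s (d m)) = d m) /\
    (forall x (n : N), s (qe S x *: n) = qe S x *: (s n : M)).
Proof.
move=> fM fN; have [s sP] := pseudo_inverse (kl d) fM fN.
exists (mklin (klin_sum_linear (index_enum (vert Q))
  (fun x => act M (qe S x) \o s \o act N (qe S x)))); split=> [m|y n] /=.
  rewrite linear_sum -[RHS](sum_qe_act S); apply: eq_bigr => x _.
  have -> : qe S x *: d m = d (qe S x *: m) by rewrite linearZ.
  by rewrite linearZ /= (sP (qe S x *: m)) /= linearZ /= qe_qe_act eqxx.
rewrite scaler_sumr; apply: eq_bigr => x _.
by rewrite !qe_qe_act eq_sym; case: eqP => [->|_] //; rewrite linear0 scaler0.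
Qed.

Hypothesis X_rigid : Ext1_zero S X X.

(* With [pi] a projection onto the image [I] of [f], rigidity lifts the derivation [pi, -],
   which vanishes on [I], along [f] and gives [phi], linear over [A] on [I], such that [theta =
   pi - f phi] is an endomorphism with values in [I]: if [I != X] then [theta] is nilpotent, so
   that [f phi = 1 - theta] is invertible on [I] and [I] is a proper direct summand of [X]. *)
Lemma rigid_indecomposable_endo_inj (f : modhom X X) :
  (exists2 x, f x = 0 & x <> 0) -> forall x, f x = 0.
Proof.
move=> [x0 fx0 nx0].
have [s [sP se]] := equivariant_pseudo_inverse f X_fin X_fin.
(* The projection [pi] is [f s], and the family is [s [pi, a]]: a lift of [[pi, a]] along [f], since
   [[pi, a]] takes its values in the image of [f]. *)
have [phi [phie phia]] := X_rigid (fun a =>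
  (s \o kl f \o s \o act X (qa S a)) \- (s \o act X (qa S a) \o kl f \o s)).
have non_surj : exists y, forall x, f x <> y.
  apply: contrapT => ns; have fs y : f (s y) = y.
    have [x <-] : exists x, f x = y; last exact: sP.
    by apply: contrapT => nx; apply: ns; exists y => x fx; apply: nx; exists x.
  have [z sz] : exists z, s z = x0.
    apply: inj_surj => // u v; rewrite -{2}[u]fs => e; rewrite -[u]fs e fs //.
  by apply: nx0; rewrite -sz -[z]fs sz fx0 linear0.
pose theta : klin X X := (kl f \o s) \- (kl f \o phi).
have thetaE x : theta x = f (s x) - f (phi x) by [].
have fZ (a : A) z : f (a *: z) = a *: f z by exact: linearZ.
have phia' a (x : X) : phi (qa S a *: x) - qa S a *: (phi x : X)
    = s (f (s (qa S a *: x)) - qa S a *: f (s x)) :> X.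
  rewrite phia [X in qe S _ *: X]/= qa_qe_act eqxx !se.
  by rewrite fZ qa_qe_act eqxx scalerBr -!se -fZ -se !qe_qa_act eqxx -linearB.
have phif (a : A) (x : X) : phi (f (a *: x)) = a *: (phi (f x) : X).
  apply: (@qgen _ _ _ S X X (phi \o kl f)) => [y z|b z] /=; rewrite fZ ?phie //.
  by apply/eqP; rewrite -subr_eq0 phia' sP -fZ sP subrr linear0.
have thetaA (a : A) (x : X) : theta (a *: x) = a *: (theta x : X).
  apply: (@qgen _ _ _ S X X theta) => [y z|b z]; rewrite !thetaE ?phie ?se ?fZ ?scalerBr //.
  have e := phia' b z; move/eqP: e; rewrite subr_eq => /eqP ->.
  rewrite linearD fZ -(fZ _ (s z)).
  have -> : f (s (qa S b *: z)) - f (qa S b *: s z) = f (s (qa S b *: z) - qa S b *: s z)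
    by rewrite linearB.
  rewrite sP [f (_ - _)]linearB /=.
  by rewrite opprD addrA opprB addrCA subrr addr0.
pose th := klin_modhom thetaA; pose eta := @klin_modhom _ _ X X (phi \o kl f) phif.
have th0 y : geig theta 0 y.
  have [c cP] := indecomposable_endo th.
  have [<-|nc] := eqVneq c 0; first exact: cP.
  have [y0 ny0] := non_surj.
  have [z tz] : exists z, theta z = y0.
    apply: inj_surj => // u v uv; apply/eqP; rewrite -subr_eq0; apply/eqP.
    by apply: (geig_disjoint nc (cP _)); apply: geig_eigen;
      rewrite scale0r [LHS](linearB theta) uv subrr.
  by case: (ny0 (s z - phi z)); rewrite linearB /= -thetaE.
(* [eta = phi f] is an endomorphism that kills [x0], so its only eigenvalue is 0. *)
have eta0 y : geig (phi \o kl f) 0 y.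
  have [c cP] := indecomposable_endo eta.
  have [<-|nc] := eqVneq c 0; first exact: cP.
  case: nx0; apply: (geig_disjoint nc (cP _)); apply: geig_eigen.
  by rewrite /= fx0 linear0 scale0r.
move=> x; apply: (@geig_disjoint _ _ theta 1 0 (f x) (oner_neq0 _)) => //.
have [N xN] := eta0 x; exists N.
(* [f] carries [eta] to [1 - theta], so nilpotency of [eta] puts [f x] in degree 1 for [theta],
   while all of [X] has degree 0. *)
have shE y : shift theta 1 (f y) = - f (shift (phi \o kl f) 0 y).
  by rewrite /= scale0r subr0 scale1r sP addrAC subrr add0r.
have -> : iter N (shift theta 1) (f x) = (-1) ^+ N *: (f (iter N (shift (phi \o kl f) 0) x) :
  restr_scalars X).
  elim: {xN}N => [|N IH]; first by rewrite scale1r.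
  by rewrite !iterS IH [LHS]linearZ shE exprSr -scalerA scaleN1r.
by rewrite xN linear0 scaler0.
Qed.

(** If [c] is the eigenvalue of [f], then [f - c] is nilpotent, so it is not injective and therefore
    0. *)
Lemma rigid_indecomposable_endo_scalar (f : modhom X X) : exists c : k, forall x, f x = c%:A *: x.
Proof.
have [c cP] := indecomposable_endo f; exists c => x.
pose g : modhom X X := f - c *: hom_id X.
have gE y : g y = f y - c%:A *: y by [].
apply/eqP; rewrite -subr_eq0 -gE; apply/eqP; apply: rigid_indecomposable_endo_inj.
apply: contrapT => inj; apply: X_indec.1 => y.
have [N] := cP y; have -> : iter N (shift (kl f) c) y = iter N g y.
  by elim: N => //= N ->.
elim: N => //= N IH gN; apply: IH; apply: contrapT => nz; apply: inj.
by exists (iter N g y).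
Qed.

End RigidIndecomposable.

(** * Smash products as Galois coverings *)

Section FullyFaithfulIso.
Variables (k : fieldType) (C D : kcat k) (K : kfunctor C D) (o : D -> C).
Hypotheses (oK : cancel o K) (Ko : cancel K o).
Hypotheses (K_inj : forall x y : C, injective (@fmor _ _ _ K x y))
  (K_surj : forall (x y : C) (f : mor D (K x) (K y)), exists g, @fmor _ _ _ K x y g = f).

Lemma to_arrow_at_hom (E : kcat k) (x y x' y' : E) (f : mor E x y) :
  x = x' -> y = y' -> to_arrow (at_hom x' y' (to_arrow f)) = to_arrow f.
Proof. by case: _ / => {}; case: _ /; rewrite at_homE. Qed.

Lemma at_hom_linear (E : kcat k) (x y x' y' : E) : x = x' -> y = y' ->
  linear (fun f : mor E x y => at_hom x' y' (to_arrow f)).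
Proof. by case: _ / => {}; case: _ / => c f g; rewrite !at_homE. Qed.

Lemma at_hom_id (E : kcat k) (x x' : E) : x = x' -> at_hom x' x' (to_arrow (idm x)) = idm x'.
Proof. by case: _ /; rewrite at_homE. Qed.

Lemma at_hom_comp (E : kcat k) (x y z x' y' z' : E) (g : mor E y z) (f : mor E x y) :
  x = x' -> y = y' -> z = z' ->
  at_hom x' z' (to_arrow (kcomp g f)) = kcomp (at_hom y' z' (to_arrow g)) (at_hom x' y' (to_arrow
    f)).
Proof. by case: _ / => {}; case: _ / => {}; case: _ / => {}; rewrite !at_homE. Qed.

(** [K (o x)] and [x] are only propositionally equal, so [at_hom] serves as transport between their
    morphism spaces; equality of functors compares bundled morphisms and absorbs the transport. *)
Lemma kfunctor_iso_bij : kfunctor_iso K.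
Proof.
pose u x y (f : mor D x y) : mor C (o x) (o y) :=
  sval (cid (K_surj (at_hom (K (o x)) (K (o y)) (to_arrow f)))).
have uE x y (f : mor D x y) : fmor K (u x y f) = at_hom (K (o x)) (K (o y)) (to_arrow f) :=
  svalP (cid (K_surj (at_hom (K (o x)) (K (o y)) (to_arrow f)))).
have u_lin x y : linear (u x y).
  move=> c f g; apply: K_inj; rewrite linearP /= !uE.
  exact: (at_hom_linear (esym (oK x)) (esym (oK y))).
have u_id x : mklin (u_lin x x) (idm x) = idm (o x).
  by apply: K_inj; rewrite /= uE fmor_id; exact: (at_hom_id (esym (oK x))).
have u_comp x y z (g : mor D y z) (f : mor D x y) :
    mklin (u_lin x z) (kcomp g f) = kcomp (mklin (u_lin y z) g) (mklin (u_lin x y) f).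
  apply: K_inj; rewrite fmor_comp /= !uE.
  exact: (at_hom_comp g f (esym (oK x)) (esym (oK y)) (esym (oK z))).
exists (@KFunctor k D C o (fun x y => mklin (u_lin x y)) u_id u_comp); split=> x y f /=.
  have -> : u (K x) (K y) (fmor K f) = at_hom (o (K x)) (o (K y)) (to_arrow f).
    apply: K_inj; rewrite uE; move: (Ko x) (Ko y); move: (o (K x)) (o (K y)) => x' y' ex ey.
    by case: x / ex f => f; case: y / ey f => f; rewrite !at_homE.
  exact: (to_arrow_at_hom f (esym (Ko x)) (esym (Ko y))).
by rewrite uE; exact: (to_arrow_at_hom f (esym (oK x)) (esym (oK y))).
Qed.

End FullyFaithfulIso.

Section SmashProduct.
Variables (k : fieldType) (B : kcat k) (G : groupType).
Variable pr : forall x y : B, G -> {linear mor B x y -> mor B x y}.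
Variable supp : B -> B -> seq G.
Arguments pr {x y} _.
Hypotheses (supp_uniq : forall x y, uniq (supp x y))
  (pr_sum : forall x y (f : mor B x y), f = \sum_(d <- supp x y) pr d f)
  (pr_pr : forall x y (f : mor B x y) g h, pr g (pr h f) = if g == h then pr h f else 0)
  (pr_id : forall x : B, pr 1%g (idm x) = idm x)
  (pr_comp : forall x y z (u : mor B y z) (f : mor B x y) g h,
     pr g f = f -> pr h u = u -> pr (g * h)%g (kcomp u f) = kcomp u f).

Definition smash_ob : choiceType := (B * G)%type.
(** The morphisms from [(x, g)] to [(y, h)] are those of degree [g^-1 * h]. This degree is unchanged
    when [g] and [h] are multiplied on the left by the same element, whence the action of [G] by
    left translation. *)
Definition smash_mor (p q : smash_ob) : lmodType k := fixsp (@pr p.1 q.1 (p.2^-1 * q.2)%g).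

Fact smash_id_subproof (p : smash_ob) : pr (p.2^-1 * p.2)%g (idm p.1) = idm p.1.
Proof. by rewrite mulVg. Qed.
Definition smash_id p : smash_mor p p := mk_fixsp (smash_id_subproof p).

Fact smash_comp_subproof p q r (u : smash_mor q r) (f : smash_mor p q) :
  pr (p.2^-1 * r.2)%g (kcomp (val u) (val f)) = kcomp (val u) (val f).
Proof.
have -> : (p.2^-1 * r.2 = (p.2^-1 * q.2) * (q.2^-1 * r.2))%g by rewrite mulgA mulgK.
by apply: pr_comp; exact: fixspE.
Qed.
Definition smash_comp p q r (u : smash_mor q r) (f : smash_mor p q) : smash_mor p r :=
  mk_fixsp (smash_comp_subproof u f).

Fact smash_comp_linearl p q r (f : smash_mor p q) : linear (fun u : smash_mor q r =>
  smash_comp u f).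
Proof. by move=> c u v; apply: val_inj; exact: (comp_linearl (val f)). Qed.
Fact smash_comp_linearr p q r (u : smash_mor q r) : linear (fun f : smash_mor p q =>
  smash_comp u f).
Proof. by move=> c f g; apply: val_inj; exact: (comp_linearr (val u)). Qed.
Fact smash_compA p q r t (h : smash_mor r t) (g : smash_mor q r) (f : smash_mor p q) :
  smash_comp h (smash_comp g f) = smash_comp (smash_comp h g) f.
Proof. by apply: val_inj; exact: Defs.compA. Qed.
Fact smash_comp_idl p q (f : smash_mor p q) : smash_comp (smash_id q) f = f.
Proof. by apply: val_inj; exact: comp_idl. Qed.
Fact smash_comp_idr p q (f : smash_mor p q) : smash_comp f (smash_id p) = f.
Proof. by apply: val_inj; exact: comp_idr. Qed.

Definition smash : kcat k := @KCat k smash_ob smash_mor smash_id smash_comp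
  smash_comp_linearl smash_comp_linearr smash_compA smash_comp_idl smash_comp_idr.

Lemma smash_to_arrow (x y : B) (g g' h h' : G) (f : mor smash (x, g) (y, h))
    (f' : mor smash (x, g') (y, h')) :
  g = g' -> h = h' -> val f = val f' -> to_arrow f = to_arrow f'.
Proof. by move=> eg eh; case: _ / eg f'; case: _ / eh => f' e; congr to_arrow;
  exact: val_inj. Qed.

Definition smash_proj : kfunctor smash B :=
  @KFunctor k smash B (fun p => p.1) (fun p q =>
    mklin (@fixsp_val_linear _ _ (@pr p.1 q.1 (p.2^-1 * q.2)%g)))
    (fun _ => erefl) (fun _ _ _ _ _ => erefl).

Section Translation.
Variable t : G.
Definition translate (p : smash) : smash := (p.1, (t * p.2)%g).

Fact translate_mor_subproof (p q : smash) (f : mor smash p q) :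
  pr ((t * p.2)^-1 * (t * q.2))%g (val f) = val f.
Proof. by rewrite invgM -mulgA mulKg fixspE. Qed.
Definition translate_mor (p q : smash) (f : mor smash p q) :
  mor smash (translate p) (translate q) :=
  mk_fixsp (translate_mor_subproof f).
Fact translate_mor_linear p q : linear (@translate_mor p q).
Proof. by move=> c f g; apply: val_inj. Qed.
Fact translate_id p : mklin (@translate_mor_linear p p) (idm p) = idm (translate p).
Proof. exact: val_inj. Qed.
Fact translate_comp p q r (u : mor smash q r) (f : mor smash p q) :
  mklin (@translate_mor_linear p r) (kcomp u f)
  = kcomp (mklin (@translate_mor_linear q r) u) (mklin (@translate_mor_linear p q) f).
Proof. exact: val_inj. Qed.
Definition translation : kfunctor smash smash :=
  @KFunctor k smash smash translate (fun p q =>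
    mklin (@translate_mor_linear p q)) translate_id translate_comp.
End Translation.

Fact translation1 : kfunctor_eq (translation 1%g) (kfunctor_id smash).
Proof. by move=> [x g] [y h] f; apply: smash_to_arrow; rewrite ?mul1g. Qed.
Fact translationM g h :
  kfunctor_eq (translation (g * h)%g) (kfunctor_comp (translation g) (translation h)).
Proof. by move=> [x a] [y b] f; apply: smash_to_arrow; rewrite ?mulgA. Qed.
Definition smash_action : kaction G smash := KAction translation1 translationM.

Lemma smash_action_free : free_action smash_action.
Proof.
move=> g [x h] /(congr1 snd) /= e.
by apply: (mulIg h); rewrite e mul1g.
Qed.

Lemma pr_out (x y : B) (f : mor B x y) d : d \notin supp x y -> pr d f = 0.
Proof.
move=> nd; rewrite [in LHS](pr_sum f) linear_sum big_seq big1 // => e es.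
by rewrite pr_pr; case: eqP nd => // ->; rewrite es.
Qed.

Lemma pr_val (p q : smash) (f : mor smash p q) d e : (p.2^-1 * q.2)%g = e ->
  pr d (val f) = if d == e then val f else 0.
Proof. by move=> <-; rewrite -[val f]fixspE pr_pr. Qed.

Lemma smash_supp (p q : smash) (f : mor smash p q) : f <> 0 -> (p.2^-1 * q.2)%g \in supp p.1 q.1.
Proof.
move=> nf; apply: contrapT => /negP /pr_out e; apply: nf; apply: val_inj.
by rewrite -[LHS]fixspE e.
Qed.

Lemma fsum_seq (V : nmodType) (I : choiceType) (s : seq I) (F : I -> V) : uniq s ->
  (forall i, F i <> 0 -> i \in s) -> \sum_(i \in setT) F i = \sum_(i <- s) F i.
Proof.
move=> us Fs; rewrite (@fsumE _ _ [set` s]) //.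
apply: perm_big; apply: uniq_perm => // i.
by rewrite in_fset_set //; apply/idP/idP; rewrite inE.
Qed.

Local Notation orb := (orbits smash_action).

Lemma orbit_of_fst (p q : smash) : orbit_of smash_action p = orbit_of smash_action q <-> p.1 =
  q.1.
Proof.
rewrite orbit_ofP; split=> [[g <-] //|]; case: p q => [x g] [y h] /= ->.
by exists (h * g^-1)%g; rewrite /= /translate /= mulgVK.
Qed.

Definition orbit_repr (A : orb) : smash := repr A.
Lemma orbit_reprK (A : orb) : orbit_of smash_action (orbit_repr A) = A.
Proof. exact: reprK. Qed.

(* At [p = orbit_repr A] and [y = (orbit_repr C).1] this is the morphism of [B] corresponding to
   the morphism [q] of the quotient category. *)
Definition fibre_sum (A C : orb) (q : quot_mor A C) (p : smash) (y : B) : mor B p.1 y :=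
  \sum_(d <- supp p.1 y) (val (q p (y, p.2 * d)%g) : mor B p.1 y).

Lemma quot_mor_shift (A C : orb) (q : quot_mor A C) (t : G) (x y : B) (c d c' d' : G) :
  c' = (t * c)%g -> d' = (t * d)%g -> val (q (x, c') (y, d')) = val (q (x, c) (y, d)).
Proof. by move=> -> ->; exact: (congr1 val (qfam_act q t (x, c) (y, d))). Qed.

Lemma fibre_sum_shift (A C : orb) (q : quot_mor A C) (p : smash) (y : B) g :
  fibre_sum q (p.1, g) y = fibre_sum q p y.
Proof.
case: p => x h; apply: eq_bigr => d _ /=.
by apply: (@quot_mor_shift _ _ _ (g * h^-1)%g); rewrite ?mulgA mulgVK.
Qed.

Lemma fibre_sum_linear (A C : orb) (p : smash) (y : B) :
  linear (fun q : quot_mor A C => fibre_sum q p y).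
Proof.
move=> c f g; rewrite /fibre_sum scaler_sumr -big_split /=.
by apply: eq_bigr.
Qed.

Lemma fibre_sum_id (A : orb) (p : smash) : orbit_of smash_action p = A ->
  fibre_sum (quot_id A) p p.1 = idm p.1.
Proof.
case: p => x c oA; rewrite /fibre_sum /=.
have E1 c' : c' = c -> val (quot_id A (x, c) (x, c')) = idm x.
  by move=> ->; rewrite quot_idE.
have E0 c' : c' <> c -> val (quot_id A (x, c) (x, c')) = 0.
  by move=> nc; rewrite quot_id0 // => -[/esym].
have [s1|s1] := boolP (1%g \in supp x x).
  rewrite (bigD1_seq 1%g s1 (supp_uniq x x)) (E1 _ (mulg1 c)) -[RHS]addr0; apply: congr1.
  apply: big1 => d nd; apply: E0 => /(congr1 (fun z => c^-1 * z)%g); rewrite mulKg mulVg => e.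
  by rewrite e eqxx in nd.
have -> : idm x = 0 by rewrite -(pr_id x) (pr_out _ s1).
rewrite big_seq; apply: big1 => d ds; apply: E0 => /(congr1 (fun z => c^-1 * z)%g);
  rewrite mulKg mulVg => e.
by rewrite e in ds; rewrite ds in s1.
Qed.

Lemma fibre_sum_comp (A C D : orb) (q' : quot_mor C D) (q : quot_mor A C) (p r : smash) (z : B) :
  orbit_of smash_action r = C ->
  fibre_sum (quot_comp q' q) p z = kcomp (fibre_sum q' r z) (fibre_sum q p r.1).
Proof.
move=> oC; rewrite [fibre_sum q p r.1]/fibre_sum comp_sumr.
under [RHS]eq_bigr => e _ do rewrite -(fibre_sum_shift q' r z (p.2 * e)%g) comp_suml.
pose w e : smash := (r.1, (p.2 * e)%g).
have LE d : val (quot_comp q' q p (z, (p.2 * d)%g)) =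
    \sum_(e <- supp p.1 r.1) kcomp (val (q' (w e) (z, (p.2 * d)%g))) (val (q p (w e))).
  rewrite -[quot_comp q' q p _]/(quot_comp_fam q' q p _) /quot_comp_fam (@fsum_seq _ _ (map w
    (supp p.1 r.1))).
  - by rewrite big_map fixsp_val_sum.
  - rewrite map_inj_uniq // => e e' /(congr1 snd) /=; exact: mulgI.
  move=> v nv; have nq : q p v <> 0 by move=> e; apply: nv; rewrite e comp0r.
  have v1 : v.1 = r.1 by apply/orbit_of_fst; rewrite oC; case: (qfam_supp nq).
  apply/mapP; exists (p.2^-1 * v.2)%g; first by rewrite -v1; exact: smash_supp nq.
  by rewrite /w mulVKg -v1; case: (v).
pose T e d : mor B p.1 z := kcomp (val (q' (w e) (z, (p.2 * d)%g))) (val (q p (w e))).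
transitivity (\sum_(d <- supp p.1 z) \sum_(e <- supp p.1 r.1) T e d).
  by apply: eq_bigr => d _; exact: LE.
rewrite exchange_big /=; apply: eq_bigr => e _.
transitivity (\sum_(d <- supp r.1 z) T e (e * d)%g); last first.
  apply: eq_bigr => d _; apply: (congr1 (fun u : mor B r.1 z => kcomp u (val (q p (w e))))).
  by apply: (@quot_mor_shift _ _ _ 1%g); rewrite ?mul1g ?mulgA.
(* The two sides run over different supports; summing over all of [G] allows the reindexing by
   [d |-> e * d]. *)
transitivity (\sum_(d \in setT) T e d).
  apply: esym; apply: fsum_seq => // d nT.
  have -> : d = (p.2^-1 * (z, p.2 * d).2)%g by rewrite /= mulKg.
  apply: (@smash_supp p (z, (p.2 * d)%g) (kcomp (q' (w e) (z, (p.2 * d)%g)) (q p (w e)))).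
  by move=> /(congr1 val).
rewrite (reindex_fsbigT (fun d : G => (e * d)%g)) /=; last first.
  by exists (fun d : G => (e^-1 * d)%g); [exact: mulKg | exact: mulVKg].
apply: fsum_seq => // d nT.
have -> : d = ((w e).2^-1 * (z, (p.2 * (e * d))%g).2)%g by rewrite /w /= (mulgA p.2) mulKg.
apply: (@smash_supp (w e) (z, (p.2 * (e * d))%g) (q' (w e) (z, (p.2 * (e * d))%g))).
by move=> q0; apply: nT; rewrite /T q0 comp0l.
Qed.

Definition quot_to_mor (A C : orb) : {linear quot_mor A C ->
  mor B (orbit_repr A).1 (orbit_repr C).1} :=
  mklin (@fibre_sum_linear A C (orbit_repr A) (orbit_repr C).1).

Fact quot_to_id A : quot_to_mor A A (quot_id A) = idm (orbit_repr A).1.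
Proof. by apply: fibre_sum_id; exact: orbit_reprK. Qed.

Fact quot_to_comp A C D (q' : quot_mor C D) (q : quot_mor A C) :
  quot_to_mor A D (quot_comp q' q) = kcomp (quot_to_mor C D q') (quot_to_mor A C q).
Proof. by apply: fibre_sum_comp; exact: orbit_reprK. Qed.

Definition quot_to : kfunctor (quot_cat smash_action) B :=
  @KFunctor k (quot_cat smash_action) B (fun A =>
    (orbit_repr A).1) quot_to_mor quot_to_id quot_to_comp.

(** The summands of [fibre_sum] have pairwise distinct degrees, so the projections recover each of
    them; equivariance determines the rest of the family. *)
Lemma fibre_sum_inj (A C : orb) (q : quot_mor A C) (p r : smash) :
  orbit_of smash_action p = A -> orbit_of smash_action r = C -> fibre_sum q p r.1 = 0 -> q = 0.
Proof.
move=> oA oC q0.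
have H g : q p (r.1, g) = 0.
  apply: contrapT => nq; have ds := smash_supp nq; apply: nq; apply: val_inj.
  have e := congr1 (pr (p.2^-1 * g)%g) q0; rewrite linear0 in e.
  apply: etrans e; apply: esym; rewrite linear_sum (bigD1_seq (p.2^-1 * g)%g ds) ?supp_uniq //=.
  apply: etrans (addr0 _); apply: (congr2 +%R); last first.
    by apply: big1 => d nd; apply: etrans (@pr_val p (r.1, (p.2 * d)%g) (q p (r.1,
      (p.2 * d)%g)) _ d (mulKg _ _)) _; rewrite eq_sym (negPf nd).
  apply: etrans (@pr_val p (r.1, _) (q p (r.1, _)) _ _ (mulKg _ _)) _; rewrite eqxx;
    case: (p) => x c /=.
  by apply: (@quot_mor_shift _ _ _ 1%g); rewrite mul1g; [|exact: mulVKg].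
apply: quot_mor_ext => u v; apply: contrapT => nq.
have [ou ov] := qfam_supp nq.
have /orbit_ofP[t tu] : orbit_of smash_action p = orbit_of smash_action u by rewrite oA ou.
have v1 : r.1 = v.1 by apply/orbit_of_fst; rewrite oC ov.
apply: nq; rewrite -tu (_ : v = smash_action t (r.1, (t^-1 * v.2)%g)).
  by rewrite qfam_act H linear0.
by case: (v) v1 => x h /= ->; rewrite /translate /= mulVKg.
Qed.

Lemma quot_to_inj A C : injective (quot_to_mor A C).
Proof.
move=> f g e; apply/eqP; rewrite -subr_eq0; apply/eqP.
apply: (@fibre_sum_inj A C (f - g) (orbit_repr A) (orbit_repr C)); rewrite ?orbit_reprK //.
by rewrite -[LHS]/(quot_to_mor A C (f - g)) linearB e subrr.
Qed.

Section LiftMorphism.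
Variables (A C : orb) (x y : B) (f : mor B x y).
Hypotheses (xA : orbit_of smash_action (x, 1%g) = A) (yC : orbit_of smash_action (y, 1%g) = C).

Fact lift_component_subproof (g h : G) : pr ((x, g).2^-1 * (y, h).2)%g (pr (g^-1 * h)%g f) =
  pr (g^-1 * h)%g f.
Proof. by rewrite pr_pr eqxx. Qed.
Definition lift_component (g h : G) : mor smash (x, g) (y, h) :=
  mk_fixsp (lift_component_subproof g h).

(** The preimage of [f] under the functor from the quotient category: its homogeneous components
    spread over all pairs of points above [x] and [y]. *)
Definition lift_family (u v : smash) : mor smash u v :=
  at_hom u v (to_arrow (lift_component u.2 v.2)).

Lemma lift_familyE g h : lift_family (x, g) (y, h) = lift_component g h.
Proof. exact: at_homE. Qed.

Lemma lift_family_neq0 u v : lift_family u v <> 0 -> (x, u.2) = u /\ (y, v.2) = v.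
Proof. by move=> nz; apply: contrapT => ne; apply: nz; apply: at_hom0 => -[eu ev]; apply: ne. Qed.

Fact lift_family_supp u v : lift_family u v <> 0 -> orbit_of smash_action u =
  A /\ orbit_of smash_action v = C.
Proof.
move=> /lift_family_neq0[eu ev]; rewrite -xA -yC; split; apply/orbit_of_fst.
  by rewrite -eu.
by rewrite -ev.
Qed.

Fact lift_family_act g u v :
  lift_family (smash_action g u) (smash_action g v) = fmor (smash_action g) (lift_family u v).
Proof.
have [[<- <-]|ne] := pselect ((x, u.2) = u /\ (y, v.2) = v).
  rewrite [LHS]lift_familyE lift_familyE; apply: val_inj => /=.
  by rewrite invgM -mulgA mulKg.
have -> : lift_family u v = 0 by apply: contrapT => /lift_family_neq0.
rewrite linear0; apply: contrapT => /lift_family_neq0[] /= [xu] [yv]; apply: ne.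
by rewrite xu yv; case: (u); case: (v).
Qed.

Fact lift_family_fin u : finite_set (fun v => lift_family u v <> 0).
Proof.
apply: (@sub_finite_set _ _ [set` [seq (y, (u.2 * d)%g) | d <- supp x y]]) => //.
move=> v nz; have [eu ev] := lift_family_neq0 nz.
have := smash_supp nz; have -> : u.1 = x by rewrite -eu.
have -> : v.1 = y by rewrite -ev.
by move=> ds; apply/mapP; exists (u.2^-1 * v.2)%g; rewrite // mulVKg.
Qed.

Definition lift_quot_mor : quot_mor A C :=
  QuotMor lift_family_supp lift_family_act lift_family_fin.
End LiftMorphism.

Lemma quot_to_surj A C (f : mor B (orbit_repr A).1 (orbit_repr C).1) : exists q,
  quot_to_mor A C q = f.
Proof.
have xA : orbit_of smash_action ((orbit_repr A).1, 1%g) = A.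
  by rewrite -[RHS]orbit_reprK; apply/orbit_of_fst.
have yC : orbit_of smash_action ((orbit_repr C).1, 1%g) = C.
  by rewrite -[RHS]orbit_reprK; apply/orbit_of_fst.
exists (lift_quot_mor f xA yC); rewrite /= /fibre_sum.
move: (orbit_repr A) (orbit_repr C).1 f xA yC => [x g] y f xA yC /=.
rewrite [RHS]pr_sum; apply: eq_bigr => d _.
by rewrite lift_familyE /= mulKg.
Qed.

Lemma quot_to_iso : kfunctor_iso quot_to.
Proof.
pose o (x : B) : quot_cat smash_action := orbit_of smash_action (x, 1%g).
apply: (@kfunctor_iso_bij k (quot_cat smash_action) B quot_to o) => [x|A||].
- by apply/(orbit_of_fst _ (x, 1%g)); rewrite orbit_reprK.
- by rewrite /= -[RHS]orbit_reprK; apply/orbit_of_fst.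
- exact: quot_to_inj.
- exact: quot_to_surj.
Qed.

Lemma smash_galois : galois_covering smash_proj smash_action.
Proof.
split; first by move=> g p q f.
exists smash_action_free, quot_to; split; first exact: quot_to_iso.
move=> u v f /=.
have /orbit_ofP[t tu] : orbit_of smash_action u =
  orbit_of smash_action (orbit_repr (orbit_of smash_action u)).
  by rewrite orbit_reprK.
have v1 : v.1 = (orbit_repr (orbit_of smash_action v)).1 by apply/orbit_of_fst;
  rewrite orbit_reprK.
move: (orbit_repr (orbit_of smash_action u)) tu (orbit_repr (orbit_of smash_action v)).1 v1 =>
  p tu y v1.
case: y / v1; case: p / tu.
apply: (congr1 (@to_arrow k B u.1 v.1)).
(* [d0] is the degree of [f]; only the term of the fibre sum with this index can be non-zero, and
   [f] is 0 if [d0] is not in the support. *)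
pose d0 := (u.2^-1 * v.2)%g.
have assoc d : ((t * u.2) * d = t * (u.2 * d))%g by rewrite mulgA.
have E1 c : c = (t * v.2)%g -> val (quot_proj_mor smash_action_free f (smash_action t u) (v.1,
  c)) = val f.
  by move=> ->; exact: (congr1 val (quot_proj_famEE smash_action_free f t)).
have E0 c : c <> (t * v.2)%g -> val (quot_proj_mor smash_action_free f (smash_action t u) (v.1,
  c)) = 0.
  move=> nc; apply: (congr1 val (_ : _ = 0));
    apply: etrans (quot_proj_famE smash_action_free f t (v.1, c)) _.
  by apply: at_hom0 => -[/esym].
have [ds|ds] := boolP (d0 \in supp u.1 v.1).
  rewrite /fibre_sum (bigD1_seq d0 ds) ?supp_uniq //=; apply: etrans (addr0 _);
    apply: (congr2 +%R).
    by apply: E1; apply: etrans (assoc _) _; rewrite mulVKg.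
  apply: big1 => d nd; apply: E0 => e; move: (etrans (esym (assoc d)) e) => /mulgI {}e.
  by move: nd; rewrite /d0 -e mulKg eqxx.
have f0 : f = 0 by apply: contrapT => /smash_supp; rewrite (negPf ds).
apply: etrans (_ : 0 = val f); last by rewrite f0.
rewrite /fibre_sum big_seq; apply: big1 => d dd; apply: E0 => e;
  move: (etrans (esym (assoc d)) e) => /mulgI {}e.
by move: ds; rewrite /d0 -e mulKg dd.
Qed.

Section LocallyBounded.
Hypotheses (B_fin : finite_set [set: B]) (B_hom : forall x y : B, fin_dim (mor B x y)).
Hypothesis B_skeletal : forall x y : B, x <> y -> ~ exists f : mor B x y, invertible f.
Hypothesis B_brick : forall (x : B) (f : mor B x x), exists c : k, f = c *: idm x.
Hypothesis B_nz : forall x : B, idm x <> 0 :> mor B x x.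

Lemma smash_mor_fin_dim (p q : smash) : fin_dim (mor smash p q).
Proof.
pose d := (p.2^-1 * q.2)%g.
have idem (f : mor B p.1 q.1) : pr d (pr d f) = pr d f by rewrite pr_pr eqxx.
have L : linear (fun f : mor B p.1 q.1 => mk_fixsp (idem f)).
  by move=> c f g; apply: val_inj; exact: linearP.
apply: (fin_dim_surj L) => // f; exists (val f).
by apply: val_inj; exact: fixspE.
Qed.

Lemma smash_nontrivial (p q : smash) : ~ trivial_module (mor smash p q) ->
  (p.2^-1 * q.2)%g \in supp p.1 q.1.
Proof.
by move=> nt; apply: contrapT => ns; apply: nt => f; apply: contrapT => /smash_supp.
Qed.

Lemma invertible_neq0 (C : kcat k) (x y : C) (f : mor C x y) :
  idm x <> 0 :> mor C x x -> invertible f -> f <> 0.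
Proof. by move=> nz [g [gf _]] f0; apply: nz; rewrite -gf f0 comp0r. Qed.

Lemma smash_locally_bounded : locally_bounded smash.
Proof.
split=> [p q npq [f inv_f]|p|p|p].
- have inv_vf : invertible (val f).
    by have [g [gf fg]] := inv_f; exists (val g); split;
      [exact: (congr1 val gf) | exact: (congr1 val fg)].
  case: p q npq f {inv_f} inv_vf => [x g] [y h] npq f inv_vf.
  have [exy|nxy] := pselect (x = y); last by case: (B_skeletal nxy); exists (val f).
  case: y / exy npq f inv_vf => npq f inv_vf.
  (* An isomorphism between two points above [x] is a non-zero multiple of the identity of [x],
     hence of degree 1. Its degree is also [g^-1 * h], so the points coincide. *)
  have [c fc] := B_brick (val f : mor B x x).
  have nf := invertible_neq0 (B_nz (x := x)) inv_vf.
  apply: nf; rewrite -[val f]fixspE /= fc linearZ /= -(pr_id x) pr_pr.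
  case: eqP => [e|_]; last by rewrite scaler0.
  by case: npq; congr pair; apply: (mulgI g^-1%g); rewrite e mulVg.
- split=> [|q]; last exact: smash_mor_fin_dim.
  apply: (@sub_finite_set _ _ (\bigcup_(y in setT) [set` [seq (y,
    (p.2 * d)%g) | d <- supp p.1 y]])%classic).
    move=> q /smash_nontrivial ds; exists q.1 => //=; apply/mapP; exists (p.2^-1 * q.2)%g => //.
    by rewrite mulVKg; case: (q).
  by apply: bigcup_finite => // y _.
- split=> [|q]; last exact: smash_mor_fin_dim.
  apply: (@sub_finite_set _ _ (\bigcup_(y in setT) [set` [seq (y,
    (p.2 * d^-1)%g) | d <- supp y p.1]])%classic).
    move=> q /smash_nontrivial ds; exists q.1 => //=; apply/mapP; exists (q.2^-1 * p.2)%g => //.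
    by rewrite invgM invgK mulgA mulgV mul1g; case: (q).
  by apply: bigcup_finite => // y _.
have endo (f : mor smash p p) : exists c : k, f = c *: idm p.
  by have [c fc] := B_brick (val f : mor B p.1 p.1); exists c; exact: val_inj.
have nz : (idm p : mor smash p p) <> 0 by move=> /(congr1 val); exact: B_nz.
have inv c : c != 0 -> invertible (c *: idm p : mor smash p p).
  move=> nc; exists (c^-1 *: idm p).
  have e (a b : k) : kcomp (a *: idm p : mor smash p p) (b *: idm p) = (a * b) *: idm p.
    apply: etrans (linearZ_LR (mklin (@comp_linearl k smash p p p (b *: idm p))) a (idm p)) _.
    exact: etrans (congr1 (fun z => a *: z) (Defs.comp_idl (b *: idm p :
      mor smash p p))) (scalerA a b _).
  by rewrite !e mulVf // mulfV // scale1r.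
have ninv (f : mor smash p p) : ~ invertible f -> f = 0.
  have [c ->] := endo f => ni; have [->|nc] := eqVneq c 0; first by rewrite scale0r.
  by case: ni; exact: inv.
have ninv0 : ~ invertible (0 : mor smash p p) by move=> /(invertible_neq0 nz); apply.
split=> // [f g /ninv -> /ninv ->|f g /ninv ->|f g /ninv ->].
- by rewrite addr0.
- by rewrite comp0r.
- by rewrite comp0l.
Qed.

End LocallyBounded.
End SmashProduct.

(** * Weights and gradings *)

Record add_subgroup (V : zmodType) := AddSubgroup {
  asg_pred : V -> Prop;
  asg_pred0 : asg_pred 0;
  asg_predB : forall u v, asg_pred u -> asg_pred v -> asg_pred (u - v)
}.

Section AddSubgroupGroup.
Variables (V : zmodType) (H : add_subgroup V).

Lemma asg_predN v : asg_pred H v -> asg_pred H (- v).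
Proof. by move=> Hv; rewrite -sub0r; apply: asg_predB => //; exact: asg_pred0. Qed.

Lemma asg_predD u v : asg_pred H u -> asg_pred H v -> asg_pred H (u + v).
Proof. by move=> Hu Hv; rewrite -[v]opprK; apply: asg_predB => //; exact: asg_predN. Qed.

(** The subgroup as a type, to be given multiplicative notation since Galois coverings take a
    [groupType]. *)
Definition asg : Type := {v : V | `[< asg_pred H v >]}.
HB.instance Definition _ := SubChoice.on asg.

Lemma asgP (v : asg) : asg_pred H (val v).
Proof. by case: v => v /= /asboolP. Qed.

Definition mk_asg v (Hv : asg_pred H v) : asg := exist _ v (introT (asboolP _) Hv).

Definition asg_one : asg := mk_asg (asg_pred0 H).
Definition asg_mul (u v : asg) : asg := mk_asg (asg_predD (asgP u) (asgP v)).
Definition asg_inv (v : asg) : asg := mk_asg (asg_predN (asgP v)).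

Fact asg_mulA : associative asg_mul.
Proof. by move=> u v w; apply: val_inj; rewrite /= addrA. Qed.
Fact asg_mul1 : left_id asg_one asg_mul.
Proof. by move=> u; apply: val_inj; rewrite /= add0r. Qed.
Fact asg_mulr1 : right_id asg_one asg_mul.
Proof. by move=> u; apply: val_inj; rewrite /= addr0. Qed.
Fact asg_mulV : left_inverse asg_one asg_inv asg_mul.
Proof. by move=> u; apply: val_inj; rewrite /= addNr. Qed.
Fact asg_mulrV : right_inverse asg_one asg_inv asg_mul.
Proof. by move=> u; apply: val_inj; rewrite /= subrr. Qed.
HB.instance Definition _ := isGroup.Build asg asg_mulA asg_mul1 asg_mulr1 asg_mulV asg_mulrV.

End AddSubgroupGroup.

Lemma fin_dim_modhom (k : fieldType) (A : algType k) (M N : lmodType A) :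
  fin_dim (restr_scalars M) -> fin_dim (restr_scalars N) -> fin_dim (modhom M N).
Proof.
move=> [n [b bP]] /fin_dim_coord[m [u [v [uK _]]]].
pose j (f : modhom M N) : 'rV[k]_(n * m) := mxvec (\matrix_(l < n) u (f (b l))).
have j_lin : linear j.
  move=> c f g; rewrite /j -linearP; congr mxvec; apply/matrixP => l l'.
  rewrite !mxE; have -> : (c *: f + g) (b l) = c *: (f (b l) : restr_scalars N) + g (b l) by [].
  by rewrite linearP !mxE.
apply: (@fin_dim_inj _ _ _ (mklin j_lin)) => f g /= /(can_inj mxvecK) e.
apply: hom_ext => x; have [c ->] := bP x.
rewrite -[LHS]/(kl f _) -[RHS]/(kl g _) !linear_sum; apply: eq_bigr => l _.
rewrite !linearZ; congr (_ *: _); apply: (can_inj uK).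
by have /rowP := congr1 (row l) e; rewrite !rowK => h; apply/rowP.
Qed.

Section AdjointDerivation.
Variables (k : closedFieldType) (Q : quiver) (A : algType k) (S : quiver_algebra Q A) (lam :
  arr Q -> k).

(* [phi] is the derivation [qe x |-> 0], [qa a |-> lam a *: qa a] of [A], lifted to [M]. *)
Definition lifts_weight (M : lmodType A) (phi : klin M M) : Prop :=
  (forall x (m : M), phi (qe S x *: m) = qe S x *: (phi m : M)) /\
  (forall a (m : M), phi (qa S a *: m) = qa S a *: (phi m :
    M) + (lam a)%:A *: (qa S a *: m) :> M).

Lemma lifts_weight_exists (M : lmodType A) : Ext1_zero S M M -> exists phi : klin M M,
  lifts_weight phi.
Proof.
move=> /(_ (fun a => lam a \*: act M (qa S a)))[phi [phie phia]].
exists phi; split=> // a m; move/eqP: (phia a m); rewrite subr_eq => /eqP ->.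
rewrite addrC; congr (_ + _); rewrite /= [LHS]scale_algC.
by rewrite qa_qe_act eqxx qe_qa_act eqxx.
Qed.

Lemma lifts_weight_shift (M : lmodType A) (phi : klin M M) c : lifts_weight phi ->
  lifts_weight (shift phi c).
Proof.
have comm (a : A) (m : M) : c *: (a *: m : restr_scalars M) = a *: (c *: (m :
  restr_scalars M) : restr_scalars M) :> M.
  by rewrite -[LHS]/(c%:A *: (a *: m)) -scale_algC.
move=> [phie phia]; split=> [x m|a m] /=.
  by rewrite phie scalerBr comm.
by rewrite phia scalerBr comm addrAC.
Qed.

Section Ad.
Variables (M N : lmodType A) (phi : klin M M) (psi : klin N N).
Hypotheses (Hphi : lifts_weight phi) (Hpsi : lifts_weight psi).

(** [phi] and [psi] lift the same derivation of [A], so the terms in [lam] cancel in the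
    commutator. *)
Fact ad_subproof (f : modhom M N) (a : A) (m : M) :
  ((psi \o kl f) \- (kl f \o phi)) (a *: m) = a *: (((psi \o kl f) \- (kl f \o phi)) m : N).
Proof.
apply: (@qgen _ _ _ S M N ((psi \o kl f) \- (kl f \o phi))) => [x {}m|b {}m] /=.
  by rewrite linearZ /= Hpsi.1 Hphi.1 linearZ scalerBr.
rewrite linearZ /= Hpsi.2 Hphi.2 linearD !linearZ /= scalerBr opprD addrACA.
by rewrite [X in _ + X](_ : _ = 0) ?addr0 //; apply/eqP; rewrite subr_eq0.
Qed.
Definition ad (f : modhom M N) : modhom M N := @klin_modhom _ _ M N _ (ad_subproof f).

Lemma adE f m : ad f m = psi (f m) - f (phi m). Proof. by []. Qed.

Fact ad_linear : linear ad.
Proof.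
move=> c f g; apply: hom_ext => m; rewrite adE.
rewrite -[(c *: f + g) m]/(c *: (f m : restr_scalars N) + g m) linearP.
rewrite -[(c *: f + g) (phi m)]/(c *: (f (phi m) : restr_scalars N) + g (phi m)).
rewrite -[RHS]/(c *: (ad f m : restr_scalars N) + ad g m) !adE.
by rewrite scalerBr opprD addrACA.
Qed.
Definition adl : {linear modhom M N -> modhom M N} := mklin ad_linear.

Lemma geig_apply c d (f : modhom M N) (m : M) :
  geig adl c f -> geig phi d m -> geig psi (c + d) (f m).
Proof.
apply: (@geig_bilinear k (modhom M N) (restr_scalars M) (restr_scalars N) (fun f m => f m)) =>
  [g|m'|g m'].
- exact: (kl_subproof g).
- by move=> a g h.
- by rewrite /= subrK.
Qed.
End Ad.

Lemma geig_comp (L M N : lmodType A) phi psi chi (Hphi : @lifts_weight L phi) (Hpsi :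
  @lifts_weight M psi)
    (Hchi : @lifts_weight N chi) c d (g : modhom M N) (f : modhom L M) :
  geig (adl Hpsi Hchi) c g -> geig (adl Hphi Hpsi) d f ->
    geig (adl Hphi Hchi) (c + d) (hom_comp g f).
Proof.
apply: (@geig_bilinear k (modhom M N) (modhom L M) (modhom L N) (fun g f => hom_comp g f)) =>
  [h|h|h h'].
- exact: hom_comp_linearr.
- exact: hom_comp_linearl.
apply: hom_ext => m; rewrite /= .
rewrite -[RHS]/(chi (h (h' m)) - h (psi (h' m)) + h (psi (h' m) - h' (phi m))).
by rewrite linearB /= addrA subrK.
Qed.

Lemma geig_hom_id (M : lmodType A) phi (Hphi : @lifts_weight M phi) :
  geig (adl Hphi Hphi) 0 (hom_id M).
Proof. by apply: geig_eigen; apply: hom_ext => m; rewrite scale0r /= subrr. Qed.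

Lemma geig_adl_shift (M N : lmodType A) phi psi (Hphi : @lifts_weight M phi) (Hpsi :
  @lifts_weight N psi)
    a b (Hphi' : lifts_weight (shift phi a)) (Hpsi' : lifts_weight (shift psi b)) c f :
  geig (adl Hphi' Hpsi') c f <-> geig (adl Hphi Hpsi) (c + b - a) f.
Proof.
have e g : shift (adl Hphi' Hpsi') c g = shift (adl Hphi Hpsi) (c + b - a) g.
  apply: hom_ext => m; pose u : restr_scalars N := g m.
  rewrite -[LHS]/(psi u - b *: u - g (phi m - a *: (m : restr_scalars M)) - c *: u).
  rewrite -[RHS]/(psi u - g (phi m) - (c + b - a) *: u).
  have -> : g (phi m - a *: (m : restr_scalars M)) = (g (phi m) : restr_scalars N) - a *: u.
    apply: etrans (linearB (kl g) (phi m) (a *: (m : restr_scalars M))) _.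
    by apply: (congr1 (fun z => _ - z)); exact: (linearZ_LR (kl g) a m).
  move: (psi u) (g (phi m) : restr_scalars N) => v w.
  rewrite scalerBl scalerDl !opprD !opprK !addrA.
  by rewrite -!addrA; congr (_ + _); rewrite addrCA; congr (_ + _); rewrite [RHS]addrC -addrA.
have it N' : iter N' (shift (adl Hphi' Hpsi') c) f =
  iter N' (shift (adl Hphi Hpsi) (c + b - a)) f.
  by elim: N' => //= N' ->; exact: e.
by split=> -[N' fN]; exists N'; rewrite -fN it.
Qed.

End AdjointDerivation.

Lemma connected_constant (Q : quiver) (I : Type) (m : vert Q -> I) : quiver_connected Q ->
  (forall a, m (src a) = m (tgt a)) -> forall x y, m x = m y.
Proof.
move=> Qc ma x y; have [s ws <-] := Qc x y.
elim: s (x : vert (double_quiver Q)) ws => [|[a b] s IH] z //= /andP[/eqP az ws].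
by rewrite /walk_end /= -[RHS](IH _ ws) -az; case: b {ws az IH} => /=.
Qed.

Section Linked.
Variables (V : zmodType) (I : Type) (R : I -> I -> V -> Prop).

(* Connectedness by zigzags in the covering with vertices [I * V] in which an element of degree
   [d] from [i] to [j] gives the edges [(i, c) -- (j, c + d)]. *)
Inductive linked (p : I * V) : I * V -> Prop :=
| linked_refl : linked p p
| linked_fwd i j c d : linked p (i, c) -> R i j d -> linked p (j, c + d)
| linked_bwd i j c d : linked p (j, c) -> R i j d -> linked p (i, c - d).

Lemma linked_trans p q r : linked p q -> linked q r -> linked p r.
Proof. by move=> pq; elim=> // [i j c d _ IH Rij|i j c d _ IH Rij];
  [exact: linked_fwd IH Rij | exact: linked_bwd IH Rij]. Qed.

Lemma linked_sym p q : linked p q -> linked q p.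
Proof.
elim=> [|i j c d _ IH Rij|i j c d _ IH Rij]; first exact: linked_refl.
  by apply: linked_trans IH; have := linked_bwd (linked_refl (j, c + d)) Rij; rewrite addrK.
by apply: linked_trans IH; have := linked_fwd (linked_refl (i, c - d)) Rij; rewrite subrK.
Qed.

Lemma linked_shift t p q : linked p q -> linked (p.1, p.2 + t) (q.1, q.2 + t).
Proof.
elim=> [|i j c d _ IH Rij|i j c d _ IH Rij]; first exact: linked_refl.
  by rewrite /= addrAC; exact: linked_fwd IH Rij.
by rewrite /= addrAC; exact: linked_bwd IH Rij.
Qed.

Variable i0 : I.
(** Translating by [u - v] a zigzag from 0 to [v] gives one from [u - v] to [u]; it is followed
    backwards after a zigzag from 0 to [u]. *)
Fact holonomyB u v : linked (i0, 0) (i0, u) -> linked (i0, 0) (i0, v) -> linked (i0, 0) (i0,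
  u - v).
Proof.
move=> lu /(linked_shift (u - v)) /=; rewrite add0r addrCA subrr addr0 => /linked_sym.
exact: linked_trans lu.
Qed.
Definition holonomy : add_subgroup V := @AddSubgroup V (fun h => linked (i0, 0) (i0,
  h)) (linked_refl _) holonomyB.
End Linked.

Section WeightPotential.
Variables (k : closedFieldType) (Q : quiver) (A : algType k) (S : quiver_algebra Q A).
Hypothesis Q_connected : quiver_connected Q.
Hypothesis S_center : forall al : A, (forall x, al * qe S x = qe S x * al) ->
  exists m : vert Q -> k, forall x, al * qe S x = m x *: qe S x.
Hypotheses (qe_neq0 : forall x, qe S x <> 0) (qa_neq0 : forall a, qa S a <> 0).

Lemma center_scalar (al : A) : (forall a : A, al * a = a * al) -> exists c : k, al = c%:A.
Proof.
move=> alC; have [m mE] := S_center (fun x => alC (qe S x)).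
have ma a : m (src a) = m (tgt a).
  have /eqP : (m (src a) - m (tgt a)) *: qa S a = 0.
    have es : qa S a * qe S (src a) = qa S a by rewrite qa_qe eqxx.
    have et : qe S (tgt a) * qa S a = qa S a by rewrite qe_qa eqxx.
    rewrite scalerBl -{1}es scalerAr -mE mulrA -alC -mulrA es.
    by rewrite -{2}et scalerAl -mE -mulrA et subrr.
  by rewrite scaler_eq0 subr_eq0 => /orP[/eqP //|/eqP /qa_neq0].
have /card_gt0P[x0 _] := vert_gt0 Q.
exists (m x0); rewrite -[al]mulr1 -(sum_qe S) mulr_sumr scaler_sumr.
by apply: eq_bigr => x _; rewrite mE (connected_constant Q_connected ma x x0).
Qed.

Variables (T : lmodType A) (n : nat) (X : 'I_n -> lmodType A).
Variables (inj : forall i, modhom (X i) T) (prj : forall i, modhom T (X i)).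
Hypotheses (inj_sum : forall m, \sum_i inj i (prj i m) = m) (prj_inj : forall i x,
  prj i (inj i x) = x)
  (prj_inj0 : forall i j x, i != j -> prj j (inj i x) = 0).
Hypothesis T_fin : fin_dim (restr_scalars T).
Hypothesis T_faithful : forall a : A, (forall t : T, a *: t = 0) -> a = 0.
Hypothesis T_centralizer : forall phi : klin T T, (forall (b : modhom T T) t, phi (b t) =
  b (phi t)) ->
  exists a : A, forall t : T, phi t = a *: t.
Hypotheses (X_indec : forall i, indecomposable (X i)) (X_rigid : forall i,
  Ext1_zero S (X i) (X i)).
Hypothesis X_noniso : forall i j, i != j -> ~ module_iso (X i) (X j).
Hypothesis X_sc : simply_connected (end_cat X).

Lemma X_neq0 i : exists x : X i, x <> 0.
Proof.
apply: contrapT => nx; apply: (X_indec i).1 => x.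
by apply: contrapT => x0; apply: nx; exists x.
Qed.

Lemma X_fin i : fin_dim (restr_scalars (X i)).
Proof.
apply: (fin_dim_surj (kl_subproof (prj i)) _ T_fin) => x.
by exists (inj i x); exact: prj_inj.
Qed.

Lemma X_hom_fin i j : fin_dim (modhom (X i) (X j)).
Proof. by apply: fin_dim_modhom; exact: X_fin. Qed.

Lemma inj_inj0 i x : inj i x = 0 -> x = 0.
Proof. by move=> e; rewrite -[x]prj_inj e linear0. Qed.

(** If the summands fell into two classes without non-zero maps between them, the projection of [T]
    onto one class would commute with all endomorphisms of [T]. It would then come from a central
    element of [A], that is from a scalar, and could not be 1 on one summand and 0 on another. *)
Lemma hom_connected (P : 'I_n -> Prop) :
  (forall i j, P i -> ~ P j -> (forall f : modhom (X i) (X j), f = 0) /\ (forall f :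
    modhom (X j) (X i), f = 0)) ->
  (exists i, P i) -> forall j, P j.
Proof.
move=> Psep [i Pi] j; apply: contrapT => nPj.
pose p (t : T) := \sum_(l | `[< P l >]) inj l (prj l t).
have p_lin : linear p.
  move=> c u v; rewrite /p scaler_sumr -big_split; apply: eq_bigr => l _ /=.
  by rewrite !linearP.
pose pm : modhom T T := mk_hom p_lin.
have pb (b : modhom T T) t : pm (b t) = b (pm t).
  pose t_ l l' := inj l' (prj l' (b (inj l (prj l t)))).
  have t0 l l' : `[< P l >] != `[< P l' >] -> t_ l l' = 0.
    pose f : modhom (X l) (X l') := hom_comp (prj l') (hom_comp b (inj l)).
    have E : f = 0 -> t_ l l' = 0 by move=> f0; rewrite /t_ -[prj l' _]/(f (prj l t)) f0 linear0.
    move=> ne; apply: E.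
    have [Pl|nPl] := pselect (P l); have [Pl'|nPl'] := pselect (P l').
    - by move: ne; rewrite !asboolT.
    - by have [H _] := Psep _ _ Pl nPl'; exact: H.
    - by have [_ H] := Psep _ _ Pl' nPl; exact: H.
    - by move: ne; rewrite !asboolF.
  transitivity (\sum_l \sum_(l' | `[< P l' >]) t_ l l').
    rewrite exchange_big /=; apply: eq_bigr => l' _.
    by rewrite -{1}[t]inj_sum !linear_sum.
  transitivity (\sum_(l | `[< P l >]) \sum_l' t_ l l'); last first.
    rewrite /= /p linear_sum; apply: eq_bigr => l _; exact: inj_sum.
  rewrite big_mkcond [RHS]big_mkcond; apply: eq_bigr => l _ /=.
  rewrite big_mkcond /=; case: ifP => Pl; last first.
    by apply: big1 => l' _; case: ifP => // Pl'; rewrite t0 // Pl Pl'.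
  by apply: eq_bigr => l' _; case: ifP => // Pl'; rewrite t0 // Pl Pl'.
have [al alE] := T_centralizer (phi := kl pm) pb.
have [a|c cE] := @center_scalar al.
  apply/eqP; rewrite -subr_eq0; apply/eqP/T_faithful => t.
  rewrite scalerBl -!scalerA -!alE; apply/eqP; rewrite subr_eq0; apply/eqP.
  exact: (linearZ_LR pm a t).
have pE t : pm t = c%:A *: t by rewrite -cE -alE.
have pinj l (x : X l) : pm (inj l x) = if `[< P l >] then inj l x else 0.
  have h l' : l' != l -> inj l' (prj l' (inj l x)) = 0.
    by move=> nl; rewrite prj_inj0 ?linear0 // eq_sym.
  rewrite /= /p; case: ifP => Pl; last first.
    by apply: big1 => l' Pl'; apply: h; apply: contraTneq Pl' => ->; rewrite Pl.
  by rewrite (bigD1 l) //= prj_inj big1 ?addr0 // => l' /andP[_ /h].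
have [x nx] := X_neq0 i; have [y ny] := X_neq0 j.
have nix : inj i x <> 0 by move=> /inj_inj0.
have njy : inj j y <> 0 by move=> /inj_inj0.
have c1 : c = 1.
  apply: (klin_scale_inj nix); rewrite -pE pinj asboolT //.
  by rewrite [1%:A]scale1r scale1r.
have c0 : c = 0.
  apply: (klin_scale_inj njy); rewrite -pE pinj asboolF //.
  by rewrite [0%:A]scale0r scale0r.
by have := oner_neq0 k; rewrite -c1 c0 eqxx.
Qed.

Lemma X_hom_scalar i (f : modhom (X i) (X i)) : exists c : k, f = c *: hom_id (X i).
Proof.
have [c cE] := rigid_indecomposable_endo_scalar (X_fin i) (X_indec i) (@X_rigid i) f.
by exists c; apply: hom_ext => x; rewrite cE.
Qed.

Variable lam : arr Q -> k.

Section Grading.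
Variable phi : forall i, klin (X i) (X i).
Hypothesis Hphi : forall i, lifts_weight S lam (phi i).
Variable H : add_subgroup k.

Let D i j : {linear modhom (X i) (X j) -> modhom (X i) (X j)} := adl (Hphi i) (Hphi j).
Let spec i j := spectral_exists (D i j) (X_hom_fin i j).
Let s i j : seq k := sval (cid (spec i j)).
Let pr i j : k -> {linear modhom (X i) (X j) -> modhom (X i) (X j)} :=
  sval (cid (svalP (cid (spec i j)))).
Let sp i j : spectral (D i j) (s i j) (pr i j) := svalP (cid (svalP (cid (spec i j)))).

Hypothesis degH : forall i j c (f : modhom (X i) (X j)), f <> 0 -> geig (D i j) c f ->
  asg_pred H c.
(** Connectedness of the smash product, tested on non-zero homogeneous morphisms. *)
Hypothesis connH : forall P : 'I_n -> asg H -> Prop,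
  (forall i j (g h : asg H) (f : modhom (X i) (X j)), f <> 0 ->
    geig (D i j) (val h - val g) f -> (P i g <-> P j h)) ->
  (exists i g, P i g) -> forall j h, P j h.

Let gpr (i j : end_cat X) (h : asg H) : {linear mor (end_cat X) i j -> mor (end_cat X) i j} :=
  pr i j (val h).
Let gsupp (i j : end_cat X) : seq (asg H) := pmap insub (s i j).

Let gsupp_uniq i j : uniq (gsupp i j).
Proof. by apply: pmap_sub_uniq; exact: spectral_uniq (sp i j). Qed.

Let gpr_sum i j (f : mor (end_cat X) i j) : f = \sum_(h <- gsupp i j) gpr i j h f.
Proof.
rewrite /gsupp big_pmap [LHS](spectral_sum (sp i j)); apply: eq_bigr => c _.
(* A scalar of the list [s i j] outside [H] is not the degree of a non-zero morphism, so the
   component dropped by [pmap] is 0. *)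
case: insubP => [h _ <-|] //= /asboolP nc; apply: contrapT => nz; apply: nc.
by apply: (degH nz); exact: spectral_geig (sp i j) c f.
Qed.

Let gpr_pr i j (f : mor (end_cat X) i j) g h : gpr i j g (gpr i j h f) =
  if g == h then gpr i j h f else 0.
Proof. exact: spectral_pr (sp i j) _ _ _. Qed.

Let gpr_id (i : end_cat X) : gpr i i 1%g (idm i) = idm i.
Proof.
apply: etrans (spectralE (sp i i) _ (geig_hom_id (Hphi i))) _.
by rewrite eqxx.
Qed.

Let gpr_geig i j (f : mor (end_cat X) i j) h : gpr i j h f = f <-> geig (D i j) (val h) f.
Proof.
split=> [<-|fh]; first exact: spectral_geig (sp i j) _ _.
by apply: etrans (spectralE (sp i j) _ fh) _; rewrite eqxx.
Qed.

Let gpr_comp (i j l : end_cat X) (u : mor (end_cat X) j l) (f : mor (end_cat X) i j) g h :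
  gpr i j g f = f -> gpr j l h u = u -> gpr i l (g * h)%g (kcomp u f) = kcomp u f.
Proof.
move=> /gpr_geig fg /gpr_geig uh; apply/gpr_geig.
by rewrite /= addrC; exact: geig_comp uh fg.
Qed.

Let E := smash gpr_id gpr_comp.

Let E_connected : cat_connected E.
Proof.
move=> [P [[[i g] Pig] [[j h] nPjh] Psep]].
apply: nPjh; pose P' l (t : asg H) := P (l, t).
apply: (connH (P := P')) => [i' j' g' h' f nf fgh|]; last by exists i, g.
pose f' : mor E (i', g') (j', h') := mk_fixsp ((gpr_geig f (g'^-1 * h')%g).2 (eq_rect _ (fun c =>
  geig _ c f) fgh _ (addrC _ _))).
have nf' : f' <> 0 by move=> /(congr1 val).
split=> [Pi|Pj]; apply: contrapT => nP.
  by case: (Psep _ _ Pi nP) => /(_ f').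
by case: (Psep _ _ Pj nP) => _ /(_ f').
Qed.

Lemma grading_trivial (h : asg H) : h = 1%g.
Proof.
apply: contrapT => nh; apply: X_sc.
exists (asg H), E, (smash_proj gpr_id gpr_comp), (smash_action gpr_id gpr_comp); split.
- exact: (smash_galois gsupp_uniq gpr_sum gpr_pr gpr_id gpr_comp).
- exact: E_connected.
- apply: (smash_locally_bounded gpr_sum gpr_pr gpr_id gpr_comp) =>
  [|i j|i j nij [f [g [gf fg]]]|i f|i].
  + exact: finite_finset.
  + exact: X_hom_fin.
  + apply: (@X_noniso i j); first exact/eqP.
    exists f; exists g => x; first by rewrite -[LHS]/(hom_comp g f x) [hom_comp g f]gf.
    by rewrite -[LHS]/(hom_comp f g x) [hom_comp f g]fg.
  + exact: X_hom_scalar.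
  + have [x nx] := X_neq0 i; move=> e; apply: nx.
    by rewrite -[x]/(hom_id (X i) x) [hom_id _]e.
- by exists h.
Qed.

End Grading.

(** The spectral projections of the sum [Phi] of the [phi i] commute with all endomorphisms of [T],
    so each is multiplication by an element of [A]. It commutes with the [qe x], hence acts on
    [qe x T] by a scalar. A projection that is non-zero there thus has all of [qe x T] in its image;
    its eigenvalue is [mu x]. *)
Lemma degree0_potential (phi : forall i, klin (X i) (X i)) (Hphi : forall i,
  lifts_weight S lam (phi i)) :
  (forall i j (f : modhom (X i) (X j)), geig (adl (Hphi i) (Hphi j)) 0 f) ->
  exists mu : vert Q -> k, forall a, lam a = mu (tgt a) - mu (src a).
Proof.
move=> deg0.
pose Phi : klin T T := mklin (klin_sum_linear (index_enum 'I_n) (fun i =>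
  kl (inj i) \o phi i \o kl (prj i))).
have PhiE t : Phi t = \sum_i inj i (phi i (prj i t)) by [].
have prjPhi i t : prj i (Phi t) = phi i (prj i t).
  rewrite PhiE linear_sum (bigD1 i) //= prj_inj big1 ?addr0 // => j nj.
  exact: prj_inj0.
have injPhi i x : Phi (inj i x) = inj i (phi i x).
  rewrite PhiE (bigD1 i) //= prj_inj big1 ?addr0 // => j nj.
  by rewrite prj_inj0 1?eq_sym // !linear0.
have Phi_lift : lifts_weight S lam Phi.
  split=> [x t|a t]; rewrite !PhiE.
    by rewrite scaler_sumr; apply: eq_bigr => i _; rewrite linearZ /= (Hphi i).1 linearZ.
  rewrite -[in X in _ = _ + X](inj_sum (qa S a *: t)) !scaler_sumr -big_split /=.
  by apply: eq_bigr => i _; rewrite linearZ /= (Hphi i).2 linearD !linearZ.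
clearbody Phi.
have [s [pr sp]] := spectral_exists Phi T_fin.
have geig_b (b : modhom T T) c t : geig Phi c t -> geig Phi c (b t).
  move=> tc; rewrite -[b t]inj_sum; apply: geig_sum => j _.
  rewrite -[t]inj_sum !linear_sum; apply: geig_sum => i _.
  rewrite -[c]addr0; apply: (@geig_map _ _ _ (phi j) _ (kl (inj j))) => [x|].
    by rewrite /= injPhi scale0r addr0.
  rewrite -[c]add0r -[prj j _]/(hom_comp (prj j) (hom_comp b (inj i)) (prj i t)).
  apply: (geig_apply (deg0 i j _)).
  rewrite -[c]addr0; apply: (@geig_map _ _ _ Phi _ (kl (prj i))) => // t'.
  by rewrite /= prjPhi scale0r addr0.
have pr_b c (b : modhom T T) t : pr c (b t) = b (pr c t).
  rewrite -{1}[c]addr0; apply: (@spectral_intertwine k _ _ _ _ _ _ _ _ (kl b) 0 sp sp) => d u ud.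
  by rewrite addr0; exact: geig_b.
have pr_e c x (t : T) : pr c (qe S x *: t) = qe S x *: (pr c t : T).
  rewrite -{1}[c]addr0; apply: (@spectral_intertwine k _ _ _ _ _ _ _ _ (act T (qe S x)) 0 sp sp)
    => d u ud.
  apply: (@geig_map _ _ _ Phi _ (act T (qe S x))) ud => v.
  by rewrite scale0r addr0; exact: Phi_lift.1.
have mu_ex x : exists mu, forall t : T, geig Phi mu (qe S x *: t).
  have [t nt] : exists t : T, qe S x *: t <> 0.
    apply: contrapT => nt; apply: (qe_neq0 (x := x)); apply: T_faithful => t.
    by apply: contrapT => xt; apply: nt; exists t.
  have [c nc] : exists c, pr c (qe S x *: t) <> 0.
    apply: contrapT => nc; apply: nt; rewrite [LHS](spectral_sum sp) big1 // => c _.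
    by apply: contrapT => pc; apply: nc; exists c.
  have [al alE] := T_centralizer (phi := pr c) (pr_b c).
  have [m mE] : exists m : vert Q -> k, forall y, al * qe S y = m y *: qe S y.
    apply: S_center => y; apply/eqP; rewrite -subr_eq0; apply/eqP/T_faithful => u.
    by rewrite scalerBl -!scalerA -!alE pr_e subrr.
  have prm (u : T) : pr c (qe S x *: u) = (m x)%:A *: (qe S x *: u).
    by rewrite alE scalerA mE scalerZ.
  have nm : m x != 0.
    by apply: contra_notN nc => /eqP m0; rewrite prm m0 [0%:A]scale0r scale0r.
  exists c => u; have -> : qe S x *: u = pr c ((m x)^-1%:A *: (qe S x *: u)).
    rewrite klZ prm -[RHS]/((m x)^-1 *: (m x *: (qe S x *: u : restr_scalars T))).
    by rewrite scalerA mulVf // scale1r.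
  exact: spectral_geig sp _ _.
have [mu muE] : exists mu : vert Q -> k, forall x (t : T), geig Phi (mu x) (qe S x *: t).
  by exists (fun x => sval (cid (mu_ex x))) => x; exact: svalP (cid (mu_ex x)).
exists mu => a; apply/eqP; rewrite eq_sym subr_eq addrC; apply: contrapT => /negP ne.
apply: (qa_neq0 (a := a)); apply: T_faithful => t.
apply: (@geig_disjoint k (restr_scalars T) Phi _ _ _ ne).
  by have := muE (tgt a) (qa S a *: t); rewrite qe_qa_act eqxx.
have <- : qa S a *: (qe S (src a) *: t) = qa S a *: t by rewrite qa_qe_act eqxx.
apply: (@geig_map _ _ _ Phi _ (act T (qa S a))) (muE (src a) t) => v.
exact: Phi_lift.2.
Qed.

Lemma weight_potential : exists mu : vert Q -> k, forall a, lam a = mu (tgt a) - mu (src a).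
Proof.
pose phi i : klin (X i) (X i) := sval (cid (lifts_weight_exists lam (@X_rigid i))).
have Hphi i : lifts_weight S lam (phi i) := svalP (cid (lifts_weight_exists lam (@X_rigid i))).
have [i0 _] : exists i0 : 'I_n, True.
  have /card_gt0P[x0 _] := vert_gt0 Q.
  apply: contrapT => n0; apply: (qe_neq0 (x := x0)); apply: T_faithful => t.
  rewrite -[t]inj_sum big1 ?scaler0 // => i; by case: n0; exists i.
pose R i j d := exists2 f : modhom (X i) (X j), f <> 0 & geig (adl (Hphi i) (Hphi j)) d f.
have linked_all j : exists c, linked R (i0, 0) (j, c).
  apply: (hom_connected (P := fun j => exists c, linked R (i0, 0) (j, c))); last by exists i0,
    0; exact: linked_refl.
  move=> i {}j [c ic] nj.
  have comp i' j' (f : modhom (X i') (X j')) : f <> 0 -> exists d, R i' j' d.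
    have [s [pr sp]] := spectral_exists (adl (Hphi i') (Hphi j')) (X_hom_fin i' j').
    move=> nf; apply: contrapT => nd; apply: nf; rewrite (spectral_sum sp f) big1 // => d _.
    by apply: contrapT => nz; apply: nd; exists d, (pr d f) => //; exact: spectral_geig sp _ _.
  split=> f; apply: contrapT => /comp[d Rd]; apply: nj.
    by exists (c + d); exact: linked_fwd ic Rd.
  by exists (c - d); exact: linked_bwd ic Rd.
(* [c j] is the degree of a chosen zigzag from [i0] to [j]; shifting [phi j] by it subtracts [c j]
   from the second coordinate in the fibre over [j]. *)
pose c j := sval (cid (linked_all j)).
have cP j : linked R (i0, 0) (j, c j) := svalP (cid (linked_all j)).
pose H := holonomy R i0.
have HP d j : linked R (i0, 0) (j, d + c j) <-> asg_pred H d.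
  have := linked_shift d (cP j); rewrite /= add0r [c j + d]addrC => l.
  by split=> l'; [exact: linked_trans l' (linked_sym l) | exact: linked_trans l' l].
have Hphi' i := lifts_weight_shift (c i) (Hphi i).
have degH i j d (f : modhom (X i) (X j)) : f <> 0 -> geig (adl (Hphi' i) (Hphi' j)) d f ->
  asg_pred H d.
  move=> nf /geig_adl_shift fd; apply/(HP d j).
  have := linked_fwd (cP i) (ex_intro2 _ _ f nf (fd (Hphi i) (Hphi j))).
  by rewrite addrCA subrr addr0.
have connH (P : 'I_n -> asg H -> Prop) :
    (forall i j (g h : asg H) (f : modhom (X i) (X j)), f <> 0 ->
       geig (adl (Hphi' i) (Hphi' j)) (val h - val g) f -> (P i g <-> P j h)) ->
    (exists i g, P i g) -> forall j h, P j h.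
  move=> Pstep [i1 [g1 Pig1]].
  (* The zigzag chosen for [i0] may have a non-zero degree, so in the new coordinates the base point
     is [- c i0], not 0. *)
  have H0 : asg_pred H (- c i0) by apply/(HP _ i0); rewrite addNr; exact: linked_refl.
  pose h0 : asg H := mk_asg H0.
  have key q : linked R (i0, 0) q -> forall h : asg H, val h = q.2 - c q.1 ->
    (P i0 h0 <-> P q.1 h).
    have step i j d e : linked R (i0, 0) (i, d) -> R i j e ->
        forall g h : asg H, val g = d - c i -> val h = d + e - c j -> (P i g <-> P j h).
      move=> _ [f nf fe] g h eg eh; apply: (Pstep _ _ _ _ _ nf); apply/geig_adl_shift.
      by rewrite eg eh (_ : d + e - c j - (d - c i) + c j - c i = e) //; ring.
    have mem q' : linked R (i0, 0) q' -> asg_pred H (q'.2 - c q'.1).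
      by case: q' => i d l; apply/(HP _ i); rewrite subrK.
    elim=> [h /= eh|i j d e l IH Rij h /= eh|i j d e l IH Rij h /= eh].
    - by rewrite (_ : h = h0) //; apply: val_inj; apply: etrans eh _; rewrite sub0r.
    - apply: (iff_trans (IH (mk_asg (mem _ l)) (erefl _))).
      exact: (step i j d e l Rij (mk_asg (mem _ l)) h (erefl _) eh).
    have l' := linked_bwd l Rij.
    apply: (iff_trans (IH (mk_asg (mem _ l)) (erefl _))).
    apply: iff_sym; apply: (step i j (d - e) e l' Rij h (mk_asg (mem _ l)) eh).
    by rewrite /= subrK.
  have all_iff j h : P i0 h0 <-> P j h.
    apply: (key (j, val h + c j)); first by apply/(HP _ j); exact: asgP.
    by rewrite /= addrK.
  by move=> j h; apply/(all_iff j h)/(all_iff i1 g1).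
have H1 := grading_trivial degH connH.
apply: (@degree0_potential (fun i => shift (phi i) (c i)) Hphi') => i j f.
have [s [pr sp]] := spectral_exists (adl (Hphi' i) (Hphi' j)) (X_hom_fin i j).
rewrite (spectral_sum sp f); apply: geig_sum => d _.
have [->|nz] := pselect (pr d f = 0); first exact: geig0.
have fd := spectral_geig sp d f.
by have /(congr1 val) /= <- := H1 (mk_asg (degH _ _ _ _ nz fd)).
Qed.

End WeightPotential.

(** * Derivations *)

Section InnerDerivations.
Variables (k : fieldType) (Q : quiver) (A : algType k) (S : quiver_algebra Q A).
Hypothesis potential : forall lam : arr Q -> k, exists mu : vert Q -> k, forall a, lam a =
  mu (tgt a) - mu (src a).
Hypothesis arrow_corner : forall a (be : A), qe S (tgt a) * be = be -> be * qe S (src a) = be ->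
  exists c : k, be = c *: qa S a.
Variable T : lmodType A.
Hypothesis T_faithful : forall a : A, (forall t : T, a *: t = 0) -> a = 0.
Hypothesis T_centralizer : forall phi : klin T T, (forall (b : modhom T T) t, phi (b t) =
  b (phi t)) ->
  exists a : A, forall t : T, phi t = a *: t.
Variable D : modhom T T -> modhom T T.

(** Endomorphisms of [T] commute with [A], so subtracting from [nabla] the action of an element of
    [A] preserves its relation to [D]. Two such corrections make [nabla] linear over [A]: the first
    achieves commutation with the vertices, the second with the arrows. *)
Lemma inner_of_lift (nabla : klin T T) : (forall (b : modhom T T) t, nabla (b t) =
  D b t + b (nabla t)) ->
  exists be : modhom T T, forall b, D b = hom_comp be b - hom_comp b be.
Proof.
have commA (nab : klin T T) : (forall (b : modhom T T) t, nab (b t) = D b t + b (nab t)) ->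
    forall a : A, exists be : A, forall t : T, nab (a *: t) - a *: (nab t : T) = be *: t.
  move=> nabb a; apply: (T_centralizer (phi := (nab \o act T a) \- (act T a \o nab))) => b t /=.
  have -> : a *: b t = b (a *: t) by rewrite linearZ.
  have -> : b (nab (a *: t) - a *: (nab t : T)) = b (nab (a *: t)) - a *: b (nab t).
    by rewrite linearB linearZ.
  by rewrite !nabb scalerDr [D b (_ *: _)]linearZ opprD addrACA subrr add0r.
move=> nabb.
pose ep x := sval (cid (commA nabla nabb (qe S x))).
have epE x (t : T) : nabla (qe S x *: t) - qe S x *: (nabla t : T) = ep x *: t :=
  svalP (cid (commA nabla nabb (qe S x))) t.
(* As [ep x] is the commutator of [nabla] with [qe x], subtracting [ga] leaves the block-diagonal
   part of [nabla], the sum of the [qe x nabla qe x]. *)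
pose ga := \sum_x ep x * qe S x.
pose nab1 : klin T T := nabla \- act T ga.
have nab1b (b : modhom T T) t : nab1 (b t) = D b t + b (nab1 t).
  by rewrite /= nabb [b (_ - _)]linearB linearZ addrA.
have nab1E t : nab1 t = \sum_x qe S x *: (nabla (qe S x *: t) : T).
  have nabla_sum : nabla t = \sum_x nabla (qe S x *: t)
    by rewrite -[in LHS](sum_qe_act S t) linear_sum.
  rewrite -[LHS]/(nabla t - ga *: t) nabla_sum /ga scaler_suml -sumrB; apply: eq_bigr => x _.
  have := epE x (qe S x *: t); rewrite qe_qe_act eqxx scalerA => <-.
  by rewrite opprB addrC subrK.
have nab1e x (t : T) : nab1 (qe S x *: t) = qe S x *: (nab1 t : T).
  rewrite !nab1E scaler_sumr; apply: eq_bigr => y _.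
  by rewrite !qe_qe_act eq_sym; case: eqP => [->|_] //; rewrite linear0 scaler0.
clearbody nab1.
(* The commutator of [nab1] with [a] is multiplication by an element of [A] that runs from [src a]
   to [tgt a], hence by a multiple of [a]: [nab1] lifts a weight. *)
have nab1a a : exists c : k, forall t : T, nab1 (qa S a *: t) - qa S a *: (nab1 t : T) =
  (c *: qa S a) *: t.
  have [be beE] := commA nab1 nab1b (qa S a).
  have [||c cE] := @arrow_corner a be; last by exists c => t; rewrite -cE.
  - apply/eqP; rewrite -subr_eq0; apply/eqP/T_faithful => t.
    rewrite scalerBl -scalerA -!beE scalerBr qe_qa_act eqxx -nab1e qe_qa_act eqxx.
    by rewrite subrr.
  - apply/eqP; rewrite -subr_eq0; apply/eqP/T_faithful => t.
    by rewrite scalerBl -scalerA -!beE nab1e !qa_qe_act !eqxx subrr.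
pose lam a := sval (cid (nab1a a)).
have lamE a (t : T) : nab1 (qa S a *: t) - qa S a *: (nab1 t : T) = (lam a *: qa S a) *: t :=
  svalP (cid (nab1a a)) t.
have [mu muE] := potential lam.
(* The commutator of [m] with an arrow [a] is [mu (tgt a) - mu (src a)] times [a], the same as that
   of [nab1]. *)
pose m := \sum_x mu x *: qe S x.
have me x : m * qe S x = mu x *: qe S x.
  rewrite mulr_suml (bigD1 x) //= -scalerAl qe_qe eqxx big1 ?addr0 // => y /negPf ny.
  by rewrite -scalerAl qe_qe ny scaler0.
have em x : qe S x * m = mu x *: qe S x.
  rewrite mulr_sumr (bigD1 x) //= -scalerAr qe_qe eqxx big1 ?addr0 // => y /negPf ny.
  by rewrite -scalerAr qe_qe eq_sym ny scaler0.
pose be0 : klin T T := nab1 \- act T m.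
have be0A (a : A) (t : T) : be0 (a *: t) = a *: (be0 t : T).
  apply: (@qgen _ _ _ S T T be0) => [x {}t|{}a {}t] /=.
    by rewrite nab1e scalerBr !scalerA me em.
  have eT : qe S (tgt a) * qa S a = qa S a by rewrite qe_qa eqxx.
  have eS : qa S a * qe S (src a) = qa S a by rewrite qa_qe eqxx.
  have ma : m * qa S a = mu (tgt a) *: qa S a by rewrite -eT mulrA me -scalerAl.
  have am : qa S a * m = mu (src a) *: qa S a by rewrite -eS -mulrA em -scalerAr.
  rewrite scalerBr !scalerA ma am; have := lamE a t; rewrite muE scalerBl scalerBl.
  by move/eqP; rewrite subr_eq => /eqP ->; rewrite addrAC (addrAC (_ *: t)) subrr add0r addrC.
exists (klin_modhom be0A) => b; apply: hom_ext => t.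
rewrite -[RHS]/(be0 (b t) - b (be0 t)) /= nab1b [b (_ - _)]linearB linearZ /=.
by rewrite opprB addrA subrK addrK.
Qed.

End InnerDerivations.

Section AcyclicPathAlgebra.
Variables (k : fieldType) (Q : quiver).
Local Notation A := (path_algebra k Q).
Local Notation S := (path_quiver_algebra k Q).
Implicit Types (x y : vert Q) (a : arr Q) (p : qpath Q).

Lemma path_elt_neq0 p : path_elt k p <> 0.
Proof.
move=> /malgP/(_ p); rewrite mcoeff0 (mcoeffUU p 1) => /eqP.
by rewrite oner_eq0.
Qed.

Lemma path_algebra_line (V : lmodType k) (F : A -> V) (v : V) :
  {morph F : f g / f + g} -> (forall c f, F (c *: f) = c *: F f) ->
  (forall p, exists c : k, F (path_elt k p) = c *: v) -> forall f, exists c : k, F f = c *: v.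
Proof.
move=> FD FZ Fp; elim/pa_ind => [|f g [c Ef] [d Eg]|c p].
- by exists 0; rewrite -(scale0r 0) FZ !scale0r.
- by exists (c + d); rewrite FD Ef Eg scalerDl.
- by have [d Ed] := Fp p; exists (c * d); rewrite FZ Ed scalerA.
Qed.

Lemma path_elt_corner x y p0 (be : A) : (forall p, psrc p = x -> ptgt p = y -> p = p0) ->
  exists c : k, pamul (pe k y) (pamul be (pe k x)) = c *: path_elt k p0.
Proof.
move=> puniq; move: be; apply: path_algebra_line => [f g|c f|p].
- exact: etrans (congr1 _ (pamulDl f g (pe k x))) (pamulDr _ _ _).
- exact: etrans (congr1 _ (esym (pamulZl c f (pe k x)))) (esym (pamulZr c _ _)).
have E0 : pamul (pe k y) 0 = 0 :> A := pamul0r _.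
have E : pamul (path_elt k p) (pe k x) = if x == psrc p then path_elt k p else 0 := path_pe k x p.
have E' : pamul (pe k y) (path_elt k p) = if y == ptgt p then path_elt k p else 0 :=
  pe_path k y p.
have [ex|/negPf nx] := eqVneq x (psrc p); last first.
  by exists 0; rewrite nx in E; exact: etrans (etrans (congr1 _ E) E0) (esym (scale0r _)).
rewrite ex eqxx -ex in E; have [ey|/negPf ny] := eqVneq y (ptgt p); last first.
  by exists 0; rewrite ny in E'; exact: etrans (etrans (congr1 _ E) E') (esym (scale0r _)).
rewrite ey eqxx -ey in E'; exists 1; rewrite -(puniq p) //.
exact: etrans (etrans (congr1 _ E) E') (esym (scale1r _)).
Qed.

Lemma path_algebra_corner x y p0 (be : A) : (forall p, psrc p = x -> ptgt p = y -> p = p0) ->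
  qe S y * be = be -> be * qe S x = be -> exists c : k, be = c *: path_elt k p0.
Proof.
move=> puniq yb bx; have [c E] := path_elt_corner be puniq; exists c.
apply: etrans (esym yb) _; apply: etrans E; apply: (congr1 (pamul _)); exact: esym bx.
Qed.

Hypothesis Q_acyclic : no_oriented_cycle Q.

Lemma acyclic_walk x s : walk x s -> walk_end x s = x -> s = [::].
Proof. by move=> ws es; apply/eqP/negP => /negP ns; have := Q_acyclic ns ws; rewrite es eqxx. Qed.

Lemma acyclic_loop x p : psrc p = x -> ptgt p = x -> p = pid x.
Proof.
case: p => -[z s] w /= ez; rewrite /psrc /= in ez; rewrite ez in w *.
move=> es; have s0 : s = [::] by exact: acyclic_walk w es.
by apply: val_inj; rewrite /= s0.
Qed.

Lemma acyclic_center (al : A) : (forall x, al * qe S x = qe S x * al) ->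
  exists m : vert Q -> k, forall x, al * qe S x = m x *: qe S x.
Proof.
move=> alC; have H x : exists c : k, al * qe S x = c *: qe S x.
  have [e1 e2] := qe_corner (alC x).
  exact: path_algebra_corner (fun p => @acyclic_loop x p) e1 e2.
by exists (fun x => sval (cid (H x))) => x; exact: svalP (cid (H x)).
Qed.

Lemma walk_potential (m : vert Q -> k) (x : vert Q) s : walk x s ->
  \sum_(b <- s) (m (tgt b) - m (src b)) = m (walk_end x s) - m x.
Proof.
elim: s x => [|b s IH] x /=; first by rewrite big_nil subrr.
by move=> /andP[/eqP <- /IH e]; rewrite big_cons e addrC addrA subrK.
Qed.

Hypothesis potential : forall lam : arr Q -> k, exists mu : vert Q -> k,
  forall a, lam a = mu (tgt a) - mu (src a).

(** Take the indicator of [a] as weight. Its potential gives every path parallel to [a] the total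
    weight 1, so the path contains [a]; what comes before and after [a] is closed, hence trivial by
    acyclicity. *)
Lemma arrow_unique_path a p : psrc p = src a -> ptgt p = tgt a -> p = qarr a.
Proof.
have [mu muE] := potential (fun b => (b == a)%:R).
case: p => -[x s] w; rewrite /psrc /ptgt /psrc /parr /= => ex; rewrite {x}ex in w *.
move=> es; have := walk_potential mu w; rewrite es -muE eqxx /= => sum1.
have as_ : a \in s.
  apply: contraT => nas; suff e10 : 1 = 0 :> k by have := oner_neq0 k; rewrite e10 eqxx.
  rewrite -[LHS]sum1 big_seq; apply: big1 => b bs.
  by rewrite -muE; case: eqP nas => // <-; rewrite bs.
apply: val_inj => /=; congr (_, _); case/splitPr: as_ w es {sum1} => s1 s2 /=.
rewrite walk_cat walk_end_cat /= => /and3P[w1 /eqP e1 w2] es.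
by rewrite (acyclic_walk w1 (esym e1)) (acyclic_walk w2 es).
Qed.

Lemma acyclic_arrow_corner a (be : A) : qe S (tgt a) * be = be -> be * qe S (src a) = be ->
  exists c : k, be = c *: qa S a.
Proof. by apply: path_algebra_corner => p; exact: arrow_unique_path. Qed.

(** For the indicator of the first arrow of the cycle, the total signed weight is 1 or -1, as no
    arrow of a graph cycle is repeated; but it telescopes to 0. *)
Lemma potential_no_graph_cycle x s : ~ @graph_cycle Q x s.
Proof.
case: s => [|[a e] s] [] // _ ws es _ /= /andP[as_ _].
have [mu muE] := potential (fun b => (b == a)%:R).
pose d (b : arr (double_quiver Q)) : k := mu (tgt b) - mu (src b).
have sum_d z t : walk z t -> \sum_(b <- t) d b = mu (walk_end z t) - mu z.
  elim: t z => [|b t IH] z /=; first by rewrite big_nil subrr.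
  by move=> /andP[/eqP <- /IH E]; rewrite big_cons E addrC addrA subrK.
have dE (b : arr Q) (c : bool) : d (b, c) = (-1) ^+ c * (b == a)%:R.
  by rewrite muE /d; case: c => /=; rewrite ?expr1 ?expr0 ?mul1r // mulN1r opprB.
have /eqP := sum_d _ _ ws; rewrite es subrr big_cons dE eqxx mulr1 big_seq big1 ?addr0 ?signr_eq0
  // => -[b c] bs.
rewrite dE; case: eqP => [ba|]; last by rewrite mulr0.
by case/negP: as_; apply/mapP; exists (b, c).
Qed.

End AcyclicPathAlgebra.

Theorem proposition1 (k : closedFieldType) (Q : quiver)
    (Q_connected : quiver_connected Q) (Q_acyclic : no_oriented_cycle Q)
    (T : lmodType (path_algebra k Q)) (T_tilting : tilting T)
    (n : nat) (X : 'I_n -> lmodType (path_algebra k Q))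
    (T_basic : basic_decomposition X T) :
  simply_connected (end_cat X) ->
  is_tree Q /\ HH1_vanishes (fun g f : modhom T T => hom_comp g f).
Proof.
move=> X_sc; have [T_rigid T_faithful T_centralizer T_lift] := tilting_properties T_tilting.
have [T_fin _ _ _] := T_tilting.
have [T_sum X_indec X_noniso] := T_basic.
have [inj [prj [inj_sum prj_inj prj_inj0]]] := direct_sum_proj T_sum.
pose S := path_quiver_algebra k Q.
have X_factor i : factors_through T (X i).
  by exists 1%N, (fun _ => inj i), (fun _ => prj i) => x; rewrite big_ord1 prj_inj.
have X_rigid i : Ext1_zero S (X i) (X i).
  apply: (Ext1_zero_retract (prj_inj i)).
  exact: Ext1_zero_factors (X_factor i) T_rigid.
have potential lam : exists mu : vert Q -> k, forall a, lam a = mu (tgt a) - mu (src a).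
  apply: (@weight_potential k Q _ S Q_connected (acyclic_center Q_acyclic) _ _ T n X inj prj) =>
    //.
  - by move=> x; exact: path_elt_neq0.
  - by move=> a; exact: path_elt_neq0.
split; first by split=> // x s; exact: (potential_no_graph_cycle potential).
move=> D D_deriv.
have [|nabla nablaE] := T_lift D.
  move=> b c; have := D_deriv b c; rewrite /hochschild_d1 addrAC => /eqP.
  by rewrite subr_eq0 => /eqP <-.
have [be beE] := inner_of_lift potential (acyclic_arrow_corner Q_acyclic potential) T_faithful
  T_centralizer nablaE.
(* [hochschild_d0] takes the commutator in the opposite order, whence the sign. *)
exists (- be) => b; rewrite beE /hochschild_d0; apply: hom_ext => t.
by rewrite -[RHS]/(b (- be t) - - be (b t)) linearN opprK addrC.
Qed.
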